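(* Let $k\in\mathbb{N}$, $\ell\in\mathbb{R}_+$ with $k\le\ell$, and let $\Phi(x)=\varphi_{\ell,k}(\|x\|_2)$ on $\mathbb{R}^{2k+1}$, where $\varphi_{\ell,k}$ is the Wu function. Then $$\mathcal{N}_\Phi(\mathbb{R}^{2k+1})=P*L^2(\mathbb{R}^{2k+1}):=\{P*g:g\in L^2(\mathbb{R}^{2k+1})\},$$ where $P(x)=\frac{\Gamma(\ell+1)}{\Gamma(\ell-k+1)}(2/\pi)^{k/2}(1-\|x\|_2^2)_+^{\ell-k}$. Moreover, the convolution operator $C_P:L^2(\mathbb{R}^{2k+1})\to\mathcal{N}_\Phi(\mathbb{R}^{2k+1})$, $C_Pg=P*g$, is a bijective isometry.
   Context: $\mathbb{R}_+=[0,\infty)$. For $\ell\ge0$ let $f_\ell(r)=(1-r^2)_+^\ell$ and $f_\ell*f_\ell(r)=\int_{\mathbb{R}}f_\ell(|y|)f_\ell(|r-y|)\,dy$, $r\ge0$. Let $\mathscr{D}\varphi(r):=-\frac1r\varphi'(r)$, $\mathscr{D}^k$ its $k$-fold iterate, and $\varphi_{\ell,k}(r):=\mathscr{D}^k(f_\ell*f_\ell)(r)$ (Wu function) for $k\in\mathbb{N}$, $\ell\in\mathbb{R}_+$, $k\le\ell$. The native space $\mathcal{N}_\Phi(\mathbb{R}^d)$ of a positive definite continuous function $\Phi$ is the reproducing kernel Hilbert space of real functions on $\mathbb{R}^d$ with reproducing kernel $(x,y)\mapsto\Phi(x-y)$, with its Hilbert norm. *)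

(* Defs.v *)
From HB Require Import structures.
From mathcomp Require Import all_boot all_order all_algebra.
From mathcomp Require Import all_classical all_reals all_analysis.
Set Implicit Arguments. Unset Strict Implicit. Unset Printing Implicit Defensive.
Import Order.TTheory GRing.Theory Num.Theory.
Import numFieldNormedType.Exports.
Local Open Scope classical_set_scope.
Local Open Scope ring_scope.

Section Defs.
Variable R : realType.

Definition tpow (x a : R) : R := if 0 < x then x `^ a else 0.

Definition f_trunc (l r : R) : R := tpow (1 - r ^+ 2) l.

Definition ff (l r : R) : R :=
  Rintegral lebesgue_measure setT (fun y => f_trunc l `|y| * f_trunc l `|r - y|).

Definition Dop (phi : R -> R) : R -> R := fun r => - (derive1 phi r) / r.

Definition wu (l : R) (k : nat) (r : R) : R :=
  if 0 < r then iter k Dop (ff l) r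
  else lim (iter k Dop (ff l) x @[x --> 0^'+]).

Definition Gamma (x : R) : R :=
  Rintegral lebesgue_measure `]0, +oo[ (fun t => t `^ (x - 1) * expR (- t)).

(* R^n as n-tuples of reals, with the product (Borel) sigma-algebra *)
Definition vsub n (x y : n.-tuple R) : n.-tuple R :=
  [tuple tnth x i - tnth y i | i < n].
Definition norm2 n (x : n.-tuple R) : R := Num.sqrt (\sum_(i < n) tnth x i ^+ 2).

(* Lebesgue integral on R^n of a nonnegative function, as an iterated
   integral (equal to the product-measure integral by Tonelli) *)
Fixpoint iint (n : nat) : (n.-tuple R -> \bar R) -> \bar R :=
  match n with
  | 0 => fun f => f [tuple]
  | n'.+1 => fun f => (\int[lebesgue_measure]_x iint (fun t => f (cons_tuple x t)))%E
  end.

Definition Rintn n (f : n.-tuple R -> R) : R :=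
  fine (iint (fun x => (Num.max (f x) 0)%:E)) - fine (iint (fun x => (Num.max (- f x) 0)%:E)).

Definition L2 n (g : n.-tuple R -> R) : Prop :=
  measurable_fun setT g /\ (iint (fun x => (g x ^+ 2)%:E) < +oo)%E.

Definition convol n (P g : n.-tuple R -> R) : n.-tuple R -> R :=
  fun x => Rintn (fun y => P (vsub x y) * g y).

Definition is_RKHS n (H : set (n.-tuple R -> R))
    (ip : (n.-tuple R -> R) -> (n.-tuple R -> R) -> R)
    (K : n.-tuple R -> n.-tuple R -> R) : Prop :=
  (H (fun _ => 0) /\
      (forall f g, H f -> H g -> H (fun x => f x + g x)) /\
      (forall (a : R) f, H f -> H (fun x => a * f x)) /\
      (forall f g h, H f -> H g -> H h ->
          ip (fun x => f x + g x) h = ip f h + ip g h) /\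
      (forall (a : R) f g, H f -> H g -> ip (fun x => a * f x) g = a * ip f g) /\
      (forall f g, H f -> H g -> ip f g = ip g f) /\
      (forall f, H f -> 0 <= ip f f) /\
      (forall f, H f -> ip f f = 0 -> f = (fun _ => 0)) /\
      (forall u : nat -> (n.-tuple R -> R), (forall m, H (u m)) ->
          (forall e : R, 0 < e -> exists N, forall p q, (N <= p)%N -> (N <= q)%N ->
              ip (fun x => u p x - u q x) (fun x => u p x - u q x) < e) ->
          exists f, H f /\ (forall e : R, 0 < e -> exists N, forall p, (N <= p)%N ->
              ip (fun x => u p x - f x) (fun x => u p x - f x) < e)) /\
      (forall y, H (fun x => K x y)) /\
      (forall f y, H f -> f y = ip f (fun x => K x y))).

End Defs.

(* Main.v *)
Require Import Defs.
From HB Require Import structures.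
From mathcomp Require Import all_boot all_order all_algebra.
From mathcomp Require Import all_classical all_reals all_analysis.
From mathcomp Require Import measurable_realfun.
From mathcomp Require Import ring lra.
Set Implicit Arguments. Unset Strict Implicit. Unset Printing Implicit Defensive.
Import Order.TTheory GRing.Theory Num.Theory.
Import numFieldNormedType.Exports.
Local Open Scope classical_set_scope.
Local Open Scope ring_scope.

(** Write [rho a s = (1 - s)_+^a].  Polar coordinates give
    [\int\int rho (a-1) (x^2 + y^2 + s) dx dy = (pi / a) rho a s]; integrating out
    two coordinates, the autoconvolution [q n a (|x|^2)] of [rho a (|y|^2)] on
    [R^n] satisfies [(pi / a)^2 q n a s = pi \int_0^oo q (n+2) (a-1) (s + t) dt].
    Differentiating in [s], the operator [D] sends [q n a] to [2 a^2 / pi] times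
    [q (n+2) (a-1)].  After [k] steps from [n = 1], [a = l], this says
    [Phi = P * P] on [R^(2k+1)], so the kernel section at [y] is [P * P(. - y)] and
    [P * L^2], normed through a preimage, reproduces [Phi].

    Injectivity of [C_P] is obtained without the Fourier transform.  If
    [P * g = 0], the commutator of convolution with the coordinate functions shows
    that [(z^s P) * g = 0] for every monomial [z^s], so for almost every [x] all
    moments of the compactly supported function [z |-> P z g(x - z)] vanish.  It
    is therefore null, and integrating in [x] gives [g = 0].

    Finally the span of the kernel sections is dense in any reproducing kernel
    Hilbert space, and the norm on that span is dictated by the kernel; hence the
    space and its norm are unique. *)

(** * Lebesgue measure on tuples of reals *)

(** The statement integrates over R^n by iterating one-dimensional integrals, so a sigma-finite
    measure with the same recursion is built to make Tonelli and dominated convergence available.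
    The exponent is real, so nothing can be expanded into polynomials; the pair (dimension,
    exponent) moves along (n, a), (n + 2, a - 1) instead, which is where 2k + 1 and l - k come from.
    Each move contributes 2 (l - i)^2 / pi, and the product over i < k is the square of the constant
    in front of P. The delicate case is l = k: there P is a multiple of the indicator of the open
    ball and jumps on the sphere, so continuity of the autoconvolution has to come from the sphere
    being null. A Fourier proof of injectivity would use that the transform of P vanishes only on a
    null set. Here the commutator with a coordinate plays the part of a derivative of the transform;
    as x_i g may leave L^2, coordinates are truncated first. The conclusion concerns every Hilbert
    space reproducing the kernel, whatever its inner product: hence one explicit model, then
    uniqueness. *)

Section TupleMeasure.
Context {R : realType}.
Local Notation leb := (@lebesgue_measure R).

Definition tcons n (p : measurableTypeR R * n.-tuple R) : n.+1.-tuple R := cons_tuple p.1 p.2.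

Lemma measurable_tcons n : measurable_fun setT (@tcons n).
Proof.
rewrite (_ : @tcons n = fun p => [the n.+1.-tuple R of p.1 :: p.2]).
  by apply: measurable_cons.
by apply/funext => p; apply/val_inj.
Qed.

Lemma measurable_tcons1 n (a : R) :
  measurable_fun setT (fun t : n.-tuple R => cons_tuple a t).
Proof.
rewrite (_ : (fun _ => _) = @tcons n \o pair a)//.
apply: measurableT_comp; first exact: measurable_tcons.
exact: pair1_measurable.
Qed.

Section Step.
Variables (n : nat) (m : {sigma_finite_measure set (n.-tuple R) -> \bar R}).

Definition step_fun : set (n.+1.-tuple R) -> \bar R := pushforward (leb \x m)%E (@tcons n).

Let step0 : step_fun set0 = 0%E.
Proof. by rewrite /step_fun /pushforward preimage_set0 measure0. Qed.

Let step_ge0 A : (0 <= step_fun A)%E.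
Proof. by rewrite /step_fun /pushforward; apply: measure_ge0. Qed.

Let step_sigma_additive : semi_sigma_additive step_fun.
Proof.
move=> F mF tF mUF; rewrite /step_fun /pushforward preimage_bigcup.
apply: measure_semi_sigma_additive.
- by move=> k; rewrite -[X in measurable X]setTI; exact: measurable_tcons.
- apply/trivIsetP => /= i j _ _ ij; rewrite -preimage_setI.
  by move/trivIsetP : tF => /(_ _ _ _ _ ij) ->//; rewrite preimage_set0.
- rewrite -preimage_bigcup -[X in measurable X]setTI; exact: measurable_tcons.
Qed.

HB.instance Definition _ := isMeasure.Build _ _ _ step_fun step0 step_ge0 step_sigma_additive.

(** [tcons] has the measurable inverse [un], so the boxes exhausting the product pull back to sets
    that exhaust the tuples and keep their finite measure. *)
Lemma step_sigma_finite : sigma_finite setT step_fun.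
Proof.
have /sigma_finiteP[F [TF ndF Foo]] := sigma_finiteT leb.
have /sigma_finiteP[G [TG ndG Goo]] := sigma_finiteT m.
pose un (x : n.+1.-tuple R) : measurableTypeR R * n.-tuple R := (thead x, [tuple of behead x]).
have unK x : tcons (un x) = x by rewrite /un /tcons [RHS]tuple_eta; apply/val_inj.
have consK p : un (tcons p) = p by case: p => a t; rewrite /un /tcons /=; congr pair; apply/val_inj.
have mun : measurable_fun setT un.
  apply/measurable_fun_pairP; split.
    rewrite (_ : _ \o _ = (fun x => tnth x ord0)) //; exact: measurable_tnth.
  exact: measurable_behead.
exists (fun k => un @^-1` (F k `*` G k)).
  apply/seteqP; split=> // x _.
  have : setT (un x).1 by []. rewrite TF => -[i _ Fi].
  have : setT (un x).2 by []. rewrite TG => -[j _ Gj].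
  exists (maxn i j) => //=; split.
    by move: Fi; apply/subsetPset/ndF/leq_maxl.
  by move: Gj; apply/subsetPset/ndG/leq_maxr.
move=> k; have [? ?] := Foo k; have [? ?] := Goo k; split.
  by rewrite -[X in measurable X]setTI; apply: mun => //; exact: measurableX.
rewrite /step_fun /pushforward (_ : _ @^-1` _ = F k `*` G k).
  by rewrite product_measure1E// lte_mul_pinfty// ge0_fin_numE.
apply/funext => p.
by rewrite -[LHS]/((F k `*` G k) (un (tcons p))) consK.
Qed.

HB.instance Definition _ := @Measure_isSigmaFinite.Build _ _ _ step_fun step_sigma_finite.

Definition step : {sigma_finite_measure set (n.+1.-tuple R) -> \bar R} := step_fun.

End Step.

Definition dirac0 : {sigma_finite_measure set ((0%N).-tuple R) -> \bar R} := \d_([tuple] : (0%N).-tuple R).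

(** The recursion copies that of [iint], starting from a unit mass at the empty tuple. Carrying
    sigma-finiteness in the type keeps Tonelli applicable at every level. *)
Fixpoint mu n : {sigma_finite_measure set (n.-tuple R) -> \bar R} :=
  match n with 0 => dirac0 | n'.+1 => step (mu n') end.

Lemma integral_mu0 (f : (0%N).-tuple R -> \bar R) :
  measurable_fun setT f -> (\int[mu 0]_x f x = f [tuple])%E.
Proof. by move=> mf; rewrite integral_dirac// diracT mul1e. Qed.

Lemma ge0_integral_muS n (f : n.+1.-tuple R -> \bar R) : measurable_fun setT f ->
  (forall x, 0 <= f x)%E ->
  (\int[mu n.+1]_x f x = \int[leb]_a \int[mu n]_t f (cons_tuple a t))%E.
Proof.
move=> mf f0.
rewrite [LHS](_ : _ = \int[pushforward (leb \x mu n)%E (@tcons n)]_x f x)%E//.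
rewrite ge0_integral_pushforward//; last exact: measurable_tcons.
have mft : measurable_fun setT (f \o @tcons n).
  by apply: measurableT_comp => //; exact: measurable_tcons.
by rewrite preimage_setT; apply: (fubini_tonelli1 (f \o @tcons n)) => // p; exact: f0.
Qed.

Lemma ge0_integral_muS2 n (f : n.+1.-tuple R -> \bar R) : measurable_fun setT f ->
  (forall x, 0 <= f x)%E ->
  (\int[mu n.+1]_x f x = \int[mu n]_t \int[leb]_a f (cons_tuple a t))%E.
Proof.
move=> mf f0.
rewrite [LHS](_ : _ = \int[pushforward (leb \x mu n)%E (@tcons n)]_x f x)%E//.
rewrite ge0_integral_pushforward//; last exact: measurable_tcons.
have mft : measurable_fun setT (f \o @tcons n).
  by apply: measurableT_comp => //; exact: measurable_tcons.
by rewrite preimage_setT; apply: (fubini_tonelli2 (f \o @tcons n)) => // p; exact: f0.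
Qed.

(** This is the bridge from the iterated integrals of the statement to the measure [mu]; Tonelli is
    already contained in [ge0_integral_muS]. *)
Lemma iintE n (f : n.-tuple R -> \bar R) : measurable_fun setT f ->
  (forall x, 0 <= f x)%E -> iint f = (\int[mu n]_x f x)%E.
Proof.
elim: n f => [|n IH] f mf f0; first by rewrite integral_mu0.
rewrite ge0_integral_muS//=; apply: eq_integral => a _; rewrite IH//.
by apply: measurableT_comp => //; exact: measurable_tcons1.
Qed.

End TupleMeasure.

(** * Isometries of the plane and of tuples *)

Section OneD.
Context {R : realType}.
Local Notation leb := (@lebesgue_measure R).
Local Notation Rm := (measurableTypeR R).
Local Open Scope ereal_scope.

(** The image of Lebesgue measure under the reflection gives half-open intervals their length, and
    this characterises Lebesgue measure. *)
Lemma ge0_integral_subl (a : R) (f : R -> \bar R) : measurable_fun setT f ->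
  (forall x, 0 <= f x) -> \int[leb]_x f (a - x)%R = \int[leb]_x f x.
Proof.
move=> mf f0; pose phi := (fun x => a - x)%R : Rm -> Rm.
have mphi : measurable_fun setT phi by apply: measurable_funB.
transitivity (\int[pushforward leb phi]_x f x).
  by rewrite ge0_integral_pushforward// preimage_setT.
apply: eq_measure_integral => A mA _.
apply/esym; apply: lebesgue_measure_unique => //.
move=> _ [[u v] _ <-] /=; rewrite /pushforward/=.
rewrite (_ : _ @^-1` _ = `[(a - v)%R, (a - u)%R[%classic); last first.
  by apply/seteqP; split=> x; rewrite /= !in_itv /= /phi; lra.
rewrite !lebesgue_measure_itv/= !lte_fin ltrD2l ltrN2.
case: ifP => // _; rewrite -!EFinB; congr EFin; lra.
Qed.

Lemma ge0_integral_addr (a : R) (f : R -> \bar R) : measurable_fun setT f ->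
  (forall x, 0 <= f x) -> \int[leb]_x f (x + a)%R = \int[leb]_x f x.
Proof.
move=> mf f0; rewrite -(@ge0_integral_subl a f)//.
(* A translation is a composite of two reflections. *)
rewrite -(@ge0_integral_subl 0%R (fun x => f (a - x)%R))//.
  by apply: eq_integral => x _; congr f; lra.
by apply: measurableT_comp => //; exact: measurable_funB.
Qed.

Lemma ge0_integral_scale (c : R) (f : R -> \bar R) : (0 < c)%R ->
  measurable_fun setT f -> (forall x, 0 <= f x) ->
  c%:E * \int[leb]_x f (c * x)%R = \int[leb]_x f x.
Proof.
move=> c0 mf f0; pose phi := (fun x => c * x)%R : Rm -> Rm.
have mphi : measurable_fun setT phi by apply: measurable_funM.
transitivity (c%:E * \int[pushforward leb phi]_x f x).
  by rewrite ge0_integral_pushforward// preimage_setT.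
have cnn : (0 <= c)%R := ltW c0.
rewrite -[c%:E]/((NngNum cnn)%:num)%:E -ge0_integral_mscale//.
apply: eq_measure_integral => A mA _.
apply/esym; apply: lebesgue_measure_unique => //.
move=> _ [[u v] _ <-] /=; rewrite /mscale/= /pushforward/=.
rewrite (_ : _ @^-1` _ = `](u / c)%R, (v / c)%R]%classic); last first.
  by apply/seteqP; split=> x; rewrite /= !in_itv /= /phi ltr_pdivrMr// ler_pdivlMr// mulrC.
rewrite !lebesgue_measure_itv/= !lte_fin ltr_pM2r ?invr_gt0//.
case: ifP => // _; last by rewrite mule0.
by rewrite -!EFinB -EFinM -mulrBl mulrC divfK// gt_eqF.
Qed.

Lemma ge0_fubini2 (F : Rm * Rm -> \bar R) : measurable_fun setT F ->
  (forall p, 0 <= F p) ->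
  \int[leb]_x \int[leb]_y F (x, y) = \int[leb]_y \int[leb]_x F (x, y).
Proof. by move=> mF F0; exact: (fubini_tonelli (m1 := leb) (m2 := leb) F mF F0). Qed.

(** For fixed [y] the shear is a translation in [x], so Tonelli is used to put the [x] integral
    inside. *)
Lemma ge0_shear1 (t : R) (F : Rm * Rm -> \bar R) : measurable_fun setT F ->
  (forall p, 0 <= F p) ->
  \int[leb]_x \int[leb]_y F ((x + t * y)%R, y) = \int[leb]_x \int[leb]_y F (x, y).
Proof.
move=> mF F0; pose G (p : Rm * Rm) := F ((p.1 + t * p.2)%R, p.2).
have mG : measurable_fun setT G.
  apply: measurableT_comp => //; apply: measurable_fun_pair => //=.
  by apply: measurable_funD => //; exact: measurable_funM.
apply: (etrans (ge0_fubini2 mG (fun p => F0 _))).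
apply: (etrans _ (esym (ge0_fubini2 mF F0))).
apply: eq_integral => y _.
apply: (@ge0_integral_addr (t * y)%R (fun x => F (x, y))) => //.
by apply: measurableT_comp => //; exact: pair2_measurable.
Qed.

Lemma ge0_shear2 (t : R) (F : Rm * Rm -> \bar R) : measurable_fun setT F ->
  (forall p, 0 <= F p) ->
  \int[leb]_x \int[leb]_y F (x, (y + t * x)%R) = \int[leb]_x \int[leb]_y F (x, y).
Proof.
move=> mF F0; apply: eq_integral => x _.
rewrite (@ge0_integral_addr (t * x)%R (fun y => F (x, y)))//.
by apply: measurableT_comp => //; exact: pair1_measurable.
Qed.

(* A plane rotation is a product of three shears. *)
Lemma ge0_rotation (c s : R) (F : Rm * Rm -> \bar R) : (c ^+ 2 + s ^+ 2 = 1)%R ->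
  measurable_fun setT F -> (forall p, 0 <= F p) ->
  \int[leb]_x \int[leb]_y F ((c * x - s * y)%R, (s * x + c * y)%R) =
  \int[leb]_x \int[leb]_y F (x, y).
Proof.
(* The half turn has no decomposition into the three shears; it is a reflection in each
   coordinate. *)
move=> cs mF F0; have [c1|c1] := eqVneq (1 + c)%R 0%R.
  have -> : s = 0%R by nra.
  have -> : c = (-1)%R by lra.
  have mH : measurable_fun setT (fun x => \int[leb]_y F (x, y)).
    exact: (measurable_fun_fubini_tonelli_F (m2 := leb) F mF F0).
  apply: (etrans _ (@ge0_integral_subl 0%R _ mH _)); last by move=> x; exact: integral_ge0.
  apply: eq_integral => x _.
  have mK : measurable_fun setT (fun y => F ((0 - x)%R, y)).
    by apply: measurableT_comp => //; exact: pair1_measurable.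
  apply: (etrans _ (@ge0_integral_subl 0%R _ mK (fun p => F0 _))).
  by apply: eq_integral => y _; congr (F (_, _)); lra.
(* Minus the tangent of half the angle, if [c] and [s] are its cosine and sine. *)
pose t := (- s / (1 + c))%R.
have st : (1 + s * t = c)%R.
  apply: (mulIf c1); rewrite /t mulrDl mul1r -mulrA divfK//; lra.
have tc : (t * (1 + c) = - s)%R by rewrite /t divfK.
pose F1 (p : Rm * Rm) := F ((p.1 + t * p.2)%R, p.2).
pose F2 (p : Rm * Rm) := F1 (p.1, (p.2 + s * p.1)%R).
have mF1 : measurable_fun setT F1.
  apply: measurableT_comp => //; apply: measurable_fun_pair => //=.
  by apply: measurable_funD => //; exact: measurable_funM.
have mF2 : measurable_fun setT F2.
  apply: measurableT_comp => //; apply: measurable_fun_pair => //=.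
  by apply: measurable_funD => //; exact: measurable_funM.
apply: (etrans _ (ge0_shear1 t mF F0)).
apply: (etrans _ (ge0_shear2 s mF1 (fun p => F0 _))).
apply: (etrans _ (ge0_shear1 t mF2 (fun p => F0 _))).
apply: eq_integral => x _; apply: eq_integral => y _.
rewrite /F2 /F1 /=; congr (F (_, _)).
  transitivity ((1 + s * t) * x + (t + t * (1 + s * t)) * y)%R; last by ring.
  by rewrite st -[X in (X + t * c)%R]mulr1 -mulrDr tc mulNr.
transitivity (s * x + (1 + s * t) * y)%R; last by ring.
by rewrite st.
Qed.

Lemma ge0_rotate_dot (a b : R) (F : Rm * Rm -> \bar R) :
  measurable_fun setT F -> (forall p, 0 <= F p) ->
  \int[leb]_x \int[leb]_y F ((x ^+ 2 + y ^+ 2)%R, (a * x + b * y)%R) =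
  \int[leb]_x \int[leb]_y
     F ((x ^+ 2 + y ^+ 2)%R, (Num.sqrt (a ^+ 2 + b ^+ 2) * x)%R).
Proof.
move=> mF F0; set r := Num.sqrt _.
have ab0 : (0 <= a ^+ 2 + b ^+ 2)%R by rewrite addr_ge0// sqr_ge0.
have r2 : (r ^+ 2 = a ^+ 2 + b ^+ 2)%R by rewrite sqr_sqrtr.
have [r0|r0] := eqVneq r 0%R.
  have [-> ->] : a = 0%R /\ b = 0%R by move: r2; rewrite r0; split; nra.
  by rewrite r0; apply: eq_integral => x _; apply: eq_integral => y _; rewrite !mul0r addr0.
pose G (p : Rm * Rm) := F ((p.1 ^+ 2 + p.2 ^+ 2)%R, (r * p.1)%R).
(* The rotation with cosine [a / r] and sine [- b / r] has [(a x + b y) / r] as its first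
   coordinate. *)
have cs : ((a / r) ^+ 2 + (- b / r) ^+ 2 = 1)%R.
  by rewrite !expr_div_n sqrrN -mulrDl r2 divff// -r2; exact: expf_neq0.
have mG : measurable_fun setT G.
  apply: measurableT_comp => //; apply: measurable_fun_pair => //=.
    by apply: measurable_funD => //; exact: measurable_funX.
  exact: measurable_funM.
apply: (etrans _ (ge0_rotation cs mG (fun p => F0 _))).
apply: eq_integral => x _; apply: eq_integral => y _; rewrite /G/=; congr (F (_, _)).
  apply: (mulfI (expf_neq0 2 r0)).
  by rewrite {1}r2; field.
by field.
Qed.

End OneD.

(** * Reflections of tuples and integrals depending on a norm and a dot product *)

Section Radial.
Context {R : realType}.
Local Notation leb := (@lebesgue_measure R).
Local Notation Rm := (measurableTypeR R).
Local Open Scope ereal_scope.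

Definition sqn n (x : n.-tuple R) : R := (\sum_(i < n) tnth x i ^+ 2)%R.
Definition dotp n (x y : n.-tuple R) : R := (\sum_(i < n) tnth x i * tnth y i)%R.

Lemma cons_tupleE n (x : n.+1.-tuple R) : x = cons_tuple (thead x) (behead_tuple x).
Proof. by rewrite {1}(tuple_eta x); apply/val_inj. Qed.

Lemma sqn_cons n a (t : n.-tuple R) : sqn (cons_tuple a t) = (a ^+ 2 + sqn t)%R.
Proof. by rewrite /sqn big_ord_recl; congr (_ + _)%R; apply: eq_bigr => i _; rewrite tnthS. Qed.

Lemma dotp_cons n a b (s t : n.-tuple R) :
  dotp (cons_tuple a s) (cons_tuple b t) = (a * b + dotp s t)%R.
Proof. by rewrite /dotp big_ord_recl; congr (_ + _)%R; apply: eq_bigr => i _; rewrite !tnthS. Qed.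

Lemma sqn_ge0 n (x : n.-tuple R) : (0 <= sqn x)%R.
Proof. by apply: sumr_ge0 => i _; exact: sqr_ge0. Qed.

Lemma tnth_vsub n (x y : n.-tuple R) i : tnth (vsub x y) i = (tnth x i - tnth y i)%R.
Proof. by rewrite tnth_mktuple. Qed.

Lemma vsub_cons n a b (s t : n.-tuple R) :
  vsub (cons_tuple a s) (cons_tuple b t) = cons_tuple (a - b)%R (vsub s t).
Proof.
apply: eq_from_tnth => i; rewrite tnth_vsub.
by case: (unliftP ord0 i) => [j ->|->]; rewrite ?tnthS ?tnth_vsub ?tnth0.
Qed.

Lemma sqn_vsub n (x y : n.-tuple R) : sqn (vsub x y) = (sqn x - 2 * dotp x y + sqn y)%R.
Proof.
rewrite /sqn /dotp mulr_sumr -sumrB -big_split/=; apply: eq_bigr => i _.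
by rewrite tnth_vsub; ring.
Qed.

Lemma vsubK n (a x : n.-tuple R) : vsub a (vsub a x) = x.
Proof. by apply: eq_from_tnth => i; rewrite !tnth_vsub; ring. Qed.

Lemma measurable_sqn n : measurable_fun setT (@sqn n).
Proof.
by apply: measurable_sum => i; apply: measurable_funX; exact: measurable_tnth.
Qed.

Lemma measurable_dotp n (x : n.-tuple R) : measurable_fun setT (dotp x).
Proof.
by apply: measurable_sum => i; apply: measurable_funM => //; exact: measurable_tnth.
Qed.

Lemma measurable_vsub n (x : n.-tuple R) : measurable_fun setT (vsub x).
Proof.
apply/measurable_fun_tnthP => i; rewrite (_ : _ \o _ = (fun y => tnth x i - tnth y i)%R).
  by apply: measurable_funB => //; exact: measurable_tnth.
by apply/funext => y /=; rewrite tnth_vsub.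
Qed.

Lemma measurable_vsubr n (x : n.-tuple R) : measurable_fun setT ((@vsub R n)^~ x).
Proof.
apply/measurable_fun_tnthP => i; rewrite (_ : _ \o _ = (fun y => tnth y i - tnth x i)%R).
  by apply: measurable_funB => //; exact: measurable_tnth.
by apply/funext => y /=; rewrite tnth_vsub.
Qed.

Lemma measurable_vsub2 n :
  measurable_fun setT (fun p : n.-tuple R * n.-tuple R => vsub p.1 p.2).
Proof.
apply/measurable_fun_tnthP => i.
rewrite (_ : _ \o _ = (fun p => tnth p.1 i - tnth p.2 i)%R).
  by apply: measurable_funB; apply: (measurableT_comp (measurable_tnth i)).
by apply/funext => y /=; rewrite tnth_vsub.
Qed.

Lemma measurable_comp_cons n (f : n.+1.-tuple R -> \bar R) a : measurable_fun setT f ->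
  measurable_fun setT (fun t => f (cons_tuple a t)).
Proof. by move=> mf; apply: measurableT_comp => //; exact: measurable_tcons1. Qed.

Lemma measurable_mu_tail n (f : n.+1.-tuple R -> \bar R) : measurable_fun setT f ->
  (forall x, 0 <= f x) -> measurable_fun setT (fun a => \int[mu n]_t f (cons_tuple a t)).
Proof.
move=> mf f0.
have mft : measurable_fun setT (f \o @tcons R n).
  by apply: measurableT_comp => //; exact: measurable_tcons.
exact: (measurable_fun_fubini_tonelli_F (m2 := mu n) _ mft (fun p => f0 _)).
Qed.

Lemma ge0_integral_vsubl n (a : n.-tuple R) (f : n.-tuple R -> \bar R) :
  measurable_fun setT f -> (forall x, 0 <= f x) ->
  \int[mu n]_y f (vsub a y) = \int[mu n]_y f y.
Proof.
elim: n a f => [|n IH] a f mf f0.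
  by apply: eq_integral => x _; congr f; apply: eq_from_tnth => -[].
have mfv : measurable_fun setT (fun y => f (vsub a y)).
  by apply: measurableT_comp => //; exact: measurable_vsub.
apply: (etrans (ge0_integral_muS mfv (fun p => f0 _))).
apply: (etrans _ (esym (ge0_integral_muS mf f0))).
apply: (etrans _ (@ge0_integral_subl _ (thead a) _ (measurable_mu_tail mf f0) _)); last first.
  by move=> x; exact: integral_ge0.
apply: eq_integral => x _.
apply: (etrans _ (IH [tuple of behead a] _ (measurable_comp_cons _ mf) (fun p => f0 _))).
by apply: eq_integral => t _; rewrite -vsub_cons; rewrite -cons_tupleE.
Qed.

Lemma ge0_integral_vsubr n (a : n.-tuple R) (f : n.-tuple R -> \bar R) :
  measurable_fun setT f -> (forall x, 0 <= f x) ->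
  \int[mu n]_y f (vsub y a) = \int[mu n]_y f y.
Proof.
move=> mf f0; pose z : n.-tuple R := [tuple of nseq n 0%R].
have mg : measurable_fun setT (fun y => f (vsub z y)).
  by apply: measurableT_comp => //; exact: measurable_vsub.
apply: (etrans _ (ge0_integral_vsubl z mf f0)).
apply: (etrans _ (ge0_integral_vsubl a mg (fun p => f0 _))).
apply: eq_integral => y _; congr f; apply: eq_from_tnth => i.
by rewrite !tnth_vsub tnth_nseq; ring.
Qed.

(* By induction the tail of [x] reduces to a single coordinate, which a plane
   rotation merges with the first one. *)
Lemma ge0_integral_radial n (x : n.+1.-tuple R) (F : Rm * Rm -> \bar R) :
  measurable_fun setT F -> (forall p, 0 <= F p) ->
  \int[mu n.+1]_y F (sqn y, dotp x y) =
  \int[mu n.+1]_y F (sqn y, (Num.sqrt (sqn x) * thead y)%R).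
Proof.
have mD (m : nat) (z : m.+1.-tuple R) G : measurable_fun setT G ->
    measurable_fun setT (fun y => G (sqn y, dotp z y) : \bar R).
  move=> mG; apply: (measurableT_comp mG); apply: measurable_fun_pair.
    exact: measurable_sqn.
  exact: measurable_dotp.
have mT (m : nat) (r : R) G : measurable_fun setT G ->
    measurable_fun setT (fun y : m.+1.-tuple R => G (sqn y, (r * thead y)%R) : \bar R).
  move=> mG; apply: (measurableT_comp mG); apply: measurable_fun_pair.
    exact: measurable_sqn.
  by apply: measurable_funM => //; exact: (measurable_tnth ord0).
elim: n x F => [|n IH] x F mF F0.
  apply: (etrans (ge0_integral_muS (mD _ _ _ mF) (fun p => F0 _))).
  apply: (etrans _ (esym (ge0_integral_muS (mT _ _ _ mF) (fun p => F0 _)))).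
  set G := (X in _ = \int[leb]_a X a).
  have mG : measurable_fun setT G.
    apply: (measurable_mu_tail (f := fun y => F (sqn y, (Num.sqrt (sqn x) * thead y)%R))).
      exact: mT.
    by move=> y; exact: F0.
  rewrite {}/G in mG *; move: mG; rewrite (cons_tupleE x).
  move: (thead x) (behead_tuple x : 0.-tuple R) => a t.
  have -> : sqn (cons_tuple a t) = (a ^+ 2)%R by rewrite sqn_cons /sqn big_ord0 addr0.
  have dE b (s : 0.-tuple R) : dotp (cons_tuple a t) (cons_tuple b s) = (a * b)%R.
    by rewrite dotp_cons /dotp big_ord0 addr0.
  rewrite sqrtr_sqr => mG; have [a0|a0] := leP 0%R a.
    by apply: eq_integral => b _; apply: eq_integral => s _; rewrite dE theadE ger0_norm.
  (* The square root of [a ^+ 2] is [- a] here, so the only coordinate has to be reflected. *)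
  apply: (etrans _ (@ge0_integral_subl _ 0%R _ mG _)); last first.
    by move=> y; exact: integral_ge0.
  apply: eq_integral => b _; apply: eq_integral => s _; congr (F (_, _)).
    by rewrite !sqn_cons sub0r sqrrN.
  by rewrite dE theadE ltr0_norm// sub0r mulrNN.
rewrite (cons_tupleE x); move: (thead x) (behead_tuple x : n.+1.-tuple R) => x0 x'.
set r := Num.sqrt (sqn x').
have r2 : (r ^+ 2 = sqn x')%R by rewrite sqr_sqrtr// sqn_ge0.
(* The coordinates beyond the first two enter only through their norm; integrating them out leaves a
   function on the plane, where a rotation can act. *)
pose G (p : Rm * Rm) := \int[mu n]_t F ((p.1 + sqn t)%R, p.2).
have mG : measurable_fun setT G.
  pose H (q : (Rm * Rm) * n.-tuple R) := F ((q.1.1 + sqn q.2)%R, q.1.2).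
  have mH : measurable_fun setT H.
    apply: (measurableT_comp mF); apply: measurable_fun_pair.
      apply: measurable_funD; first by apply: measurableT_comp.
      by apply: measurableT_comp => //; exact: measurable_sqn.
    by apply: measurableT_comp.
  exact: (measurable_fun_fubini_tonelli_F (m2 := mu n) H mH (fun p => F0 _)).
have G0 p : 0 <= G p by exact: integral_ge0.
apply: (etrans (ge0_integral_muS (mD _ _ _ mF) (fun p => F0 _))).
apply: (etrans _ (esym (ge0_integral_muS (mT _ _ _ mF) (fun p => F0 _)))).
have e1 a : \int[mu n.+1]_t F (sqn (cons_tuple a t), dotp (cons_tuple x0 x') (cons_tuple a t)) =
    \int[leb]_b G ((a ^+ 2 + b ^+ 2)%R, (x0 * a + r * b)%R).
  pose Fa (p : Rm * Rm) := F ((a ^+ 2 + p.1)%R, (x0 * a + p.2)%R).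
  have mFa : measurable_fun setT Fa.
    by apply: (measurableT_comp mF); apply: measurable_fun_pair; apply: measurable_funD.
  transitivity (\int[mu n.+1]_t Fa (sqn t, dotp x' t)).
    by apply: eq_integral => t _; rewrite sqn_cons dotp_cons.
  apply: (etrans (IH _ _ mFa (fun p => F0 _))).
  apply: (etrans (ge0_integral_muS (mT _ _ _ mFa) (fun p => F0 _))).
  by apply: eq_integral => b _; apply: eq_integral => t _; rewrite /Fa/= sqn_cons theadE addrA.
have e2 a : \int[mu n.+1]_t F (sqn (cons_tuple a t),
       (Num.sqrt (sqn (cons_tuple x0 x')) * thead (cons_tuple a t))%R) =
    \int[leb]_b G ((a ^+ 2 + b ^+ 2)%R, (Num.sqrt (x0 ^+ 2 + r ^+ 2) * a)%R).
  rewrite sqn_cons -r2; set q := Num.sqrt _.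
  have mF' := measurable_comp_cons a (mT n.+1 q _ mF).
  apply: (etrans (ge0_integral_muS mF' (fun p => F0 _))).
  by apply: eq_integral => b _; apply: eq_integral => t _; rewrite !sqn_cons theadE addrA.
transitivity (\int[leb]_a \int[leb]_b G ((a ^+ 2 + b ^+ 2)%R, (x0 * a + r * b)%R)).
  by apply: eq_integral => a _; exact: e1.
apply: (etrans (ge0_rotate_dot x0 r mG G0)).
by apply: eq_integral => a _; rewrite -e2.
Qed.

End Radial.

(** * Polar coordinates *)

Section Polar.
Context {R : realType}.
Local Notation leb := (@lebesgue_measure R).
Local Notation Rm := (measurableTypeR R).
Local Open Scope ereal_scope.

Lemma integral_expRN (s : R) :
  \int[leb]_(t in `[s, +oo[) (expR (- t))%:E = (expR (- s))%:E.
Proof.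
rewrite (@ge0_continuous_FTC2y _ _ (fun t => - expR (- t))%R s 0%R).
- by rewrite -EFinB sub0r opprK.
- by move=> x _; exact: expR_ge0.
- apply: continuous_subspaceT => x.
  by apply: continuous_comp; [exact: opp_continuous|exact: continuous_expR].
- rewrite -[X in _ --> X]oppr0; apply: cvgN.
  exact: cvgr_expR.
- by move=> x _; exact: ex_derive.
- apply: cvg_at_right_filter; apply: cvgN.
  by apply: continuous_comp; [exact: opp_continuous|exact: continuous_expR].
- by move=> x _; rewrite derive1E derive_val /GRing.scale/=; ring.
Qed.

Definition sq2 (p : Rm * Rm) : Rm := (p.1 ^+ 2 + p.2 ^+ 2)%R.

Lemma measurable_sq2 : measurable_fun setT sq2.
Proof. by apply: measurable_funD; apply: measurable_funX. Qed.

Lemma integral_push_sq2 (u : R -> \bar R) : measurable_fun setT u -> (forall x, 0 <= u x) ->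
  \int[pushforward (leb \x leb) sq2]_s u s =
  \int[leb]_x \int[leb]_y u (x ^+ 2 + y ^+ 2)%R.
Proof.
move=> mu u0; rewrite ge0_integral_pushforward//; last exact: measurable_sq2.
rewrite preimage_setT; have mc : measurable_fun setT (u \o sq2).
  by apply: measurableT_comp => //; exact: measurable_sq2.
exact: (fubini_tonelli1 (m1 := leb) (m2 := leb) _ mc (fun p => u0 _)).
Qed.

Lemma push_sq2E (A : set R) : measurable A -> pushforward (leb \x leb) sq2 A =
  \int[leb]_x \int[leb]_y (\1_A (x ^+ 2 + y ^+ 2)%R)%:E.
Proof.
move=> mA; rewrite -(@integral_push_sq2 (fun s => (\1_A s)%:E))//; last exact/measurable_EFinP.
by rewrite integral_indic ?setIT//; exact: measurable_sq2.
Qed.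

Definition indic_sq2 (c : R) (p : Rm * Rm) : \bar R :=
  (\1_(`]-oo, c]%classic : set R) (p.1 ^+ 2 + p.2 ^+ 2)%R)%:E.

Lemma measurable_indic_sq2 c : measurable_fun setT (indic_sq2 c).
Proof.
apply: (measurableT_comp (f := fun s : R => (\1_(`]-oo, c]%classic : set R) s)%:E)).
  exact/measurable_EFinP.
exact: measurable_sq2.
Qed.

Lemma indic_sq2_ge0 c p : 0 <= indic_sq2 c p.
Proof. by rewrite lee_fin. Qed.

Local Notation nu := (pushforward (leb \x leb) sq2).

(** The preimage of the half-line is the disc of radius [c]; scaling the two coordinates gives one
    factor [c] each. The area is thus linear in the squared radius. *)
Lemma push_sq2_scale (c : R) : (0 < c)%R ->
  nu `]-oo, (c ^+ 2)%R] = (c ^+ 2)%:E * nu `]-oo, 1%R].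
Proof.
move=> c0; rewrite !push_sq2E//.
pose H := indic_sq2 (c ^+ 2); have mH : measurable_fun setT H := measurable_indic_sq2 _.
have H0 p : 0 <= H p := indic_sq2_ge0 _ _.
have mH1 : measurable_fun setT (fun x => \int[leb]_y H (x, y)).
  exact: (measurable_fun_fubini_tonelli_F (m2 := leb) H mH H0).
have H10 x : 0 <= \int[leb]_y H (x, y) by exact: integral_ge0.
apply: (etrans (esym (ge0_integral_scale c0 mH1 H10))).
have c2 : (0 < c ^+ 2)%R by rewrite exprn_gt0.
rewrite [X in _ = X%:E * _]expr2 EFinM -muleA; congr (_ * _).
rewrite -ge0_integralZl//; last 3 first.
- exact: (measurable_fun_fubini_tonelli_F (m2 := leb) _ (measurable_indic_sq2 1) (indic_sq2_ge0 1)).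
- by move=> x _; apply: integral_ge0 => y _; rewrite lee_fin.
- by rewrite lee_fin ltW.
apply: eq_integral => x _.
have mHx : measurable_fun setT (fun y => H ((c * x)%R, y)).
  by apply: measurableT_comp => //; exact: pair1_measurable.
apply: (etrans (esym (ge0_integral_scale c0 mHx (fun y => H0 _)))).
congr (_ * _); apply: eq_integral => y _; rewrite /H/indic_sq2/= !indicE; congr (_%:R%:E).
by rewrite !mem_setE !in_itv/= !exprMn -mulrDr -[leRHS]mulr1 ler_pM2l.
Qed.

Lemma push_sq2_le0 (c : R) : (c <= 0)%R -> nu `]-oo, c] = 0.
Proof.
move=> c0; rewrite push_sq2E// integral0_eq// => x _.
apply/eqP; rewrite eq_le; apply/andP; split; last first.
  by apply: integral_ge0 => y _; rewrite lee_fin.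
(* For [c <= 0] every slice of the preimage lies in a single point. *)
have <- : \int[leb]_y (\1_[set 0%R] y)%:E = 0.
  by rewrite integral_indic// setIT; exact: lebesgue_measure_set1.
apply: ge0_le_integral => //.
- exact: (measurableT_comp (measurable_indic_sq2 c) (pair1_measurable x)).
- exact/measurable_EFinP.
move=> y _; rewrite lee_fin !indicE; case: (boolP (_ \in `]-oo, c]%classic)) => //.
rewrite inE/= in_itv/= => xy; have -> : y = 0%R.
  by have := sqr_ge0 x; have := sqr_ge0 y; nra.
by rewrite mem_set.
Qed.

Lemma indic_EFin_ge0 (A : set R) x : 0 <= (\1_A x)%:E :> \bar R.
Proof. by rewrite lee_fin. Qed.

(** The unit disc lies in the square with side 2. *)
Lemma push_sq2_1_fin : nu `]-oo, 1%R] < +oo.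
Proof.
rewrite push_sq2E//.
pose H := indic_sq2 1.
pose I : set R := `[(-1)%R, 1%R]%classic.
apply: (@le_lt_trans _ _ (\int[leb]_x \int[leb]_y ((\1_I x)%:E * (\1_I y)%:E))).
  have mH : measurable_fun setT H := measurable_indic_sq2 1.
  have mK : measurable_fun setT (fun p : Rm * Rm => (\1_I p.1)%:E * (\1_I p.2)%:E : \bar R).
    have mI : measurable (I : set Rm) by exact: measurable_itv.
    have m1 : measurable_fun setT (\1_I : Rm -> R) by exact: measurable_indic.
    apply: emeasurable_funM; apply/measurable_EFinP.
      exact: (measurableT_comp m1 measurable_fst).
    exact: (measurableT_comp m1 measurable_snd).
  apply: ge0_le_integral => //.
  - by move=> x _; exact: integral_ge0.
  - exact: (measurable_fun_fubini_tonelli_F (m2 := leb) H mH (indic_sq2_ge0 1)).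
  - exact: (measurable_fun_fubini_tonelli_F (m2 := leb) _ mK (fun p => mule_ge0 (indic_EFin_ge0 _ _) (indic_EFin_ge0 _ _))).
  - move=> x _; apply: ge0_le_integral => //.
    + exact: (measurableT_comp mH (pair1_measurable x)).
    + exact: (measurableT_comp mK (pair1_measurable x)).
    + move=> y _; rewrite -EFinM lee_fin !indicE !mem_setE !in_itv/=.
      rewrite -natrM ler_nat; case: leP => // xy.
      have := sqr_ge0 x; have := sqr_ge0 y => x2 y2.
      have -> : (-1 <= x <= 1)%R by apply/andP; split; nra.
      by have -> : (-1 <= y <= 1)%R by apply/andP; split; nra.
have lI : leb I = 2%:E by rewrite /I lebesgue_measure_itv/= lte_fin ifT -?EFinB ?opprK//; lra.
have mI : measurable (I : set Rm) by exact: measurable_itv.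
have m1 : measurable_fun setT (EFin \o (\1_I : Rm -> R)).
  by apply/measurable_EFinP; exact: measurable_indic.
have -> : \int[leb]_x \int[leb]_y ((\1_I x)%:E * (\1_I y)%:E) =
    \int[leb]_x ((\1_I x)%:E * 2%:E) :> \bar R.
  apply: eq_integral => x _; rewrite ge0_integralZl//.
  by congr (_ * _); rewrite integral_indic// setIT; exact: lI.
rewrite ge0_integralZr// integral_indic// setIT.
by rewrite [X in X * _](_ : _ = 2%:E)// -EFinM ltry.
Qed.

Lemma push_sq2_halfline (c : R) : nu `]-oo, c] = nu `]-oo, 1%R] * (Num.max c 0)%:E.
Proof.
have [c0|c0] := leP c 0%R; first by rewrite push_sq2_le0// mule0.
have -> : c = (Num.sqrt c ^+ 2)%R by rewrite sqr_sqrtr// ltW.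
by rewrite push_sq2_scale ?sqrtr_gt0// muleC.
Qed.

Let C := fine (nu `]-oo, 1%R]).
Let CE : C%:E = nu `]-oo, 1%R].
Proof.
rewrite /C fineK// ge0_fin_numE; first exact: push_sq2_1_fin.
by rewrite /pushforward; exact: measure_ge0.
Qed.
Let C0 : (0 <= C)%R.
Proof. by rewrite /C fine_ge0// /pushforward; exact: measure_ge0. Qed.

(* Scaling determines this pushforward up to the constant [C]; the Gaussian
   integral shows [C = pi] in [ge0_integral_polar]. *)
Lemma push_sq2_lebesgue (A : set R) : measurable A ->
  nu A = C%:E * leb (A `&` `]0%R, +oo[).
Proof.
move=> mA.
have mD : measurable (`]0%R, +oo[%classic : set Rm) by [].
pose m2 := mscale (NngNum C0) (mrestr leb mD).
transitivity (m2 A); last by [].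
pose g (k : nat) : set Rm := `](- k%:R)%R, k%:R%R]%classic.
pose nuM : {measure set Rm -> \bar R} :=
  measure_function_pushforward__canonical__measure_function_Measure (leb \x leb) measurable_sq2.
rewrite -[LHS]/(nuM A).
apply: (@measure_unique _ R Rm (@ocitv R) g _ _ _ _ nuM m2) => //.
- exact: ocitvI.
- by move=> k; exact: is_ocitv.
- apply/seteqP; split => // x _; exists (Num.bound `|x|%R) => //.
  rewrite /g /= in_itv/=; have := archi_boundP (normr_ge0 x).
  by rewrite ltr_norml => /andP[-> /ltW ->].
- move=> _ [[a b] _ <-] /=; rewrite /m2 /mscale/= /mrestr.
  have [ab|ba] := leP a b; last first.
    rewrite (_ : `]a, b]%classic = set0) ?set0I ?measure0 ?mule0//.
      exact: measurable_sq2.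
    by apply/seteqP; split=> x //=; rewrite in_itv/=; lra.
  have eqU : (`]-oo, b]%classic : set Rm) = `]-oo, a] `|` `]a, b].
    apply/seteqP; split=> x /=; rewrite !in_itv/=.
      by move=> xb; case: (leP x a) => xa; [left|right].
    by case=> [/le_trans-> //|/andP[]].
  (* Areas of half-lines are finite, so the mass of an interval is a difference of two of them. *)
  have nuU : nu `]-oo, b] = nu `]-oo, a] + nu `]a, b].
    rewrite eqU; apply: (measureU nuM) => //.
    by apply/seteqP; split=> x //= []; rewrite !in_itv/=; lra.
  have -> : nu `]a, b] = C%:E * (Num.max b 0 - Num.max a 0)%:E.
    have: nu `]a, b] = nu `]-oo, b] - nu `]-oo, a].
      by rewrite nuU (addeC (nu `]-oo, a])) addeK// (push_sq2_halfline a) -CE -EFinM.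
    by rewrite (push_sq2_halfline a) (push_sq2_halfline b) -CE => ->; rewrite -!(EFinM C) mulrBr EFinB.
  congr (_ * _).
  have -> : `]a, b] `&` `]0%R, +oo[ = `](Num.max a 0%R), b]%classic.
    apply/seteqP; split=> x /=; rewrite !in_itv/= andbT gt_max; first by case=> /andP[-> ->] ->.
    by move=> /andP[/andP[-> ->] ->].
  rewrite lebesgue_measure_itv/= lte_fin.
  have [b0|b0] := leP b 0%R.
    by rewrite !max_r ?(le_trans ab)// ltNge b0/= subrr.
  have mab : (Num.max a 0 <= b)%R by rewrite ge_max ab ltW.
  move: mab; rewrite le_eqVlt => /predU1P[->|h]; first by rewrite ltxx subrr.
  by rewrite h EFinB.
- move=> k; have le : nuM (g k) <= nuM `]-oo, k%:R]%classic.
    apply: le_measure; rewrite ?mem_set//; first exact: measurable_itv.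
    by move=> x; rewrite /g/= !in_itv/= => /andP[].
  by apply: (le_lt_trans le); rewrite [ltLHS](push_sq2_halfline k%:R) -CE -EFinM ltry.
Qed.

Lemma ge0_integral_push_sq2 (u : R -> \bar R) : measurable_fun setT u -> (forall x, 0 <= u x) ->
  \int[leb]_x \int[leb]_y u (x ^+ 2 + y ^+ 2)%R = C%:E * \int[leb]_(s in `]0%R, +oo[) u s.
Proof.
move=> mu u0; apply: (etrans (esym (integral_push_sq2 mu u0))).
have mD : measurable (`]0%R, +oo[%classic : set Rm) by [].
pose nuM : {measure set Rm -> \bar R} :=
  measure_function_pushforward__canonical__measure_function_Measure (leb \x leb) measurable_sq2.
have nu0 : nuM (~` `]0%R, +oo[) = 0.
  rewrite [LHS](@push_sq2_lebesgue (~` `]0%R, +oo[)) ?setICl ?measure0 ?mule0//.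
  exact: measurableC.
rewrite -[LHS]/(\int[nuM]_s u s) -(setUv `]0%R, +oo[%classic).
rewrite ge0_integral_setU//=; last 3 first.
- exact: measurableC.
- by rewrite setUv.
- by rewrite disj_set2E setICr.
rewrite [X in _ + X]null_set_integral//; last 2 first.
- exact: measurableC.
- exact: measurable_funS mu.
rewrite adde0 -[C%:E]/((NngNum C0)%:num)%:E -ge0_integral_mscale//; last exact: measurable_funS mu.
apply: (@eq_measure_integral _ _ _ _ (mscale (NngNum C0) leb) nuM) => A mA AD.
  by apply: (etrans (push_sq2_lebesgue mA)); rewrite setIidl.
exact: measurable_sq2.
Qed.

Lemma ge0_integral_polar (u : R -> \bar R) : measurable_fun setT u -> (forall x, 0 <= u x) ->
  \int[leb]_x \int[leb]_y u (x ^+ 2 + y ^+ 2)%R = pi%:E * \int[leb]_(s in `]0%R, +oo[) u s.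
Proof.
suff -> : pi = C by exact: ge0_integral_push_sq2.
have me : measurable_fun setT (fun s : R => (expR (- s))%:E).
  apply/measurable_EFinP; apply: measurableT_comp => //.
have := ge0_integral_push_sq2 me (fun s => expR_ge0 _).
rewrite integral_itv_obnd_cbnd; last exact: measurable_funS me.
rewrite integral_expRN oppr0 expR0 mule1 => /esym CE'; apply: EFin_inj.
apply/esym; apply: (etrans CE').
have mg : measurable_fun setT (fun x : R => (gauss_fun x)%:E).
  by apply/measurable_EFinP; exact: measurable_gauss_fun.
transitivity (\int[leb]_x ((gauss_fun x)%:E * (Num.sqrt pi)%:E)).
  apply: eq_integral => x _; rewrite -integralT_gauss -ge0_integralZl//.
  - by apply: eq_integral => y _; rewrite -EFinM /gauss_fun -expRD opprD.
  - by move=> y _; rewrite lee_fin gauss_fun_ge0.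
  - by rewrite lee_fin gauss_fun_ge0.
rewrite ge0_integralZr//; last by move=> y _; rewrite lee_fin gauss_fun_ge0.
by rewrite [X in X * _]integralT_gauss -EFinM -expr2 sqr_sqrtr// pi_ge0.
Qed.

End Polar.

(** * Truncated powers and the dimension walk *)

Section PowerIntegral.
Context {R : realType}.
Local Notation leb := (@lebesgue_measure R).
Local Notation Rm := (measurableTypeR R).
Local Open Scope ereal_scope.

Lemma derivable_powRl (b x : R) : (0 < x)%R -> derivable (@powR R ^~ b) x 1.
Proof. by move=> x0; have [] := is_derive1_powR b x0. Qed.

Lemma powR_continuous (b x : R) : (0 < x)%R -> {for x, continuous (@powR R ^~ b)}.
Proof.
move=> x0; apply: differentiable_continuous.
exact/derivable1_diffP/derivable_powRl.
Qed.

Lemma powR_cvg_right (b x : R) : (0 <= b)%R -> (0 <= x)%R ->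
  (y `^ b)%R @[y --> x^'+] --> (x `^ b)%R.
Proof.
(* Since 0 to the power 0 is 1, the exponent 0 gives a constant function, continuous from the right
   at 0 as well. *)
move=> b0 x0; have [->|bn0] := eqVneq b 0%R.
  by rewrite powRr0; under eq_fun do rewrite powRr0; exact: cvg_cst.
move: x0; rewrite le_eqVlt => /predU1P[<-|x0].
  by rewrite powR0//; apply: powR_cvg0; rewrite lt_neqAle eq_sym bn0.
exact/cvg_at_right_filter/powR_continuous.
Qed.

Lemma integral_powR (b c : R) : (0 <= b)%R -> (0 < c)%R ->
  \int[leb]_(x in `[0%R, c]) (x `^ b)%:E = (c `^ (b + 1) / (b + 1))%:E.
Proof.
move=> b0 c0; have b1 : (0 < b + 1)%R by lra.
rewrite (@continuous_FTC2 _ _ (fun x => x `^ (b + 1) / (b + 1))%R)//.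
- by rewrite -EFinB powR0 ?gt_eqF// mul0r subr0.
- apply/continuous_within_itvP => //; split.
  + by move=> x; rewrite in_itv/= => /andP[x0 _]; exact: powR_continuous.
  + exact: powR_cvg_right.
  + exact/cvg_at_left_filter/powR_continuous.
- split.
  + move=> x; rewrite in_itv/= => /andP[x0 _]; apply: derivableM => //.
    by exact: derivable_powRl.
  + by apply: cvgM; [apply: powR_cvg_right => //; exact: ltW|exact: cvg_cst].
  + by apply: cvgM; [exact/cvg_at_left_filter/powR_continuous|exact: cvg_cst].
- move=> x; rewrite in_itv/= => /andP[x0 _].
  rewrite derive1E deriveM//; last by exact: derivable_powRl.
  have := is_derive1_powR (b + 1)%R x0 => /@derive_val ->.
  rewrite derive_cst scaler0 add0r /GRing.scale/= addrK; field.
  by rewrite gt_eqF.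
Qed.

(** The argument stands for a squared radius, in which polar integration becomes a translation. For
    exponent 0 this is the indicator of [s < 1]. *)
Definition rho (a s : R) : R := tpow (1 - s) a.

Lemma measurable_tpow (a : R) : measurable_fun setT ((@tpow R)^~ a).
Proof.
apply: measurable_fun_ifT => //=.
by apply: measurable_fun_ltr.
Qed.

Lemma measurable_rho a : measurable_fun setT (rho a).
Proof.
apply: (measurableT_comp (measurable_tpow a)).
exact: measurable_funB.
Qed.

Lemma rho_ge0 a s : (0 <= rho a s)%R.
Proof. by rewrite /rho /tpow; case: ifP => // _; exact: powR_ge0. Qed.

Lemma rho_le1 a s : (0 <= a)%R -> (0 <= s)%R -> (rho a s <= 1)%R.
Proof.
move=> a0 s0; rewrite /rho /tpow; case: ifP => // s1.
have := @ge0_ler_powR R a a0 (1 - s)%R 1%R; rewrite powR1; apply; rewrite ?nnegrE//; lra.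
Qed.

Lemma rho0 a s : (1 <= s)%R -> rho a s = 0%R.
Proof. by move=> s1; rewrite /rho /tpow ifN// -leNgt subr_le0. Qed.

(** The point 1 is excluded because of the jump there when [a] is 0. *)
Lemma rho_continuous a s : s != 1%R -> {for s, continuous (rho a)}.
Proof.
rewrite neq_lt => /orP[s1|s1].
- have : {for s, continuous (fun t : R => (1 - t) `^ a)%R}.
    apply: (@continuous_comp _ _ _ (fun t : R => 1 - t)%R (@powR R ^~ a)).
      by apply: continuousB; [exact: cst_continuous|].
    by apply: powR_continuous; rewrite subr_gt0.
  rewrite /prop_for /continuous_at [rho a s]/rho /tpow subr_gt0 s1.
  apply: cvg_trans; apply: near_eq_cvg; near=> t.
  by rewrite /rho /tpow subr_gt0 ifT//; near: t; exact: lt_nbhsl.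
- rewrite /prop_for /continuous_at rho0 ?ltW//.
  apply: cvg_near_cst; near=> t; rewrite rho0//; near: t.
  by apply: filterS (lt_nbhsr s1) => x /ltW.
Unshelve. all: by end_near. Qed.

Lemma integral_rho (a s : R) : (1 <= a)%R ->
  \int[leb]_(t in `]0%R, +oo[) (rho (a - 1) (t + s))%:E = (rho a s / a)%:E.
Proof.
move=> a1; have [s1|s1] := leP 1%R s.
  rewrite rho0// mul0r integral0_eq// => t; rewrite /= in_itv/= andbT => t0.
  by rewrite rho0//; lra.
pose c := (1 - s)%R; have c0 : (0 < c)%R by rewrite subr_gt0.
have mr : measurable_fun setT (fun t : R => (rho (a - 1) (t + s))%:E).
  apply/measurable_EFinP; apply: (measurableT_comp (measurable_rho _)).
  exact: measurable_funD.
(* Reflecting [t] to [c - t] turns the integral into that of a pure power over the interval from 0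
   to [c]. *)
pose G (x : R) : \bar R := ((fun x => (x `^ (a - 1))%:E) \_ `]0%R, c[) x.
transitivity (\int[leb]_t G (c - t)%R).
  rewrite integral_mkcond; apply: eq_integral => t _; rewrite /G !patchE.
  rewrite !mem_setE !in_itv/= andbT /rho /tpow.
  have -> : (1 - (t + s) = c - t)%R by rewrite /c; ring.
  rewrite ltrBlDr ltrDl; case: ltP => t0; last by rewrite andbF.
  by rewrite andbT; case: ifP.
have mG : measurable_fun setT G.
  apply/measurable_restrict => //; apply/measurable_EFinP/measurable_funTS.
  exact: measurable_powR.
apply: (etrans (ge0_integral_subl c mG _)).
  by move=> x; rewrite /G patchE; case: ifP => // _; rewrite lee_fin powR_ge0.
rewrite -integral_mkcond.
have -> : rho a s = (c `^ (a - 1 + 1))%R by rewrite /rho /tpow c0 subrK.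
rewrite -[X in (_ / X)%:E](subrK 1%R a) -integral_powR//; last by rewrite subr_ge0.
rewrite (@integral_itv_bndoo _ _ _ (fun x => (x `^ (a - 1))%:E) true false)//.
apply/measurable_EFinP/measurable_funTS; exact: measurable_powR.
Qed.

Lemma integral2_rho (a s : R) : (1 <= a)%R ->
  \int[leb]_x \int[leb]_y (rho (a - 1) (x ^+ 2 + y ^+ 2 + s))%:E = (pi / a * rho a s)%:E.
Proof.
move=> a1.
have mr : measurable_fun setT (fun t : R => (rho (a - 1) (t + s))%:E).
  apply/measurable_EFinP; apply: (measurableT_comp (measurable_rho _)).
  exact: measurable_funD.
apply: (etrans (@ge0_integral_polar R (fun t => (rho (a - 1) (t + s))%:E) mr _)).
  by move=> t; rewrite lee_fin rho_ge0.
by rewrite integral_rho// -EFinM; congr EFin; ring.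
Qed.

End PowerIntegral.

(** * Autoconvolution of truncated powers and its radial form *)

Section AutoConv.
Context {R : realType}.
Local Notation leb := (@lebesgue_measure R).
Local Notation Rm := (measurableTypeR R).
Local Open Scope ereal_scope.

Definition autoconv n a (x : n.-tuple R) : \bar R :=
  \int[mu n]_y (rho a (sqn y) * rho a (sqn (vsub x y)))%:E.

(** This is the autoconvolution at the point [r] of the first axis, with the squared distance from
    that point to [y] expanded. *)
Definition autoconv_axis n a (r : R) : \bar R :=
  \int[mu n.+1]_y (rho a (sqn y) * rho a (sqn y - 2 * (r * thead y) + r ^+ 2))%:E.

Lemma thead_sqr n (y : n.+1.-tuple R) r :
  (0 <= sqn y - 2 * (r * thead y) + r ^+ 2)%R.
Proof.
rewrite (cons_tupleE y) sqn_cons theadE; have := sqn_ge0 (behead_tuple y).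
by have := sqr_ge0 (thead y - r)%R; nra.
Qed.

(** The integrand sees [y] only through its norm and its dot product with [x], so
    [ge0_integral_radial] replaces [x] by a point of the first axis. *)
Lemma autoconv_radial n a (x : n.+1.-tuple R) : autoconv a x = autoconv_axis n a (Num.sqrt (sqn x)).
Proof.
pose F (p : Rm * Rm) := (rho a p.1 * rho a (p.1 - 2 * p.2 + sqn x))%:E.
have mF : measurable_fun setT F.
  apply/measurable_EFinP; apply: measurable_funM.
    by apply: (measurableT_comp (measurable_rho a)).
  apply: (measurableT_comp (measurable_rho a)); apply: measurable_funD => //.
  by apply: measurable_funB => //; exact: measurable_funM.
have F0 p : 0 <= F p by rewrite lee_fin mulr_ge0// rho_ge0.
apply: etrans; last first.
  apply: (etrans (ge0_integral_radial x mF F0)).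
  by apply: eq_integral => y _; rewrite /F/= sqr_sqrtr// sqn_ge0.
by apply: eq_integral => y _; rewrite /F/= sqn_vsub; congr (_ * rho _ _)%:E; ring.
Qed.

Lemma measurable_autoconv_integrand n a r : measurable_fun setT
  (fun y : n.+1.-tuple R => (rho a (sqn y) * rho a (sqn y - 2 * (r * thead y) + r ^+ 2))%R).
Proof.
apply: measurable_funM; apply: (measurableT_comp (measurable_rho a)).
  exact: measurable_sqn.
apply: measurable_funD => //; apply: measurable_funB; first exact: measurable_sqn.
by apply: measurable_funM => //; apply: measurable_funM => //; exact: (measurable_tnth ord0).
Qed.

(** A real-valued indicator, so that it can serve both as an integrable majorant and as a
    convolution kernel dominating all others. *)
Definition unit_ball n (y : n.-tuple R) : R := (sqn y <= 1)%R%:R.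

Lemma measurable_unit_ball n : measurable_fun setT (@unit_ball n).
Proof.
rewrite (_ : @unit_ball n = \1_[set y | sqn y <= 1]%R); last first.
  by apply/funext => y; rewrite indicE /unit_ball mem_setE.
apply: measurable_indic; rewrite -[X in measurable X]setTI.
apply: measurable_fun_ler => //; exact: measurable_sqn.
Qed.

(** By slicing: the ball lies in the product of the interval from -1 to 1 with the ball of one
    dimension less. *)
Lemma integral_unit_ball_fin n : \int[mu n]_y (unit_ball y)%:E < +oo.
Proof.
elim: n => [|n IH].
  rewrite integral_mu0 ?ltry//; apply/measurable_EFinP; exact: measurable_unit_ball.
have mb m : measurable_fun setT (fun y : m.-tuple R => (unit_ball y)%:E).
  apply/measurable_EFinP; exact: measurable_unit_ball.
have b0 m (y : m.-tuple R) : 0 <= (unit_ball y)%:E by rewrite lee_fin.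
rewrite (ge0_integral_muS (mb _) (b0 _)).
pose I : set R := `[(-1)%R, 1%R]%classic.
have mI : measurable (I : set Rm) by exact: measurable_itv.
have m1 : measurable_fun setT (EFin \o (\1_I : Rm -> R)).
  by apply/measurable_EFinP; exact: measurable_indic.
have lI : leb I = 2%:E by rewrite /I lebesgue_measure_itv/= lte_fin ifT -?EFinB ?opprK//; lra.
apply: (@le_lt_trans _ _ (\int[leb]_x ((\1_I x)%:E * \int[mu n]_y (unit_ball y)%:E))).
  apply: ge0_le_integral => //.
  - by move=> x _; exact: integral_ge0.
  - exact: (measurable_mu_tail (mb n.+1) (b0 n.+1)).
  - by apply: emeasurable_funM.
  - move=> x _; rewrite -ge0_integralZl//; last exact: mb.
    apply: ge0_le_integral => //.
    + exact: (measurable_comp_cons x (mb n.+1)).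
    + by apply: emeasurable_funM => //; exact: mb.
    + move=> y _; rewrite -EFinM lee_fin /unit_ball sqn_cons indicE mem_setE in_itv/= -natrM ler_nat.
      case: leP => // xy; have := sqr_ge0 x; have := sqn_ge0 y => y2 x2.
      have -> : (-1 <= x <= 1)%R by apply/andP; split; nra.
      by have -> : (sqn y <= 1)%R by nra.
rewrite ge0_integralZr//; last exact: integral_ge0.
rewrite integral_indic// setIT [X in X * _](_ : _ = 2%:E)//.
by rewrite lte_mul_pinfty.
Qed.

Lemma autoconv_integrand_le n a r (y : n.+1.-tuple R) : (0 <= a)%R ->
  (rho a (sqn y) * rho a (sqn y - 2 * (r * thead y) + r ^+ 2) <= unit_ball y)%R.
Proof.
move=> a0; rewrite /unit_ball; have := rho_ge0 a (sqn y) => h1.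
have h2 := rho_le1 a0 (sqn_ge0 y); have h3 := rho_le1 a0 (thead_sqr y r).
have h4 := rho_ge0 a (sqn y - 2 * (r * thead y) + r ^+ 2).
have [y1|/ltW y1] := leP (sqn y) 1%R; first by rewrite mulr_ile1.
by rewrite rho0// mul0r.
Qed.

Lemma autoconv_axis_ge0 n a r : 0 <= autoconv_axis n a r.
Proof. by apply: integral_ge0 => y _; rewrite lee_fin mulr_ge0// rho_ge0. Qed.

Lemma autoconv_axis_fin n a r : (0 <= a)%R -> autoconv_axis n a r < +oo.
Proof.
move=> a0; apply: le_lt_trans (integral_unit_ball_fin n.+1).
apply: ge0_le_integral => //.
- by move=> y _; rewrite lee_fin mulr_ge0// rho_ge0.
- by apply/measurable_EFinP; exact: measurable_autoconv_integrand.
- by apply/measurable_EFinP; exact: measurable_unit_ball.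
- by move=> y _; rewrite lee_fin autoconv_integrand_le.
Qed.

Definition autoconvR n a (r : R) : R := fine (autoconv_axis n a r).

Lemma autoconvRE n a r : (0 <= a)%R -> (autoconvR n a r)%:E = autoconv_axis n a r.
Proof. by move=> a0; rewrite /autoconvR fineK// ge0_fin_numE ?autoconv_axis_fin// autoconv_axis_ge0. Qed.

(** Slices of a sphere along the first coordinate are spheres with squared radius [c - x ^+ 2]. The
    induction starts in dimension 1, with at most two points: in dimension 0 the set for [c = 0] has
    mass 1. *)
Lemma mu_sphere n (c : R) : mu n.+1 [set y : n.+1.-tuple R | sqn y = c] = 0.
Proof.
have mS m (e : R) : measurable [set y : m.-tuple R | sqn y = e].
  have := @measurable_sqn R m measurableT [set e]; rewrite setTI; apply.
  exact: measurable_set1.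
have mi m (e : R) : measurable_fun setT (fun y : m.-tuple R => (\1_[set y | sqn y = e] y : R)%:E).
  by apply/measurable_EFinP; apply: measurable_indic; exact: mS.
have E m e : mu m [set y : m.-tuple R | sqn y = e] = \int[mu m]_y (\1_[set y | sqn y = e] y : R)%:E.
  by apply: (etrans _ (esym (integral_indic (mu m) measurableT (mS m e)))); rewrite setIT.
elim: n c => [|n IH] c; rewrite E.
  rewrite (ge0_integral_muS (mi _ _)); last by move=> y; rewrite lee_fin.
  pose A : set R := [set Num.sqrt c; (- Num.sqrt c)%R].
  have mA : measurable (A : set Rm) by apply: measurableU; exact: measurable_set1.
  apply/eqP; rewrite eq_le; apply/andP; split; last first.
    by apply: integral_ge0 => x _; apply: integral_ge0 => y _; rewrite lee_fin.
  apply: (@le_trans _ _ (\int[leb]_x (\1_A x : R)%:E)).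
    apply: ge0_le_integral => //.
    - by move=> x _; apply: integral_ge0 => y _; rewrite lee_fin.
    - by apply: (measurable_mu_tail (mi _ _)) => y; rewrite lee_fin.
    - by apply/measurable_EFinP; exact: measurable_indic.
    move=> x _; rewrite integral_mu0.
      rewrite lee_fin !indicE; case: (boolP (_ \in _)) => //.
      rewrite inE/= sqn_cons /sqn big_ord0 addr0 => xc.
      rewrite mem_set// /A/= -xc sqrtr_sqr; have [x0|x0] := leP 0%R x.
        by left; rewrite ger0_norm.
      by right; rewrite ltr0_norm// opprK.
    exact: (measurable_comp_cons x (mi _ _)).
  rewrite integral_indic// setIT le_eqVlt; apply/orP; left; apply/eqP.
  apply: countable_lebesgue_measure0; apply: finite_set_countable; exact: finite_set2.
rewrite (ge0_integral_muS (mi _ _)); last by move=> y; rewrite lee_fin.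
apply: integral0_eq => x _; rewrite -[RHS](IH (c - x ^+ 2)%R) E.
apply: eq_integral => y _; congr EFin; rewrite !indicE; congr (_ %:R).
congr nat_of_bool; apply/idP/idP => /set_mem/= h; apply/mem_set => /=.
  by move: h; rewrite sqn_cons; lra.
by rewrite sqn_cons h; ring.
Qed.

End AutoConv.

(** * Continuity of the autoconvolution *)

Section Recurrence.
Context {R : realType}.
Local Notation leb := (@lebesgue_measure R).
Local Notation Rm := (measurableTypeR R).
Local Open Scope ereal_scope.

Definition axis n (r : R) : n.+1.-tuple R := cons_tuple r [tuple of nseq n 0%R].

Lemma sqn_nseq0 n : sqn [tuple of nseq n (0 : R)%R] = 0%R.
Proof. by rewrite /sqn big1// => i _; rewrite tnth_nseq expr0n. Qed.

Lemma sqn_axis n r : sqn (axis n r) = (r ^+ 2)%R.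
Proof. by rewrite /axis sqn_cons sqn_nseq0 addr0. Qed.

Lemma sqn_vsub_axis n r y : sqn (vsub (axis n r) y) = (sqn y - 2 * (r * thead y) + r ^+ 2)%R.
Proof.
rewrite sqn_vsub sqn_axis {1}(cons_tupleE y) /axis dotp_cons.
have -> : dotp [tuple of nseq n (0 : R)%R] (behead_tuple y) = 0%R.
  by rewrite /dotp big1// => i _; rewrite tnth_nseq mul0r.
by ring.
Qed.

Lemma autoconv_axisE n a r : autoconv_axis n a r = autoconv a (axis n r).
Proof. by apply: eq_integral => y _; rewrite sqn_vsub_axis. Qed.

Lemma mu_sphere_shift n (x : n.+1.-tuple R) c :
  mu n.+1 [set y | sqn (vsub x y) = c] = 0.
Proof.
have mS : measurable [set y : n.+1.-tuple R | sqn y = c].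
  have := @measurable_sqn R n.+1 measurableT [set c]; rewrite setTI; apply.
  exact: measurable_set1.
have mS' : measurable [set y : n.+1.-tuple R | sqn (vsub x y) = c].
  have := measurable_vsub x measurableT mS; by rewrite setTI.
have mi : measurable_fun setT (fun y : n.+1.-tuple R => (\1_[set y | sqn y = c] y : R)%:E).
  by apply/measurable_EFinP; apply: measurable_indic.
rewrite -[RHS](mu_sphere n c).
have i1 := integral_indic (mu n.+1) measurableT mS.
have i2 := integral_indic (mu n.+1) measurableT mS'.
rewrite !setIT in i1 i2; rewrite -i1 -i2.
apply: etrans (ge0_integral_vsubl x mi _); last by move=> y; rewrite lee_fin.
by apply: eq_integral => y _; congr EFin; rewrite !indicE !mem_setE.
Qed.

(** Dominated convergence with the unit ball as majorant. Pointwise convergence can fail only where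
    the second factor is evaluated at its jump, that is on the unit sphere about the point [r] of
    the axis. *)
Lemma autoconvR_continuous n (a : R) : (0 <= a)%R -> continuous (@autoconvR R n a).
Proof.
move=> a0 r; apply/(@cvg_nbhsP _ R^o) => u ur.
pose f_ m (y : n.+1.-tuple R) := (rho a (sqn y) * rho a (sqn y - 2 * (u m * thead y) + u m ^+ 2))%:E.
pose f (y : n.+1.-tuple R) := (rho a (sqn y) * rho a (sqn y - 2 * (r * thead y) + r ^+ 2))%:E.
have [] := @dominated_convergence _ _ _ (mu n.+1) setT measurableT f_ f (EFin \o @unit_ball R n.+1).
- by move=> m; apply/measurable_EFinP; exact: measurable_autoconv_integrand.
- by apply/measurable_EFinP; exact: measurable_autoconv_integrand.
- exists [set y | sqn (vsub (axis n r) y) = 1%R]; split.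
  + have := measurable_vsub (axis n r) measurableT.
    have mS : measurable [set y : n.+1.-tuple R | sqn y = 1%R].
      have := @measurable_sqn R n.+1 measurableT [set 1%R]; rewrite setTI; apply.
      exact: measurable_set1.
    by move=> /(_ _ mS); rewrite setTI.
  + exact: mu_sphere_shift.
  + move=> y /= nc; apply: contrapT => y1; apply: nc => _.
    apply: cvg_EFin; first exact: nearW.
    rewrite /f_ /f /=; apply: cvgM; first exact: cvg_cst.
    have cr : {for (sqn y - 2 * (r * thead y) + r ^+ 2)%R, continuous (rho a)}.
      by apply: rho_continuous; rewrite -sqn_vsub_axis; apply/eqP.
    apply: (continuous_cvg _ cr); apply: cvgD; last first.
      by rewrite expr2; under eq_fun do rewrite expr2; exact: cvgM.
    by apply: cvgB; [exact: cvg_cst|apply: cvgM; [exact: cvg_cst|apply: cvgM => //; exact: cvg_cst]].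
- apply/integrableP; split; first by apply/measurable_EFinP; exact: measurable_unit_ball.
  apply: le_lt_trans (@integral_unit_ball_fin R n.+1).
  by under eq_integral do rewrite /= ger0_norm//.
- apply: aeW => y m _; rewrite /f_ abse_EFin lee_fin ger0_norm ?autoconv_integrand_le//.
  by rewrite mulr_ge0// rho_ge0.
move=> _ _; rewrite -/(autoconv_axis n a r) -autoconvRE// => /fine_cvg.
by [].
Qed.

Lemma autoconvR_ge0 n a r : (0 <= @autoconvR R n a r)%R.
Proof. by apply: fine_ge0; exact: autoconv_axis_ge0. Qed.

(** This is [q n a] of the overview. Square roots of negative numbers being 0, it is constant on the
    negative half-line and therefore continuous on the whole line. *)
Definition autoconv_sqr n a (s : R) : R := autoconvR n a (Num.sqrt s).

Lemma autoconv_sqr_continuous n a : (0 <= a)%R -> continuous (autoconv_sqr n a).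
Proof.
move=> a0 s; apply: (@continuous_comp _ _ _ (@Num.sqrt R) (@autoconvR R n a)).
  exact: sqrt_continuous.
exact: autoconvR_continuous.
Qed.

Lemma measurable_autoconv_sqr n a : (0 <= a)%R -> measurable_fun setT (EFin \o autoconv_sqr n a).
Proof.
move=> a0; apply/measurable_EFinP; apply: continuous_measurable_fun.
exact: autoconv_sqr_continuous.
Qed.

End Recurrence.

(** * The recurrence from dimension n to n + 2 *)

Section Rec.
Context {R : realType}.
Local Notation leb := (@lebesgue_measure R).
Local Notation Rm := (measurableTypeR R).
Local Open Scope ereal_scope.

Lemma integral2_shift_rho (a p q s : R) : (1 <= a)%R ->
  \int[leb]_u \int[leb]_v (rho (a - 1) ((u - p) ^+ 2 + (v - q) ^+ 2 + s))%:E
  = (pi / a * rho a s)%:E.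
Proof.
move=> a1; apply: (etrans _ (integral2_rho s a1)).
pose F (z : Rm * Rm) := (rho (a - 1) (z.1 ^+ 2 + z.2 ^+ 2 + s))%:E.
have mF : measurable_fun setT F.
  apply/measurable_EFinP; apply: (measurableT_comp (measurable_rho _)).
  by apply: measurable_funD => //; apply: measurable_funD; apply: measurable_funX.
have F0 z : 0 <= F z by rewrite lee_fin rho_ge0.
have mF1 := measurable_fun_fubini_tonelli_F (m2 := leb) F mF F0.
have F10 x : 0 <= \int[leb]_y F (x, y) by exact: integral_ge0.
apply: (etrans _ (ge0_integral_addr (- p)%R mF1 F10)).
apply: eq_integral => u _.
have mF2 : measurable_fun setT (fun v => F ((u - p)%R, v)).
  exact: (measurableT_comp mF (pair1_measurable _)).
exact: (ge0_integral_addr (- q)%R mF2 (fun _ => F0 _)).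
Qed.

(** Two planar integrations, each worth a factor [pi / a] and each raising one exponent from [a - 1]
    to [a]: over the two added coordinates of the point, and over the first two coordinates of the
    variable of integration. *)
Lemma autoconv_integral2 n (a : R) (x : n.-tuple R) : (1 <= a)%R ->
  \int[leb]_u \int[leb]_v autoconv (a - 1) (cons_tuple u (cons_tuple v x)) =
  ((pi / a) ^+ 2)%:E * autoconv a x.
Proof.
move=> a1; have pa0 : (0 <= pi / a :> R)%R by rewrite divr_ge0 ?pi_ge0//; lra.
pose K (z : (Rm * Rm) * n.+2.-tuple R) : \bar R :=
  (rho (a - 1) (sqn z.2) *
   rho (a - 1) (sqn (vsub (cons_tuple z.1.1 (cons_tuple z.1.2 x)) z.2)))%:E.
have mK : measurable_fun setT K.
  apply/measurable_EFinP; apply: measurable_funM.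
    apply: (measurableT_comp (measurable_rho _)).
    by apply: (measurableT_comp (@measurable_sqn R _)).
  apply: (measurableT_comp (measurable_rho _)).
  apply: (measurableT_comp (@measurable_sqn R _)).
  pose X (z : (Rm * Rm) * n.+2.-tuple R) : n.+2.-tuple R := tcons (z.1.1, tcons (z.1.2, x)).
  have mX : measurable_fun setT X.
    apply: (measurableT_comp (@measurable_tcons R _)); apply: measurable_fun_pair.
      by apply: (measurableT_comp measurable_fst).
    apply: (measurableT_comp (@measurable_tcons R _)); apply: measurable_fun_pair => //.
    by apply: (measurableT_comp measurable_snd).
  have mXY : measurable_fun setT (fun z : (Rm * Rm) * n.+2.-tuple R => (X z, z.2)).
    exact: measurable_fun_pair.
  exact: (measurableT_comp (@measurable_vsub2 R _) mXY).
have K0 z : 0 <= K z by rewrite lee_fin mulr_ge0// rho_ge0.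
pose K2 (z : Rm * n.+2.-tuple R) := \int[leb]_v K ((z.1, v), z.2).
have mK2 : measurable_fun setT K2.
  have mc : measurable_fun setT (fun w : (Rm * n.+2.-tuple R) * Rm => K ((w.1.1, w.2), w.1.2)).
    apply: (measurableT_comp mK); apply: measurable_fun_pair; last by apply: (measurableT_comp measurable_snd).
    by apply: measurable_fun_pair => //; apply: (measurableT_comp measurable_fst).
  exact: (measurable_fun_fubini_tonelli_F (m2 := leb) _ mc (fun _ => K0 _)).
have K20 z : 0 <= K2 z by exact: integral_ge0.
(* The integrals over [v] and then [u] are moved inside the integral over [y]. *)
transitivity (\int[leb]_u \int[mu n.+2]_y K2 (u, y)).
  apply: eq_integral => u _.
  have mc : measurable_fun setT (fun w : Rm * n.+2.-tuple R => K ((u, w.1), w.2)).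
    apply: (measurableT_comp mK); apply: measurable_fun_pair => //.
    exact: measurable_fun_pair.
  exact: (fubini_tonelli (m1 := leb) (m2 := mu n.+2) _ mc (fun _ => K0 _)).
apply: (etrans (fubini_tonelli (m1 := leb) (m2 := mu n.+2) _ mK2 K20)).
(* What remains of the integrand once [u] and [v] are integrated out: the second factor no longer
   depends on the first two coordinates of [y]. *)
pose L (y : n.+2.-tuple R) := (rho (a - 1) (sqn y) * (pi / a * rho a (sqn (vsub x (behead_tuple (behead_tuple y))))))%:E.
have LE p q t : L (cons_tuple p (cons_tuple q t)) =
    (rho (a - 1) (p ^+ 2 + q ^+ 2 + sqn t))%:E * (pi / a * rho a (sqn (vsub x t)))%:E.
  rewrite -EFinM /L !sqn_cons addrA; congr (_ * (_ * rho _ (sqn (vsub _ _))))%:E.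
  by apply/val_inj.
transitivity (\int[mu n.+2]_y L y).
  apply: eq_integral => y _; rewrite (cons_tupleE y) (cons_tupleE (behead_tuple y)).
  move: (behead_tuple (behead_tuple y) : n.-tuple R) (thead (behead_tuple y)) (thead y) => t q p.
  rewrite LE -(integral2_shift_rho p q (sqn (vsub x t)) a1).
  rewrite -ge0_integralZl//; last 3 first.
  - pose F (z : Rm * Rm) := (rho (a - 1) ((z.1 - p) ^+ 2 + (z.2 - q) ^+ 2 + sqn (vsub x t)))%:E.
    have mF : measurable_fun setT F.
      apply/measurable_EFinP; apply: (measurableT_comp (measurable_rho _)).
      by apply: measurable_funD => //; apply: measurable_funD; apply: measurable_funX;
        apply: measurable_funB.
    have F0 z : 0 <= F z by rewrite lee_fin rho_ge0.
    exact: (measurable_fun_fubini_tonelli_F (m2 := leb) F mF F0).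
  - by move=> u _; apply: integral_ge0 => v _; rewrite lee_fin rho_ge0.
  - by rewrite lee_fin rho_ge0.
  apply: eq_integral => u _.
  have mFu : measurable_fun setT (fun v : Rm =>
      (rho (a - 1) ((u - p) ^+ 2 + (v - q) ^+ 2 + sqn (vsub x t)))%:E).
    apply/measurable_EFinP; apply: (measurableT_comp (measurable_rho _)).
    apply: measurable_funD => //; apply: measurable_funD => //; apply: measurable_funX.
    by apply: measurable_funB.
  apply: (etrans _ (ge0_integralZl leb measurableT mFu _ _)); last 2 first.
  - by move=> v _; rewrite lee_fin rho_ge0.
  - by rewrite lee_fin rho_ge0.
  apply: eq_integral => v _.
  by rewrite /K/= -EFinM !sqn_cons addrA !vsub_cons !sqn_cons addrA.
have mL : measurable_fun setT L.
  apply/measurable_EFinP; apply: measurable_funM.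
    by apply: (measurableT_comp (measurable_rho _)); exact: measurable_sqn.
  apply: measurable_funM => //; apply: (measurableT_comp (measurable_rho _)).
  apply: (measurableT_comp (@measurable_sqn R _)).
  apply: (measurableT_comp (measurable_vsub x)).
  by apply: (measurableT_comp (@measurable_behead _ _ n)); exact: measurable_behead.
have L0 y : 0 <= L y by rewrite lee_fin mulr_ge0 ?rho_ge0// mulr_ge0// rho_ge0.
apply: (etrans (ge0_integral_muS2 mL L0)).
have mL1 : measurable_fun setT (fun t => \int[leb]_p L (cons_tuple p t)).
  have mLt : measurable_fun setT (L \o @tcons R n.+1).
    by apply: measurableT_comp => //; exact: measurable_tcons.
  exact: (measurable_fun_fubini_tonelli_G (m1 := leb) _ mLt (fun p => L0 _)).
have L10 t : 0 <= \int[leb]_p L (cons_tuple p t) by exact: integral_ge0.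
apply: (etrans (ge0_integral_muS2 mL1 L10)).
rewrite /autoconv -ge0_integralZl//; last 3 first.
- apply/measurable_EFinP; apply: measurable_funM; apply: (measurableT_comp (measurable_rho _)).
    exact: measurable_sqn.
  by apply: (measurableT_comp (@measurable_sqn R _)); exact: measurable_vsub.
- by move=> y _; rewrite lee_fin mulr_ge0// rho_ge0.
- by rewrite lee_fin sqr_ge0.
apply: eq_integral => t _.
transitivity (\int[leb]_q \int[leb]_p ((rho (a - 1) (q ^+ 2 + p ^+ 2 + sqn t))%:E *
    (pi / a * rho a (sqn (vsub x t)))%:E)).
  by apply: eq_integral => q _; apply: eq_integral => p _; rewrite LE (addrC (p ^+ 2)%R).
transitivity (\int[leb]_q ((\int[leb]_p (rho (a - 1) (q ^+ 2 + p ^+ 2 + sqn t))%:E) *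
    (pi / a * rho a (sqn (vsub x t)))%:E)).
  apply: eq_integral => q _; apply: ge0_integralZr => //.
  - apply/measurable_EFinP; apply: (measurableT_comp (measurable_rho _)).
    by apply: measurable_funD => //; apply: measurable_funD => //; apply: measurable_funX.
  - by move=> p _; rewrite lee_fin rho_ge0.
  - by rewrite lee_fin mulr_ge0// rho_ge0.
rewrite ge0_integralZr//; last 3 first.
- pose F (z : Rm * Rm) := (rho (a - 1) (z.1 ^+ 2 + z.2 ^+ 2 + sqn t))%:E.
  have mF : measurable_fun setT F.
    apply/measurable_EFinP; apply: (measurableT_comp (measurable_rho _)).
    by apply: measurable_funD => //; apply: measurable_funD; apply: measurable_funX.
  have F0 z : 0 <= F z by rewrite lee_fin rho_ge0.
  exact: (measurable_fun_fubini_tonelli_F (m2 := leb) F mF F0).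
- by move=> u _; apply: integral_ge0 => v _; rewrite lee_fin rho_ge0.
- by rewrite lee_fin mulr_ge0// rho_ge0.
by rewrite (integral2_rho _ a1) -!EFinM; congr EFin; ring.
Qed.

(** By radiality the integrand in [autoconv_integral2], taken at a point of the axis, depends on [u]
    and [v] only through the sum of their squares, and polar coordinates apply. *)
Lemma autoconv_axis_rec n (a r : R) : (1 <= a)%R ->
  ((pi / a) ^+ 2)%:E * autoconv_axis n a r =
  pi%:E * \int[leb]_(s in `]0%R, +oo[) (autoconv_sqr n.+2 (a - 1) (s + r ^+ 2))%:E.
Proof.
move=> a1; have a0 : (0 <= a - 1)%R by rewrite subr_ge0.
have mh : measurable_fun setT (fun s : R => (autoconv_sqr n.+2 (a - 1) (s + r ^+ 2))%:E).
  apply: (measurableT_comp (f := EFin \o autoconv_sqr n.+2 (a - 1))); first exact: measurable_autoconv_sqr.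
  exact: measurable_funD.
apply: (etrans _ (ge0_integral_polar mh _)); last by move=> s; rewrite lee_fin autoconvR_ge0.
rewrite autoconv_axisE; apply: (etrans (esym (autoconv_integral2 _ a1))).
apply: eq_integral => u _; apply: eq_integral => v _.
by rewrite autoconv_radial (sqn_cons u) (sqn_cons v) sqn_axis addrA autoconvRE.
Qed.

End Rec.

(** * Differentiating the recurrence; the Wu function as an autoconvolution *)

Section WuDerivative.
Context {R : realType}.
Local Notation leb := (@lebesgue_measure R).
Local Notation Rm := (measurableTypeR R).

Section Tail.
Variable h : R -> R.
Hypothesis h0 : forall s, 0 <= h s.
Hypothesis hc : continuous h.
Hypothesis hi : (\int[leb]_(s in `]0%R, +oo[) (h s)%:E < +oo)%E.

Let mh : measurable_fun setT (EFin \o h).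
Proof. by apply/measurable_EFinP; exact: continuous_measurable_fun. Qed.

Definition head_int (s : R) : R := (\int[leb]_(t in `[0, s]) h t)%R.

Lemma head_int_integrable (s : R) : leb.-integrable `[0, s] (EFin \o h).
Proof.
apply: continuous_compact_integrable; first exact: segment_compact.
exact: continuous_subspaceT.
Qed.

Lemma head_int_derive (s : R) : 0 < s -> is_derive s 1 head_int (h s).
Proof.
move=> s0.
(* The upper end [s + 1] only serves to make [s] an interior point. *)
have [] := @continuous_FTC1_closed R h 0 s (s + 1) _ (head_int_integrable (s + 1)) s0 (@hc s).
  by rewrite ltrDl.
by move=> d1 d2; apply: DeriveDef; rewrite -?derive1E.
Qed.

(** The tail is written as the total minus an integral over a bounded interval, because the
    fundamental theorem of calculus applies to the latter. *)
Lemma tail_intE (s : R) : 0 <= s ->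
  fine (\int[leb]_(t in `]0%R, +oo[) (h (t + s))%:E)%E =
  fine (\int[leb]_(t in `]0%R, +oo[) (h t)%:E)%E - head_int s.
Proof.
move=> s0.
have h0' t : (0 <= (h t)%:E)%E by rewrite lee_fin.
have e1 : (\int[leb]_(t in `]0%R, +oo[) (h (t + s))%:E = \int[leb]_(t in `]s, +oo[) (h t)%:E)%E.
  rewrite integral_mkcond [RHS]integral_mkcond.
  have mf : measurable_fun setT ((EFin \o h) \_ `]s, +oo[).
    by apply/measurable_restrict => //; exact: measurable_funS mh.
  apply: (etrans _ (ge0_integral_addr s mf _)); last first.
    by move=> x; rewrite patchE; case: ifP => // _; exact: h0'.
  apply: eq_integral => t _; rewrite !patchE.
  rewrite !mem_setE !in_itv/= !andbT.
  by have -> : (s < t + s) = (0 < t) by rewrite ltrDr.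
have e2 : (\int[leb]_(t in `[0%R, s]) (h t)%:E = \int[leb]_(t in `]0%R, s]) (h t)%:E)%E.
  by apply/esym/integral_itv_obnd_cbnd; exact: measurable_funS mh.
have e3 : (\int[leb]_(t in `]0%R, +oo[) (h t)%:E =
    \int[leb]_(t in `[0%R, s]) (h t)%:E + \int[leb]_(t in `]s, +oo[) (h t)%:E)%E.
  rewrite e2 -ge0_integral_setU//=.
  - congr (integral _ _ _); apply/seteqP; split=> t /=; rewrite !in_itv/= !andbT.
      by move=> t0; case: (leP t s) => ts; [left; rewrite t0|right].
    by case=> [/andP[]//|]; exact: le_lt_trans.
  - exact: measurable_funS mh.
  - rewrite disj_set2E; apply/eqP/seteqP; split=> t //=; rewrite !in_itv/= !andbT.
    by move=> [/andP[_ ts]]; rewrite ltNge ts.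
have f1 : (\int[leb]_(t in `[0%R, s]) (h t)%:E)%E \is a fin_num.
  by apply: integrable_fin_num => //; exact: head_int_integrable.
have f2 : (\int[leb]_(t in `]s, +oo[) (h t)%:E)%E \is a fin_num.
  rewrite ge0_fin_numE; last exact: integral_ge0.
  apply: le_lt_trans hi; rewrite e3 leeDr//; exact: integral_ge0.
rewrite e1; apply/esym; rewrite (etrans (congr1 fine e3) (fineD f1 f2)).
by rewrite /head_int /Rintegral addrAC subrr add0r.
Qed.

End Tail.

Lemma autoconvR_tail n (a r : R) : 1 <= a -> autoconvR n a r =
  a ^+ 2 / pi * (fine (\int[leb]_(s in `]0%R, +oo[) (autoconv_sqr n.+2 (a - 1) s)%:E)%E
                 - head_int (autoconv_sqr n.+2 (a - 1)) (r ^+ 2)).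
Proof.
move=> a1; have a0 : 0 < a by lra.
have am : 0 <= a - 1 by lra.
have pn : (pi : R) != 0 by rewrite gt_eqF// pi_gt0.
(* Solving the recurrence for the autoconvolution: [pi] divided by the square of [pi / a] is
   [a ^+ 2 / pi]. *)
have key (I : \bar R) : I \is a fin_num ->
    (((pi / a) ^+ 2)%:E * (autoconvR n a r)%:E = pi%:E * I)%E -> autoconvR n a r = a ^+ 2 / pi * fine I.
  case: I => // x _; rewrite -!EFinM => -[e] /=.
  have -> : x = (pi / a) ^+ 2 * autoconvR n a r / pi by rewrite e mulrAC divff// mul1r.
  move: pn => {e}; move: (pi : R) (autoconvR n a r) => p g pn; field.
  by rewrite pn gt_eqF.
have rr := autoconv_axis_rec n r a1.
set H := autoconv_sqr n.+2 (a - 1) in rr *.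
have H0 s : 0 <= H s by exact: autoconvR_ge0.
(* The recurrence itself gives finiteness: its left side is finite and [pi] is positive. *)
have fin q : (\int[leb]_(s in `]0%R, +oo[) (H (s + q ^+ 2)%R)%:E < +oo)%E.
  have := autoconv_axis_rec n q a1; rewrite -autoconvRE ?ltW// -EFinM -/H.
  have : (0 <= \int[leb]_(s in `]0%R, +oo[) (H (s + q ^+ 2)%R)%:E)%E.
    by apply: integral_ge0 => s _; rewrite lee_fin.
  move: (integral _ _ _) => [x|//|//] _; first by rewrite ltry.
  by rewrite gt0_muley// lte_fin pi_gt0.
have e0 : (\int[leb]_(s in `]0%R, +oo[) (H (s + 0 ^+ 2)%R)%:E =
           \int[leb]_(s in `]0%R, +oo[) (H s)%:E)%E.
  by apply: eq_integral => s _; rewrite expr0n addr0.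
have HI : (\int[leb]_(s in `]0%R, +oo[) (H s)%:E < +oo)%E.
  exact: (eq_rect _ (fun z => (z < +oo)%E) (fin 0) _ e0).
rewrite -(tail_intE H0 (autoconv_sqr_continuous am) HI (sqr_ge0 r)).
have finr : (\int[leb]_(s in `]0%R, +oo[) (H (s + r ^+ 2)%R)%:E)%E \is a fin_num.
  by rewrite ge0_fin_numE; [exact: fin|apply: integral_ge0 => s _; rewrite lee_fin].
by apply: (key _ finr); rewrite (autoconvRE n r (ltW a0)); exact: rr.
Qed.

Lemma autoconvR_derive n (a r : R) : 1 <= a -> 0 < r ->
  is_derive r 1 (autoconvR n a) (- (2 * a ^+ 2 / pi) * r * autoconvR n.+2 (a - 1) r).
Proof.
move=> a1 r0; have am : 0 <= a - 1 by lra.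
rewrite (funext (fun q => autoconvR_tail n q a1)).
set H := autoconv_sqr n.+2 (a - 1); set I := fine _.
have Hr : H (r ^+ 2) = autoconvR n.+2 (a - 1) r by rewrite /H /autoconv_sqr sqrtr_sqr gtr0_norm.
have d1 : is_derive (r ^+ 2) 1 (head_int H) (H (r ^+ 2)).
  by apply: head_int_derive; [exact: autoconv_sqr_continuous|rewrite exprn_gt0].
have d2 : is_derive r 1 (fun q : R => q ^+ 2) (2 * r).
  by apply: is_derive_eq; rewrite /GRing.scale/=; ring.
have d3 := @is_derive1_comp R (head_int H) (fun q => q ^+ 2) r _ _ d1 d2.
apply: is_derive_eq; rewrite /GRing.scale/= Hr; ring.
Qed.

(** The closed form of an iterate is known only on the positive half-line, which is enough because a
    derivative at [r > 0] is local. The chain rule for [r ^+ 2] yields the factor [r] that [Dop]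
    divides out. *)
Lemma Dop_autoconvR n (a c r : R) (phi : R -> R) : 1 <= a -> 0 < r ->
  (forall q, 0 < q -> phi q = c * autoconvR n a q) ->
  Dop phi r = c * (2 * a ^+ 2 / pi) * autoconvR n.+2 (a - 1) r.
Proof.
move=> a1 r0 phiE; rewrite /Dop.
have -> : derive1 phi r = derive1 (fun q => c * autoconvR n a q) r.
  rewrite !derive1E; apply: near_eq_derive.
  by near=> q; apply: phiE; near: q; exact: lt_nbhsr.
have d := autoconvR_derive n a1 r0.
have -> : derive1 (fun q => c * autoconvR n a q) r = c * (- (2 * a ^+ 2 / pi) * r * autoconvR n.+2 (a - 1) r).
  by rewrite derive1E; apply: derive_val.
move: (2 * a ^+ 2 / pi) (autoconvR n.+2 (a - 1) r) => u g.
by field; rewrite gt_eqF.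
Unshelve. all: by end_near. Qed.

Lemma ffE (l r : R) : ff l r = autoconvR 0 l r.
Proof.
rewrite /ff /autoconvR /Rintegral /autoconv_axis; congr fine.
have mi := @measurable_autoconv_integrand R 0 l r.
apply/esym; rewrite ge0_integral_muS; last 2 first.
- exact/measurable_EFinP.
- by move=> y; rewrite lee_fin mulr_ge0// rho_ge0.
apply: eq_integral => y _; rewrite integral_mu0; last first.
  apply: (measurable_comp_cons y (f := fun z => (rho l (sqn z) * rho l (sqn z - 2 * (r * thead z) + r ^+ 2))%:E)).
  exact/measurable_EFinP.
congr EFin; rewrite sqn_cons theadE /sqn big_ord0 addr0 /f_trunc /rho.
by rewrite !real_normK ?num_real//; congr (_ * tpow _ _); ring.
Qed.

Lemma iter_Dop_ff (l : R) (k j : nat) r : k%:R <= l -> (j <= k)%N -> 0 < r ->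
  iter j (@Dop R) (ff l) r =
  \prod_(i < j) (2 * (l - i%:R) ^+ 2 / pi) * autoconvR (2 * j) (l - j%:R) r.
Proof.
move=> kl; elim: j r => [|j IH] r jk r0; first by rewrite /= big_ord0 mul1r subr0 muln0 ffE.
rewrite iterS big_ord_recr/= mulnS (_ : l - j.+1%:R = (l - j%:R) - 1); last first.
  by rewrite -natr1 opprD addrA.
apply: Dop_autoconvR => //; last by move=> q q0; apply: IH => //; exact: ltnW.
(* Differentiating once more requires an exponent [l - j] of at least 1, granted by
   [j + 1 <= k <= l]. *)
by rewrite lerBrDr -(natrD _ 1) add1n; apply: le_trans kl; rewrite ler_nat.
Qed.

(** At 0 the Wu function is a right limit, which continuity of the autoconvolution identifies with
    the same formula. *)
Lemma wuE (l : R) (k : nat) r : k%:R <= l -> 0 <= r ->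
  wu l k r = \prod_(i < k) (2 * (l - i%:R) ^+ 2 / pi) * autoconvR (2 * k) (l - k%:R) r.
Proof.
move=> kl r0; rewrite /wu; case: ifPn => [r1|]; first exact: (iter_Dop_ff kl (leqnn k) r1).
rewrite -leNgt => r1; have -> : r = 0 by apply/eqP; rewrite eq_le r1.
apply/cvg_lim => //.
set c := \prod_(i < k) _.
have cG : c * autoconvR (2 * k) (l - k%:R) x @[x --> 0^'+] --> c * autoconvR (2 * k) (l - k%:R) 0.
  apply: cvgM; first exact: cvg_cst.
  by apply: cvg_at_right_filter; apply: autoconvR_continuous; rewrite subr_ge0.
apply: cvg_trans cG; apply: near_eq_cvg; near=> x.
apply/esym; apply: (iter_Dop_ff kl (leqnn k)).
by near: x; exact: nbhs_right_gt.
Unshelve. all: by end_near. Qed.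

(** * The Gamma function *)

Definition eGamma (x : R) : \bar R :=
  (\int[leb]_(t in `]0%R, +oo[) (t `^ (x - 1) * expR (- t))%:E)%E.

Let K (x : R) (p : Rm * Rm) : \bar R :=
  ((p.1 `^ (x - 1) * expR (- p.2)) * (((0 < p.1) && (p.1 <= p.2))%:R))%:E.

Let K0 x p : (0 <= K x p)%E.
Proof. by rewrite lee_fin !mulr_ge0 ?powR_ge0 ?expR_ge0. Qed.

Let mK x : measurable_fun setT (K x).
Proof.
apply/measurable_EFinP; apply: measurable_funM.
  apply: measurable_funM.
    exact: (measurableT_comp (measurable_powR _) measurable_fst).
  have me : measurable_fun setT (fun t : R => expR (- t)) by apply: measurableT_comp.
  exact: (measurableT_comp me measurable_snd).
rewrite (_ : (fun _ => _) = \1_[set p : Rm * Rm | (0 < p.1) && (p.1 <= p.2)]); last first.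
  by apply/funext => p; rewrite indicE mem_setE.
apply: measurable_indic; rewrite -[X in measurable X]setTI.
rewrite (_ : [set p : Rm * Rm | (0 < p.1) && (p.1 <= p.2)] =
  (fun p : Rm * Rm => (0 < p.1) && (p.1 <= p.2)) @^-1` [set true]) //.
apply: measurable_and => //.
  by apply: measurable_fun_ltr.
by apply: measurable_fun_ler.
Qed.

(** Tonelli replaces integration by parts: over the region 0 < s <= t, integrating s^(x-1) exp(-t)
    first in [t] gives the integrand at [x], first in [s] the integrand at [x + 1] divided by
    [x]. *)
Lemma eGamma_rec (x : R) : 1 <= x -> (x%:E * eGamma x = eGamma (x + 1))%E.
Proof.
move=> x1; have x0 : 0 < x by lra.
have e1 s : (\int[leb]_t K x (s, t) = ((EFin \o (fun s : R => (s `^ (x - 1) * expR (- s))%R)) \_ `]0%R, +oo[) s)%E.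
  rewrite patchE mem_setE in_itv/= andbT; case: ifPn => s0; last first.
    by apply: integral0_eq => t _; rewrite /K/= (negbTE s0) mulr0.
  transitivity (\int[leb]_t ((s `^ (x - 1))%:E * ((EFin \o (fun t : R => expR (- t))) \_ `[s, +oo[) t))%E.
    apply: eq_integral => t _; rewrite /K/= patchE mem_setE in_itv/= andbT s0/=.
    case: ifP => _; first by rewrite mulr1 EFinM.
    by rewrite mulr0n mulr0 -[point]/(0%E : \bar R) mule0.
  have me : measurable_fun setT ((EFin \o (fun t : R => expR (- t))) \_ `[s, +oo[).
    apply/measurable_restrict => //; apply: measurable_funTS; apply/measurable_EFinP.
    by apply: measurableT_comp.
  rewrite ge0_integralZl//.
  - by rewrite -integral_mkcond integral_expRN EFinM.
  - by move=> t _; rewrite patchE; case: ifP => // _; rewrite lee_fin expR_ge0.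
  - by rewrite lee_fin powR_ge0.
have e2 t : (x%:E * \int[leb]_s K x (s, t) = ((EFin \o (fun t : R => (t `^ (x + 1 - 1) * expR (- t))%R)) \_ `]0%R, +oo[) t)%E.
  rewrite patchE mem_setE in_itv/= andbT; case: ifPn => t0; last first.
    rewrite integral0_eq ?mule0// => s _; rewrite /K/=.
    by case: andP => [[s0 st]|_]; rewrite ?mulr0//; move: t0; rewrite (lt_le_trans s0).
  have -> : (\int[leb]_s K x (s, t) =
     \int[leb]_s ((expR (- t))%:E * ((EFin \o (fun s : R => (s `^ (x - 1))%R)) \_ `]0%R, t]) s))%E.
    apply: eq_integral => s _; rewrite /K/= patchE mem_setE in_itv/=.
    case: ifP => _; first by rewrite mulr1 mulrC EFinM.
    by rewrite mulr0n mulr0 -[point]/(0%E : \bar R) mule0.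
  have mp : measurable_fun setT (EFin \o (fun s : R => s `^ (x - 1))).
    by apply/measurable_EFinP; exact: measurable_powR.
  rewrite ge0_integralZl//.
  - rewrite -integral_mkcond integral_itv_obnd_cbnd; last exact: measurable_funS mp.
    rewrite integral_powR//; last lra.
    rewrite -!EFinM; congr EFin; rewrite subrK addrK; field.
    by rewrite gt_eqF.
  - by apply/measurable_restrict => //; exact: measurable_funTS.
  - by move=> s _; rewrite patchE; case: ifP => // _; rewrite lee_fin powR_ge0.
have f := fubini_tonelli (m1 := leb) (m2 := leb) _ (mK x) (K0 x).
rewrite /eGamma [RHS]integral_mkcond.
have -> : (\int[leb]_(t in `]0%R, +oo[) (t `^ (x - 1) * expR (- t))%:E =
    \int[leb]_s \int[leb]_t K x (s, t))%E.
  by rewrite integral_mkcond; apply: eq_integral => s _; rewrite e1.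
rewrite f -ge0_integralZl//.
- by apply: eq_integral => t _; rewrite e2.
- exact: (measurable_fun_fubini_tonelli_G (m1 := leb) _ (mK x) (K0 x)).
- by move=> t _; exact: integral_ge0.
- by rewrite lee_fin ltW.
Qed.

Let mg (x : R) : measurable_fun setT (fun t : R => (t `^ (x - 1) * expR (- t))%:E).
Proof.
apply/measurable_EFinP; apply: measurable_funM; first exact: measurable_powR.
by apply: measurableT_comp.
Qed.

Lemma eGamma_ge0 (x : R) : (0 <= eGamma x)%E.
Proof. by apply: integral_ge0 => t _; rewrite lee_fin mulr_ge0 ?powR_ge0 ?expR_ge0. Qed.

Lemma eGamma_nat_fin (n : nat) : (eGamma n.+1%:R < +oo)%E.
Proof.
elim: n => [|n IH].
  have -> : eGamma 1 = (\int[leb]_(t in `]0%R, +oo[) (expR (- t))%:E)%E.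
    by apply: eq_integral => t _; rewrite subrr powRr0 mul1r.
  rewrite integral_itv_obnd_cbnd ?integral_expRN ?ltry//.
  by apply/measurable_EFinP; apply: measurable_funTS; apply: measurableT_comp.
by rewrite -natr1 -eGamma_rec ?lte_mul_pinfty ?lee_fin// ler1n.
Qed.

(** For a natural number N above x, t^(x-1) is at most 1 + t^N: the first term suffices up to t = 1,
    the second beyond. Integer arguments are finite by the recurrence. *)
Lemma eGamma_fin (x : R) : 1 <= x -> (eGamma x < +oo)%E.
Proof.
move=> x1; pose N := Num.bound x; have xN : x < N%:R by apply: archi_boundP; lra.
have mD : measurable (`]0%R, +oo[%classic : set Rm) by [].
apply: (@le_lt_trans _ _ (eGamma 1 + eGamma N.+1%:R)%E); last first.
  have g1 : (eGamma 1 < +oo)%E := eGamma_nat_fin 0.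
  exact: lte_add_pinfty g1 (eGamma_nat_fin N).
rewrite /eGamma -ge0_integralD//; last 4 first.
- by move=> t _; rewrite lee_fin mulr_ge0 ?powR_ge0 ?expR_ge0.
- exact: measurable_funTS (mg 1).
- by move=> t _; rewrite lee_fin mulr_ge0 ?powR_ge0 ?expR_ge0.
- exact: measurable_funTS (mg _).
apply: ge0_le_integral => //.
- by move=> t _; rewrite lee_fin mulr_ge0 ?powR_ge0 ?expR_ge0.
- exact: measurable_funTS (mg _).
- by apply: emeasurable_funD; apply: measurable_funTS; exact: mg.
move=> t; rewrite /= in_itv/= andbT => t0; rewrite -EFinD lee_fin -mulrDl.
rewrite ler_pM2r ?expR_gt0// subrr powRr0 -natr1 addrK.
have [t1|t1] := leP t 1.
  rewrite (@le_trans _ _ 1)//; last by rewrite lerDl powR_ge0.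
  have := @ge0_ler_powR R (x - 1) _ t 1; rewrite powR1; apply; rewrite ?nnegrE//; lra.
rewrite (@le_trans _ _ (t `^ N%:R))//; last by rewrite lerDr.
by apply: ler_powR; lra.
Qed.

(** On the interval from 1 to 2, of length 1, the integrand is at least exp(-2). *)
Lemma Gamma_gt0 (x : R) : 1 <= x -> 0 < Gamma x.
Proof.
move=> x1; apply: fine_gt0; rewrite eGamma_fin// andbT.
have mI : measurable (`[1, 2]%classic : set Rm) by exact: measurable_itv.
apply: (@lt_le_trans _ _ (\int[leb]_(t in `[1%R, 2%R]) (cst (expR (- 2))%:E t))%E).
  have lI : leb (`[1, 2]%classic : set R) = 1%E.
    rewrite lebesgue_measure_itv/= lte_fin ifT ?ltr1n// -EFinB; congr EFin; lra.
  rewrite integral_cst// [X in (_ < _ * X)%E](_ : _ = 1%E)// mule1 lte_fin.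
apply: (@le_trans _ _ (\int[leb]_(t in `[1%R, 2%R]) (t `^ (x - 1) * expR (- t))%:E)%E).
  apply: ge0_le_integral => //.
  - by move=> t _; rewrite lee_fin expR_ge0.
  - exact: measurable_funTS (mg x).
  move=> t; rewrite /= in_itv/= => /andP[t1 t2]; rewrite lee_fin -[leLHS]mul1r.
  apply: ler_pM; rewrite ?expR_ge0//; last by rewrite ler_expR lerN2.
  by have := @ler_powR R t t1 0 (x - 1); rewrite powRr0; apply; lra.
apply: ge0_subset_integral => //.
- exact: measurable_funTS (mg x).
- by move=> t _; rewrite lee_fin mulr_ge0 ?powR_ge0 ?expR_ge0.
- by move=> t; rewrite /= !in_itv/= andbT => /andP[t1 _]; lra.
Qed.

Lemma Gamma_rec (x : R) : 1 <= x -> Gamma (x + 1) = x * Gamma x.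
Proof.
move=> x1; apply: EFin_inj; rewrite EFinM.
have GE' y : 1 <= y -> (Gamma y)%:E = eGamma y.
  by move=> y1; rewrite /Gamma /Rintegral fineK// ge0_fin_numE ?eGamma_fin// eGamma_ge0.
by rewrite !GE' ?eGamma_rec//; lra.
Qed.

Lemma Gamma_quotient (l : R) (k : nat) : k%:R <= l ->
  Gamma (l + 1) / Gamma (l - k%:R + 1) = \prod_(i < k) (l - i%:R).
Proof.
move=> kl; apply: (mulIf (x := Gamma (l - k%:R + 1))).
  by rewrite gt_eqF// Gamma_gt0//; lra.
rewrite divfK; last by rewrite gt_eqF// Gamma_gt0//; lra.
elim: k kl => [|k IH] kl; first by rewrite big_ord0 subr0 mul1r.
have kl' : k%:R + 1 <= l by rewrite natr1.
rewrite IH; last lra.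
rewrite big_ord_recr/= -mulrA; congr (_ * _).
rewrite Gamma_rec; last lra.
by congr (_ * Gamma _); rewrite -natr1; ring.
Qed.

End WuDerivative.

(** * Square-integrable functions *)

Section L2.
Context d (T : measurableType d) {R : realType} (m : {measure set T -> \bar R}).

Definition sqint (f : T -> R) : \bar R := (\int[m]_x (f x ^+ 2)%:E)%E.
Definition isL2 (f : T -> R) := measurable_fun setT f /\ (sqint f < +oo)%E.
Definition Rintegrable (f : T -> R) := m.-integrable setT (EFin \o f).
Definition inner (f g : T -> R) : R := (\int[m]_x (f x * g x))%R.

Lemma Rintegrable_le (f g : T -> R) : measurable_fun setT f -> Rintegrable g ->
  (forall x, `|f x| <= g x) -> Rintegrable f.
Proof.
move=> mf gi fg; apply: le_integrable gi => //; first exact/measurable_EFinP.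
by move=> x _; rewrite /= lee_fin (le_trans (fg x))// ler_norm.
Qed.

Lemma Rintegrable_ge0 (f : T -> R) : measurable_fun setT f -> (forall x, 0 <= f x) ->
  (\int[m]_x (f x)%:E < +oo)%E -> Rintegrable f.
Proof.
move=> mf f0 fi; apply/integrableP; split; first exact/measurable_EFinP.
by under eq_integral => x _ do rewrite /= ger0_norm ?f0//.
Qed.

Lemma RintegrableD f g : Rintegrable f -> Rintegrable g -> Rintegrable (fun x => f x + g x).
Proof. by move=> fi gi; exact: (integrableD measurableT fi gi). Qed.

Lemma RintegrableZ c f : Rintegrable f -> Rintegrable (fun x => c * f x).
Proof. by move=> fi; exact: (integrableZl measurableT c fi). Qed.

Lemma Rintegrable_measurable f : Rintegrable f -> measurable_fun setT f.
Proof. by move=> /integrableP[/measurable_EFinP]. Qed.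

Lemma Rintegrable_abs f : Rintegrable f -> Rintegrable (fun x => `|f x|).
Proof. by move=> fi; exact: integrable_norm. Qed.

Lemma RintegrableE f : Rintegrable f -> ((\int[m]_x f x)%R)%:E = (\int[m]_x (f x)%:E)%E.
Proof. by move=> fi; rewrite /Rintegral fineK//; exact: integrable_fin_num. Qed.

Lemma L2_sq f : isL2 f -> Rintegrable (fun x => f x ^+ 2).
Proof.
by move=> [mf fi]; apply: Rintegrable_ge0 => //; [exact: measurable_funX|move=> x; exact: sqr_ge0].
Qed.

Lemma sq_L2 (f : T -> R) : measurable_fun setT f -> Rintegrable (fun x => f x ^+ 2) -> isL2 f.
Proof.
move=> mf /integrableP[_ fi]; split => //; apply: le_lt_trans fi.
by rewrite /sqint; under [leRHS]eq_integral => x _ do rewrite /= ger0_norm ?sqr_ge0//.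
Qed.

Lemma L2_mul f g : isL2 f -> isL2 g -> Rintegrable (fun x => f x * g x).
Proof.
move=> lf lg; apply: Rintegrable_le (RintegrableD (L2_sq lf) (L2_sq lg)) _.
  by apply: measurable_funM; [case: lf|case: lg].
by move=> x; rewrite ler_norml; apply/andP; split; nra.
Qed.

Lemma L2_le (f g : T -> R) : measurable_fun setT f -> isL2 g -> (forall x, `|f x| <= g x) -> isL2 f.
Proof.
move=> mf lg fg; apply: sq_L2 => //; apply: Rintegrable_le (L2_sq lg) _.
  exact: measurable_funX.
move=> x; rewrite ger0_norm ?sqr_ge0//.
by rewrite -(real_normK (num_real (f x))) lerXn2r ?nnegrE//; exact: le_trans (fg x).
Qed.

Lemma L2_add f g : isL2 f -> isL2 g -> isL2 (fun x => f x + g x).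
Proof.
move=> lf lg; have mfg : measurable_fun setT (fun x => f x + g x).
  by apply: measurable_funD; [case: lf|case: lg].
apply: sq_L2 => //; apply: Rintegrable_le (RintegrableZ 2 (RintegrableD (L2_sq lf) (L2_sq lg))) _.
  exact: measurable_funX.
by move=> x; rewrite ger0_norm ?sqr_ge0//; have := sqr_ge0 (f x - g x); nra.
Qed.

Lemma L2_scale c f : isL2 f -> isL2 (fun x => c * f x).
Proof.
move=> lf; have mf : measurable_fun setT (fun x => c * f x).
  by apply: measurable_funM => //; case: lf.
apply: sq_L2 => //; have := RintegrableZ (c ^+ 2) (L2_sq lf).
by congr Rintegrable; apply/funext => x; rewrite exprMn.
Qed.

Lemma L2_sub f g : isL2 f -> isL2 g -> isL2 (fun x => f x - g x).
Proof.
move=> lf lg; have := L2_add lf (L2_scale (-1) lg).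
by congr isL2; apply/funext => x; rewrite mulN1r.
Qed.

Lemma L2_0 : isL2 (fun=> 0).
Proof. by split => //; rewrite /sqint; under eq_integral do rewrite expr0n/=; rewrite integral0 ltry. Qed.

Lemma innerC f g : inner f g = inner g f.
Proof. by apply: eq_Rintegral => x _; rewrite mulrC. Qed.

Lemma innerDl f g h : isL2 f -> isL2 g -> isL2 h ->
  inner (fun x => f x + g x) h = inner f h + inner g h.
Proof.
move=> lf lg lh; rewrite /inner -RintegralD//; last 2 first.
- exact: L2_mul.
- exact: L2_mul.
by apply: eq_Rintegral => x _; rewrite mulrDl.
Qed.

Lemma innerZl c f g : isL2 f -> isL2 g -> inner (fun x => c * f x) g = c * inner f g.
Proof.
move=> lf lg; rewrite /inner -RintegralZl//; last exact: L2_mul.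
by apply: eq_Rintegral => x _; rewrite mulrA.
Qed.

Lemma innerBl f g h : isL2 f -> isL2 g -> isL2 h ->
  inner (fun x => f x - g x) h = inner f h - inner g h.
Proof.
move=> lf lg lh; rewrite -mulN1r -innerZl// -innerDl//; last exact: L2_scale.
by congr (inner _ _); apply/funext => x; rewrite mulN1r.
Qed.

Lemma inner_ge0 f : 0 <= inner f f.
Proof. by apply: Rintegral_ge0 => x _; rewrite -expr2 sqr_ge0. Qed.

Lemma innerE f : isL2 f -> (inner f f)%:E = sqint f.
Proof.
move=> lf; rewrite /inner RintegrableE; last exact: L2_mul.
by apply: eq_integral => x _; rewrite expr2.
Qed.

Lemma inner_eq0 f : isL2 f -> inner f f = 0 -> {ae m, forall x, f x = 0}.
Proof.
move=> lf f0; have mf := lf.1.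
have : (\int[m]_x `|(f x ^+ 2)%:E| = 0)%E.
  transitivity (sqint f); last by rewrite -innerE// f0.
  by apply: eq_integral => x _; rewrite /= ger0_norm// sqr_ge0.
have msq : measurable_fun setT (fun x => (f x ^+ 2)%:E).
  by apply/measurable_EFinP; exact: measurable_funX.
move/(ae_eq_integral_abs m measurableT msq); apply: filterS => x /(_ Logic.I) [].
by move/eqP; rewrite expf_eq0/= => /eqP.
Qed.

Lemma ae_inner f f' g : {ae m, forall x, f x = f' x} ->
  isL2 f -> isL2 f' -> isL2 g -> inner f g = inner f' g.
Proof.
move=> ff lf lf' lg; congr fine; apply: ae_eq_integral => //.
- by have := L2_mul lf lg => /integrableP[].
- by have := L2_mul lf' lg => /integrableP[].
by apply: filterS ff => x e _; rewrite e.
Qed.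

Lemma discriminant_le (A B C : R) : 0 <= C -> (forall t, 0 <= A - 2 * t * B + t ^+ 2 * C) -> B ^+ 2 <= A * C.
Proof.
rewrite le_eqVlt => /predU1P[<-|C0] h.
  rewrite mulr0; have [->|B0] := eqVneq B 0; first by rewrite expr0n.
  (* With [C = 0] this [t] makes the affine expression equal to -1, so [B] must vanish. *)
  have := h ((A + 1) / (2 * B)); rewrite mulr0 addr0.
  have -> : 2 * ((A + 1) / (2 * B)) * B = A + 1 by field.
  lra.
have := h (B / C); have -> : A - 2 * (B / C) * B + (B / C) ^+ 2 * C = (A * C - B ^+ 2) / C.
  by field; rewrite gt_eqF.
by rewrite pmulr_lge0 ?invr_gt0// subr_ge0.
Qed.

Lemma cauchy_schwarz f g : isL2 f -> isL2 g -> inner f g ^+ 2 <= inner f f * inner g g.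
Proof.
move=> lf lg; apply: discriminant_le; first exact: inner_ge0.
move=> t; have ltg := L2_scale t lg; have lB := L2_sub lf ltg.
have := inner_ge0 (fun x => f x - t * g x).
rewrite (innerBl lf ltg lB) (innerC f (fun x => f x - t * g x)).
rewrite (innerC (fun x => t * g x) (fun x => f x - t * g x)).
rewrite (innerBl lf ltg lf) (innerBl lf ltg ltg) (innerC f (fun x => t * g x)).
rewrite !(innerZl t lg) // (innerC g (fun x => t * g x)) (innerZl t lg lg) (innerC g f).
by nra.
Qed.

(** The telescoped bound keeps its subtracted term, so that the induction on the number of steps
    closes exactly. *)
Lemma geometric_cauchy (a : nat -> R) (C : R) : 0 <= C ->
  (forall k, `|a k.+1 - a k| <= C / 2 ^+ k) ->
  exists l, a @ \oo --> l /\ forall k, `|l - a k| <= 2 * C / 2 ^+ k.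
Proof.
move=> C0 ha.
have hb k j : `|a (k + j)%N - a k| <= 2 * C / 2 ^+ k - 2 * C / 2 ^+ (k + j).
  elim: j => [|j IH]; first by rewrite addn0 !subrr normr0.
  rewrite addnS; have -> : a (k + j).+1 - a k = (a (k + j).+1 - a (k + j)%N) + (a (k + j)%N - a k) by ring.
  apply: le_trans (ler_normD _ _) _; apply: le_trans (lerD (ha _) IH) _.
  rewrite exprS; have p : 2 ^+ (k + j) != 0 :> R by rewrite expf_neq0.
  rewrite le_eqVlt; apply/orP; left; apply/eqP; move: (2 ^+ (k + j)) (2 * C / 2 ^+ k) p => z w p.
  by field.
have p2 j : 0 < 2 ^+ j :> R by rewrite exprn_gt0.
have hb' k j : (k <= j)%N -> `|a j - a k| <= 2 * C / 2 ^+ k.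
  move=> kj; rewrite -(subnKC kj); apply: le_trans (hb _ _) _.
  by rewrite gerBl divr_ge0 ?mulr_ge0// ltW.
have ca : cvgn a.
  apply/cauchy_cvgP/cauchyP => e e0.
  have [k ke] : exists k, 2 * C / 2 ^+ k < e.
    exists (Num.bound (2 * C / e)).
    have b : 2 * C / e < (Num.bound (2 * C / e))%:R.
      by apply: archi_boundP; rewrite divr_ge0 ?mulr_ge0// ltW.
    move: b; rewrite !ltr_pdivrMr// => b; apply: (lt_le_trans b).
    by rewrite mulrC ler_pM2l// -natrX ler_nat ltnW// ltn_expl.
  exists (a k); exists k => // j /= kj; rewrite /ball/= distrC.
  exact: le_lt_trans (hb' _ _ kj) ke.
exists (limn a); split => // k.
have cn : `|a j - a k| @[j --> \oo] --> `|limn a - a k|.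
  by apply: cvg_norm; apply: cvgB => //; exact: cvg_cst.
apply: (cvgr_to_le cn); exists k => // j /= kj; exact: hb'.
Qed.

(* A subsequence whose increments decay like [8^-k] converges wherever
   [S = \sum_k 4^k (v_(k+1) - v_k)^2] is finite, and [4 S / 4^k] bounds the squared error. *)
Lemma L2_complete (u : nat -> T -> R) : (forall p, isL2 (u p)) ->
  (forall e, 0 < e -> exists N, forall p q, (N <= p)%N -> (N <= q)%N ->
     inner (fun x => u p x - u q x) (fun x => u p x - u q x) < e) ->
  exists f, isL2 f /\ forall e, 0 < e -> exists N, forall p, (N <= p)%N ->
     inner (fun x => u p x - f x) (fun x => u p x - f x) < e.
Proof.
move=> lu cu.
have p0 k : 0 < (8 ^+ k.+1)^-1 :> R by rewrite invr_gt0 exprn_gt0.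
have [N HN] := choice (fun k => cu _ (p0 k)).
(* A sum instead of [N k] alone, so that the indices are monotone and exceed both [N k] and [k]. *)
pose phi k := (\sum_(i < k.+1) (N i).+1)%N.
have phiN k : (N k <= phi k)%N.
  by rewrite /phi big_ord_recr/= -addSnnS; apply: leq_trans (leq_addl _ _); rewrite ?leqnSn.
have phik k : (k <= phi k)%N.
  by rewrite /phi -[leqLHS]card_ord -sum1_card big_ord_recr/= -[leqLHS]addn0 leq_add// leq_sum.
have phiS k : (phi k <= phi k.+1)%N by rewrite [in leqRHS]/phi big_ord_recr/= leq_addr.
pose v k := u (phi k).
pose D k x := 4 ^+ k * (v k.+1 x - v k x) ^+ 2.
have mv k : measurable_fun setT (v k) by case: (lu (phi k)).
have mD k : measurable_fun setT (fun x => (D k x)%:E).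
  apply/measurable_EFinP; apply: measurable_funM => //; apply: measurable_funX.
  exact: measurable_funB.
have D0 k x : (0 <= (D k x)%:E)%E by rewrite lee_fin mulr_ge0 ?sqr_ge0// exprn_ge0.
pose S x := (\sum_(k <oo) (D k x)%:E)%E.
have DS k x : ((D k x)%:E <= S x)%E.
  apply: le_trans (nneseries_lim_ge k.+1 (fun i _ _ => D0 i x)).
  by rewrite big_nat_recr//= leeDr// sume_ge0.
have S0 x : (0 <= S x)%E by apply: le_trans (D0 0%N x) (DS _ _).
have mS : measurable_fun setT S by apply: ge0_emeasurable_sum => [k x _ _|k _]; [exact: D0|exact: mD].
have lv k : isL2 (fun x => v k.+1 x - v k x) by apply: L2_sub; exact: lu.
(* The increments are below 8^-(k+1) in squared norm, and 4^k 8^-(k+1) is at most 2^-(k+1), a series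
   with sum 1. *)
have iD k : (\int[m]_x (D k x)%:E <= (1 / (2 ^ k.+1)%:R)%:E)%E.
  have := RintegrableE (RintegrableZ (4 ^+ k) (L2_sq (lv k))) => <-.
  rewrite RintegralZl//; last exact: L2_sq.
  have -> : (\int[m]_x (v k.+1 x - v k x) ^+ 2)%R = inner (fun x => v k.+1 x - v k x) (fun x => v k.+1 x - v k x).
    by apply: eq_Rintegral => x _; rewrite expr2.
  have h := HN k (phi k.+1) (phi k) (leq_trans (phiN k) (phiS k)) (phiN k).
  rewrite lee_fin; apply: (@le_trans _ _ (4 ^+ k * (8 ^+ k.+1)^-1)).
    by rewrite ler_wpM2l ?exprn_ge0// ltW.
  have -> : (8 : R) = 4 * 2 by rewrite -natrM.
  rewrite natrX mul1r exprMn invfM mulrA ler_piMl ?invr_ge0 ?exprn_ge0//.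
  by rewrite ler_pdivrMr ?exprn_gt0// mul1r exprS ler_peMl ?exprn_ge0// ler1n.
have iS : (\int[m]_x S x <= 1)%E.
  rewrite integral_nneseries//; apply: le_trans (epsilon_trick0 predT ler01).
  apply: lee_nneseries => [k _ _|k _]; [by apply: integral_ge0 => x _; exact: D0|exact: iD].
have iSoo : m.-integrable setT S.
  apply/integrableP; split => //; under eq_integral => x _ do rewrite gee0_abs//.
  exact: le_lt_trans iS (ltry _).
(* Setting the sequence to 0 where the series diverges makes it converge at every point, so that the
   limit is measurable. *)
pose w k x := if (S x < +oo)%E then v k x else 0.
have hw x : exists l, (w^~ x) @ \oo --> l /\
    forall k, (S x < +oo)%E -> `|l - v k x| <= 2 * Num.sqrt (fine (S x)) / 2 ^+ k.
  have [Sx|/negbTE Sx] := boolP (S x < +oo)%E; last first.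
    have -> : w^~ x = cst 0 by apply/funext => k; rewrite /w Sx.
    by exists 0; split; [exact: cvg_cst|].
  have -> : w^~ x = v^~ x by apply/funext => k; rewrite /w Sx.
  have [k|l [cl hl]] := @geometric_cauchy (v^~ x) (Num.sqrt (fine (S x))) (sqrtr_ge0 _); last first.
    by exists l; split => // k _; exact: hl.
  have : D k x <= fine (S x) by rewrite -lee_fin fineK ?DS// ge0_fin_numE.
  rewrite /D => h; have p2 : 0 < 2 ^+ k :> R by rewrite exprn_gt0.
  rewrite ler_pdivlMr// -ler_sqr ?nnegrE ?mulr_ge0 ?sqrtr_ge0 ?exprn_ge0//.
  rewrite sqr_sqrtr ?fine_ge0// exprMn real_normK ?num_real// -exprM mulnC exprM mulrC.
  by have -> : (2 ^+ 2 : R) = 4 by rewrite -natrX.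
have [f Hf] := choice hw.
have mw k : measurable_fun setT (w k).
  apply: measurable_fun_ifT => //; exact: measurable_fun_lte.
have mf : measurable_fun setT f.
  by apply: (measurable_fun_cvg (h := w)) => // x _; have [] := Hf x.
have aeS : {ae m, forall x, (S x < +oo)%E}.
  have := integrable_ae measurableT iSoo; apply: filterS => x /(_ Logic.I).
  by rewrite ge0_fin_numE.
have key k : (\int[m]_x ((f x - v k x) ^+ 2)%:E <= (4 / 4 ^+ k)%:E)%E.
  apply: (@le_trans _ _ (\int[m]_x ((4 / 4 ^+ k)%:E * S x))%E).
    apply: ae_ge0_le_integral => //.
    - by move=> x _; rewrite lee_fin sqr_ge0.
    - by apply/measurable_EFinP; apply: measurable_funX; exact: measurable_funB.
    - by move=> x _; rewrite mule_ge0// lee_fin divr_ge0// exprn_ge0.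
    - by apply: emeasurable_funM.
    apply: filterS aeS => x Sx _; have [_ /(_ k Sx) h] := Hf x.
    have SE : S x = (fine (S x))%:E by rewrite fineK// ge0_fin_numE.
    rewrite SE -EFinM lee_fin -(real_normK (num_real _)).
    apply: (@le_trans _ _ ((2 * Num.sqrt (fine (S x)) / 2 ^+ k) ^+ 2)).
      by rewrite lerXn2r ?nnegrE ?divr_ge0 ?mulr_ge0 ?sqrtr_ge0 ?exprn_ge0.
    rewrite expr_div_n exprMn sqr_sqrtr ?fine_ge0// -exprM mulnC exprM.
    by have -> : (2 ^+ 2 : R) = 4 by [rewrite -natrX]; rewrite mulrAC.
  have c0 : (0 <= (4 / 4 ^+ k : R)%:E)%E by rewrite lee_fin divr_ge0// exprn_ge0.
  rewrite (ge0_integralZl _ _ _ (fun x _ => S0 x) c0)//.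
  by rewrite -[leRHS]mule1 lee_wpmul2l// lee_fin divr_ge0// exprn_ge0.
have ld k : isL2 (fun x => f x - v k x).
  split; first exact: measurable_funB.
  exact: le_lt_trans (key k) (ltry _).
have lf : isL2 f.
  have := L2_add (ld 0%N) (lu (phi 0%N)); congr isL2.
  by apply/funext => x; rewrite /v subrK.
exists f; split => // e e0.
have e4 : 0 < e / 4 by rewrite divr_gt0.
have [M HM] := cu _ e4.
have [k [k1 k2]] : exists k, (M <= phi k)%N /\ 4 / 4 ^+ k < e / 4.
  pose K := Num.bound (16 / e); exists (maxn M K); split.
    exact: leq_trans (leq_maxl _ _) (phik _).
  have b : 16 / e < K%:R by apply: archi_boundP; rewrite divr_ge0// ltW.
  have b2 : 16 / e < 4 ^+ maxn M K.
    apply: (lt_le_trans b); rewrite -natrX ler_nat.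
    by apply: leq_trans (leq_maxr M K) _; rewrite ltnW// ltn_expl.
  rewrite ltr_pdivrMr ?exprn_gt0//; move: b2; rewrite ltr_pdivrMr// mulrC => b2; lra.
exists M => p Mp.
have l1 : isL2 (fun x => u p x - v k x) by apply: L2_sub; exact: lu.
have h1 := HM p (phi k) Mp k1.
have h2 : inner (fun x => f x - v k x) (fun x => f x - v k x) < e / 4.
  by rewrite -lte_fin innerE//; apply: le_lt_trans (key k) _; rewrite lte_fin.
have -> : inner (fun x => u p x - f x) (fun x => u p x - f x) =
  inner (fun x => (u p x - v k x) - (f x - v k x)) (fun x => (u p x - v k x) - (f x - v k x)).
  by apply: eq_Rintegral => x _; ring.
apply: (@le_lt_trans _ _ (2 * inner (fun x => u p x - v k x) (fun x => u p x - v k x) +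
   2 * inner (fun x => f x - v k x) (fun x => f x - v k x))); last first.
  move: h1 h2; rewrite -/(v k); lra.
have i1 := RintegrableZ 2 (L2_mul l1 l1); have i2 := RintegrableZ 2 (L2_mul (ld k) (ld k)).
have l3 := L2_sub l1 (ld k).
rewrite /inner -!RintegralZl//; [|exact: L2_mul..].
rewrite -RintegralD//; apply: le_Rintegral => //; [exact: L2_mul|exact: RintegrableD|].
by move=> x _; have := sqr_ge0 ((u p x - v k x) + (f x - v k x)); nra.
Qed.

End L2.

(** * Convolution with bounded kernels supported in the unit ball *)

Section RintegralIg.
Context d (T : measurableType d) {R : realType} (m : {measure set T -> \bar R}).

Lemma RintegrableZl c (f : T -> R) : Rintegrable m f -> (\int[m]_x (c * f x) = c * \int[m]_x f x)%R.
Proof. by move=> fi; rewrite RintegralZl. Qed.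

Lemma RintegrableZr c (f : T -> R) : Rintegrable m f -> (\int[m]_x (f x * c) = (\int[m]_x f x) * c)%R.
Proof. by move=> fi; rewrite RintegralZr. Qed.

End RintegralIg.

Section RintegralProd.
Context d1 d2 (T1 : measurableType d1) (T2 : measurableType d2) {R : realType}.
Variables (m1 : {sigma_finite_measure set T1 -> \bar R}) (m2 : {sigma_finite_measure set T2 -> \bar R}).
Implicit Type F : T1 * T2 -> R.

Lemma measurable_Rintegral_prod F : measurable_fun setT F ->
  measurable_fun setT (fun x => (\int[m2]_y F (x, y))%R).
Proof.
move=> mF; have mE : measurable_fun setT (EFin \o F) by exact/measurable_EFinP.
rewrite /Rintegral; apply: (measurableT_comp (f := fine)) => //.
have -> : (fun x => \int[m2]_y (F (x, y))%:E)%E =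
   (fun x => \int[m2]_y (EFin \o F)^\+ (x, y) - \int[m2]_y (EFin \o F)^\- (x, y))%E.
  by apply/funext => x; rewrite [LHS]integralE; congr (_ + - _)%E; apply: eq_integral => y _; rewrite ?funeposE ?funenegE.
apply: emeasurable_funB; apply: (measurable_fun_fubini_tonelli_F (m2 := m2)) => //.
- exact: measurable_funepos.
- exact: measurable_funeneg.
Qed.

Lemma Rintegrable_prod F (h : T1 -> R) : measurable_fun setT F -> Rintegrable m1 h ->
  (forall x, Rintegrable m2 (fun y => F (x, y))) ->
  (forall x, (\int[m2]_y `|F (x, y)|)%R <= h x) -> Rintegrable (m1 \x m2)%E F.
Proof.
move=> mF ih iF Fh; have mE : measurable_fun setT (EFin \o F) by exact/measurable_EFinP.
apply/(integrable12ltyP m1 m2 mE).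
have /integrableP[_] := ih; apply: le_lt_trans; apply: ge0_le_integral => //.
- by move=> x _; apply: integral_ge0.
- apply: (measurable_fun_fubini_tonelli_F (m2 := m2) (abse \o (EFin \o F))) => [|p].
    exact: measurableT_comp.
  exact: abse_ge0.
- by apply: measurableT_comp => //; apply/measurable_EFinP; exact: Rintegrable_measurable ih.
move=> x _; have := Fh x; rewrite -lee_fin (RintegrableE (Rintegrable_abs (iF x))) => /le_trans; apply.
by rewrite lee_fin ler_norm.
Qed.

(** The inner integral is here a real number, while the library has an extended real; they agree
    wherever the section is integrable, hence almost everywhere. *)
Lemma Rfubini1 F : Rintegrable (m1 \x m2)%E F ->
  (\int[(m1 \x m2)%E]_z F z)%R = (\int[m1]_x \int[m2]_y F (x, y))%R.
Proof.
move=> iF; rewrite /Rintegral -(integral12_prod_meas1 iF); congr fine.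
have h := ae_integrable1 iF; apply: ae_eq_integral => //.
- exact: (measurable_fubini_F iF).
- apply/measurable_EFinP; apply: measurable_Rintegral_prod; exact: Rintegrable_measurable iF.
by apply: filterS h => x ix _; rewrite /fubini_F fineK//; exact: integrable_fin_num.
Qed.

Lemma Rfubini2 F : Rintegrable (m1 \x m2)%E F ->
  (\int[(m1 \x m2)%E]_z F z)%R = (\int[m2]_y \int[m1]_x F (x, y))%R.
Proof.
move=> iF; rewrite /Rintegral -(integral21_prod_meas1 iF); congr fine.
have h := ae_integrable2 iF; apply: ae_eq_integral => //.
- exact: (measurable_fubini_G iF).
- apply/measurable_EFinP.
  apply: (measurableT_comp (f := fine)) => //; exact: (measurable_fubini_G iF).
by apply: filterS h => x ix _; rewrite /fubini_G fineK//; exact: integrable_fin_num.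
Qed.

End RintegralProd.

Section Convolution.
Context {R : realType} (n : nat).
Local Notation V := (n.-tuple R).
Local Notation m := (@mu R n).
Implicit Types (f g h u v Q S : V -> R) (x y z : V).

Lemma integral_vsubl a f : measurable_fun setT f ->
  (\int[m]_y f (vsub a y) = \int[m]_y f y)%R.
Proof.
move=> mf; have mE : measurable_fun setT (EFin \o f) by exact/measurable_EFinP.
rewrite /Rintegral; congr fine; rewrite [LHS]integralE [RHS]integralE; congr (_ + - _)%E.
  apply: (etrans _ (ge0_integral_vsubl a (measurable_funepos mE) (funepos_ge0 _))).
  by apply: eq_integral => y _; rewrite !funeposE.
apply: (etrans _ (ge0_integral_vsubl a (measurable_funeneg mE) (funeneg_ge0 _))).
by apply: eq_integral => y _; rewrite !funenegE.
Qed.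

Lemma integral_vsubr a f : measurable_fun setT f ->
  (\int[m]_y f (vsub y a) = \int[m]_y f y)%R.
Proof.
move=> mf; have mE : measurable_fun setT (EFin \o f) by exact/measurable_EFinP.
rewrite /Rintegral; congr fine; rewrite [LHS]integralE [RHS]integralE; congr (_ + - _)%E.
  apply: (etrans _ (ge0_integral_vsubr a (measurable_funepos mE) (funepos_ge0 _))).
  by apply: eq_integral => y _; rewrite !funeposE.
apply: (etrans _ (ge0_integral_vsubr a (measurable_funeneg mE) (funeneg_ge0 _))).
by apply: eq_integral => y _; rewrite !funenegE.
Qed.

Lemma measurable_subl f x : measurable_fun setT f -> measurable_fun setT (fun y => f (vsub x y)).
Proof. by move=> mf; apply: (measurableT_comp mf); exact: measurable_vsub. Qed.

Lemma measurable_subr f x : measurable_fun setT f -> measurable_fun setT (fun y => f (vsub y x)).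
Proof. by move=> mf; apply: (measurableT_comp mf); exact: measurable_vsubr. Qed.

Lemma measurable_sub2 f : measurable_fun setT f ->
  measurable_fun setT (fun p : V * V => f (vsub p.1 p.2)).
Proof. by move=> mf; apply: (measurableT_comp mf); exact: measurable_vsub2. Qed.

(** After exchanging the integrals, translation invariance removes [y] from the inner one. *)
Lemma ge0_integral_Rconv f h : measurable_fun setT f -> measurable_fun setT h ->
  (forall z, 0 <= f z) -> (forall z, 0 <= h z) ->
  (\int[m]_x \int[m]_y (f (vsub x y) * h y)%:E = (\int[m]_x (f x)%:E) * \int[m]_y (h y)%:E)%E.
Proof.
move=> mf mh f0 h0.
have mG : measurable_fun setT (fun p : V * V => (f (vsub p.1 p.2) * h p.2)%:E).
  apply/measurable_EFinP; apply: measurable_funM; first exact: measurable_sub2.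
  exact: (measurableT_comp mh measurable_snd).
have G0 (p : V * V) : (0 <= (f (vsub p.1 p.2) * h p.2)%:E)%E by rewrite lee_fin mulr_ge0.
apply: (etrans (fubini_tonelli (m1 := m) (m2 := m) _ mG G0)) => /=.
have mf' : measurable_fun setT (fun z => (f z)%:E) by exact/measurable_EFinP.
have mh' : measurable_fun setT (fun z => (h z)%:E) by exact/measurable_EFinP.
have f0' z : (0 <= (f z)%:E)%E by rewrite lee_fin.
have h0' z : (0 <= (h z)%:E)%E by rewrite lee_fin.
have i0 : (0 <= \int[m]_x (f x)%:E)%E by apply: integral_ge0.
transitivity (\int[m]_y ((\int[m]_x (f x)%:E) * (h y)%:E))%E; last first.
  exact: (@ge0_integralZl _ _ _ m setT measurableT _ mh' _ (fun z _ => h0' z) i0).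
apply: eq_integral => y _.
have mfy : measurable_fun setT (fun x => (f (vsub x y))%:E).
  by apply: (measurableT_comp mf'); exact: measurable_vsubr.
rewrite -(ge0_integral_vsubr y mf' f0').
transitivity (\int[m]_x ((f (vsub x y))%:E * (h y)%:E))%E; last first.
  exact: (@ge0_integralZr _ _ _ m setT measurableT _ mfy _ (fun z _ => f0' _) (h0' y)).
by apply: eq_integral => x _; rewrite EFinM.
Qed.

Lemma L2_subl f x : isL2 m f -> isL2 m (fun y => f (vsub x y)).
Proof.
move=> [mf fi]; split; first exact: measurable_subl.
have mE : measurable_fun setT (fun y => (f y ^+ 2)%:E).
  by apply/measurable_EFinP; exact: measurable_funX.
by rewrite /sqint (ge0_integral_vsubl x mE)// => y; rewrite lee_fin sqr_ge0.
Qed.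

Lemma unit_ball_ge0 z : 0 <= unit_ball z. Proof. exact: ler0n. Qed.

Lemma unit_ball_sqr z : unit_ball z * unit_ball z = unit_ball z.
Proof. by rewrite /unit_ball -natrM mulnb andbb. Qed.

Lemma unit_ball_le1 z : unit_ball z <= 1. Proof. by rewrite /unit_ball lern1 leq_b1. Qed.

Lemma Rintegrable_unit_ball : Rintegrable m (@unit_ball R n).
Proof. apply: Rintegrable_ge0; [exact: measurable_unit_ball|exact: unit_ball_ge0|exact: integral_unit_ball_fin]. Qed.

Lemma L2_unit_ball : isL2 m (@unit_ball R n).
Proof.
apply: sq_L2; first exact: measurable_unit_ball.
by have := Rintegrable_unit_ball; congr Rintegrable; apply/funext => z; rewrite expr2 unit_ball_sqr.
Qed.

(** One inequality encodes both boundedness and support in the ball, so every estimate reduces to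
    convolution with [unit_ball]. *)
Definition kern_le M Q := [/\ measurable_fun setT Q, 0 <= M & forall z, `|Q z| <= M * unit_ball z].
Definition kern Q := exists M, kern_le M Q.

Lemma kern_L2 Q : kern Q -> isL2 m Q.
Proof. by move=> [M [mQ M0 QM]]; apply: L2_le QM => //; exact: L2_scale L2_unit_ball. Qed.

Lemma kern_unit_ball : kern (@unit_ball R n).
Proof.
exists 1; split => //; first exact: measurable_unit_ball.
by move=> z; rewrite mul1r ger0_norm// unit_ball_ge0.
Qed.

Definition Rconv Q g x : R := (\int[m]_y (Q (vsub x y) * g y))%R.

Lemma Rconv_integrable Q g x : kern Q -> isL2 m g -> Rintegrable m (fun y => Q (vsub x y) * g y).
Proof. by move=> kQ lg; apply: L2_mul lg; apply: L2_subl; exact: kern_L2. Qed.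

Lemma measurable_Rconv Q g : measurable_fun setT Q -> measurable_fun setT g ->
  measurable_fun setT (Rconv Q g).
Proof.
move=> mQ mg; apply: (@measurable_Rintegral_prod _ _ _ _ _ m (fun p => Q (vsub p.1 p.2) * g p.2)).
apply: measurable_funM; first exact: measurable_sub2.
exact: (measurableT_comp mg measurable_snd).
Qed.

Lemma L2_abs g : isL2 m g -> isL2 m (fun y => `|g y|).
Proof.
move=> [mg gi]; split; first exact: measurableT_comp.
by move: gi; rewrite /sqint; under eq_integral do rewrite -(real_normK (num_real _)).
Qed.

Definition Rconv_abs g := Rconv (@unit_ball R n) (fun y => `|g y|).

(* Cauchy-Schwarz against the indicator of the ball bounds the square pointwise by
   a convolution of [g ^ 2], whose integral is computed by Tonelli. *)
Lemma L2_Rconv_abs g : isL2 m g -> isL2 m (Rconv_abs g).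
Proof.
move=> lg; have mg := lg.1; have la := L2_abs lg.
have mc : measurable_fun setT (Rconv_abs g).
  by apply: measurable_Rconv; [exact: measurable_unit_ball|exact: la.1].
split => //; pose W := inner m (@unit_ball R n) (@unit_ball R n).
have W0 : 0 <= W by exact: inner_ge0.
have mG : measurable_fun setT (fun p : V * V => (unit_ball (vsub p.1 p.2) * g p.2 ^+ 2)%:E).
  apply/measurable_EFinP; apply: measurable_funM.
    by apply: measurable_sub2; exact: measurable_unit_ball.
  by apply: measurable_funX; exact: (measurableT_comp mg measurable_snd).
have G0 (p : V * V) : (0 <= (unit_ball (vsub p.1 p.2) * g p.2 ^+ 2)%:E)%E.
  by rewrite lee_fin mulr_ge0 ?unit_ball_ge0 ?sqr_ge0.
have le1 x : (((Rconv_abs g x) ^+ 2)%:E <= W%:E * \int[m]_y (unit_ball (vsub x y) * g y ^+ 2)%:E)%E.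
  have lb : isL2 m (fun y => unit_ball (vsub x y)) by apply: L2_subl; exact: L2_unit_ball.
  have lbg : isL2 m (fun y => unit_ball (vsub x y) * `|g y|).
    apply: (L2_le _ la) => [|y]; first by apply: measurable_funM; [exact: lb.1|exact: la.1].
    by rewrite normrM normr_id ler_piMl// ger0_norm ?unit_ball_ge0 ?unit_ball_le1.
  have := cauchy_schwarz lb lbg.
  have -> : inner m (fun y => unit_ball (vsub x y)) (fun y => unit_ball (vsub x y) * `|g y|) = Rconv_abs g x.
    by apply: eq_Rintegral => y _; rewrite mulrA unit_ball_sqr.
  have -> : inner m (fun y => unit_ball (vsub x y)) (fun y => unit_ball (vsub x y)) = W.
    apply: (integral_vsubl x (f := fun z => unit_ball z * unit_ball z)).
    by apply: measurable_funM; exact: measurable_unit_ball.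
  rewrite -lee_fin [X in (_ <= X)%E]EFinM (innerE lbg) /sqint => /le_trans; apply.
  apply: lee_wpmul2l; first by rewrite lee_fin.
  apply: ge0_le_integral => //.
  - by move=> y _; rewrite lee_fin sqr_ge0.
  - by apply/measurable_EFinP; apply: measurable_funX; exact: lbg.1.
  - apply/measurable_EFinP; apply: measurable_funM; [exact: lb.1|exact: measurable_funX].
  by move=> y _; rewrite lee_fin exprMn real_normK ?num_real// expr2 unit_ball_sqr.
have m1 := measurable_fun_fubini_tonelli_F (m2 := m) _ mG G0.
have e2 : (\int[m]_x \int[m]_y (unit_ball (vsub x y) * g y ^+ 2)%:E = W%:E * sqint m g)%E.
  have -> : W%:E = (\int[m]_x (unit_ball x)%:E)%E.
    by rewrite -(RintegrableE Rintegrable_unit_ball); congr EFin; apply: eq_Rintegral => z _; rewrite unit_ball_sqr.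
  apply: (ge0_integral_Rconv (measurable_unit_ball (n:=n)) (measurable_funX 2 mg) unit_ball_ge0).
  by move=> z; exact: sqr_ge0.
apply: (@le_lt_trans _ _ (W%:E * (W%:E * sqint m g))%E); last first.
  have := innerE lg => <-; rewrite -!EFinM; exact: ltry.
rewrite -e2 -(@ge0_integralZl _ _ _ m setT measurableT _ m1) /=; last 2 first.
- by move=> x _; apply: integral_ge0 => y _; exact: (G0 (x, y)).
- by rewrite lee_fin.
apply: ge0_le_integral => //.
- by move=> x _; rewrite lee_fin sqr_ge0.
- by apply/measurable_EFinP; exact: measurable_funX.
exact: emeasurable_funM.
Qed.

Lemma Rconv_le M Q g x : kern_le M Q -> isL2 m g -> `|Rconv Q g x| <= M * Rconv_abs g x.
Proof.
move=> kQ lg; have [mQ M0 QM] := kQ; have kQ' : kern Q by exists M.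
have i1 := Rconv_integrable x kQ' lg; have i2 := Rconv_integrable x kern_unit_ball (L2_abs lg).
apply: le_trans (le_normr_Rintegral measurableT i1) _.
rewrite /Rconv_abs /Rconv -RintegralZl//; apply: le_Rintegral => //; [exact: Rintegrable_abs|exact: RintegrableZ|].
by move=> y _; rewrite normrM mulrA ler_wpM2r.
Qed.

Lemma L2_Rconv Q g : kern Q -> isL2 m g -> isL2 m (Rconv Q g).
Proof.
move=> [M kQ] lg; apply: (L2_le (g := fun x => M * Rconv_abs g x)).
- by apply: measurable_Rconv; [case: kQ|case: lg].
- by apply: L2_scale; exact: L2_Rconv_abs.
by move=> x; exact: Rconv_le.
Qed.

(** The inner integral of the majorant is [M * Rconv_abs v], again in L^2, and a product of two L^2
    functions is integrable. This justifies the uses of Fubini for convolutions. *)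
Lemma Rintegrable_Rconv_prod M u v (F : V * V -> R) : 0 <= M -> isL2 m u -> isL2 m v ->
  measurable_fun setT F ->
  (forall p, `|F p| <= `|u p.1| * (M * (unit_ball (vsub p.1 p.2) * `|v p.2|))) -> Rintegrable (m \x m)%E F.
Proof.
move=> M0 lu lv mF FM.
have lc : isL2 m (fun x => M * Rconv_abs v x) by apply: L2_scale; exact: L2_Rconv_abs.
have iv x : Rintegrable m (fun y => `|u x| * (M * (unit_ball (vsub x y) * `|v y|))).
  by do 2 apply: RintegrableZ; exact: Rconv_integrable kern_unit_ball (L2_abs lv).
have mFx x : measurable_fun setT (fun y => F (x, y)).
  exact: (measurableT_comp mF (pair1_measurable x)).
have iF x : Rintegrable m (fun y => F (x, y)).
  apply: Rintegrable_le (mFx x) (iv x) _ => y; exact: (FM (x, y)).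
apply: (Rintegrable_prod mF (L2_mul (L2_abs lu) lc) iF) => x.
have -> : `|u x| * (M * Rconv_abs v x) = (\int[m]_y (`|u x| * (M * (unit_ball (vsub x y) * `|v y|))))%R.
  rewrite RintegralZl//; last by apply: RintegrableZ; exact: Rconv_integrable kern_unit_ball (L2_abs lv).
  by rewrite RintegralZl//; exact: Rconv_integrable kern_unit_ball (L2_abs lv).
by apply: le_Rintegral => //; [exact: Rintegrable_abs|exact: iv].
Qed.

(** With [s] equal to 1 or -1, one notion covers even and odd kernels; multiplication by a
    coordinate changes the sign. *)
Definition parity (s : R) Q := forall x y, Q (vsub y x) = s * Q (vsub x y).

(** By Fubini the adjoint of a convolution is convolution with the reflected kernel. *)
Lemma inner_Rconv s Q u v : kern Q -> parity s Q -> isL2 m u -> isL2 m v ->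
  inner m u (Rconv Q v) = s * inner m (Rconv Q u) v.
Proof.
move=> kQ pQ lu lv; have [M [mQ M0 QM]] := kQ.
pose F (p : V * V) := u p.1 * (Q (vsub p.1 p.2) * v p.2).
have mF : measurable_fun setT F.
  apply: measurable_funM; first exact: (measurableT_comp lu.1 measurable_fst).
  apply: measurable_funM; first exact: measurable_sub2.
  exact: (measurableT_comp lv.1 measurable_snd).
have iF : Rintegrable (m \x m)%E F.
  apply: (Rintegrable_Rconv_prod M0 lu lv mF) => p.
  by rewrite !normrM ler_wpM2l// mulrA ler_wpM2r.
have lc := L2_Rconv kQ lu.
transitivity (\int[m]_x \int[m]_y F (x, y))%R.
  by apply: eq_Rintegral => x _; exact: (esym (RintegrableZl _ (Rconv_integrable x kQ lv))).
apply: (etrans (esym (Rfubini1 iF))); apply: (etrans (Rfubini2 iF)).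
apply: (etrans _ (RintegrableZl s (L2_mul lc lv))).
apply: eq_Rintegral => y _; rewrite /F mulrA.
apply: (etrans _ (congr1 (fun t => t * v y) (RintegrableZl s (Rconv_integrable y kQ lu)))).
apply: (etrans _ (RintegrableZr (v y) (RintegrableZ s (Rconv_integrable y kQ lu)))).
by apply: eq_Rintegral => x _; rewrite /= (pQ y x); ring.
Qed.

Lemma RconvC Q S g x : kern Q -> kern S -> isL2 m g -> Rconv Q (Rconv S g) x = Rconv S (Rconv Q g) x.
Proof.
move=> kQ kS lg.
have [M [mQ M0 QM]] := kQ; have [N [mS N0 SN]] := kS.
have fub Q' S' : kern Q' -> kern S' -> Rconv Q' (Rconv S' g) x =
    (\int[m]_z \int[m]_y (Q' (vsub x y) * (S' (vsub y z) * g z)))%R.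
  move=> kQ' kS'; have [M' [mQ' M0' QM']] := kQ'; have [N' [mS' N0' SN']] := kS'.
  pose F (p : V * V) := Q' (vsub x p.1) * (S' (vsub p.1 p.2) * g p.2).
  have lq := L2_subl x (kern_L2 kQ').
  have mF : measurable_fun setT F.
    apply: measurable_funM; first exact: (measurableT_comp lq.1 measurable_fst).
    apply: measurable_funM; first exact: measurable_sub2.
    exact: (measurableT_comp lg.1 measurable_snd).
  have iF : Rintegrable (m \x m)%E F.
    apply: (Rintegrable_Rconv_prod N0' lq lg mF) => p.
    by rewrite !normrM ler_wpM2l// mulrA ler_wpM2r.
  apply: (etrans _ (etrans (esym (Rfubini1 iF)) (Rfubini2 iF))).
  by apply: eq_Rintegral => y _; exact: (esym (RintegrableZl _ (Rconv_integrable y kS' lg))).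
rewrite !fub//; apply: eq_Rintegral => z _.
have mf : measurable_fun setT (fun y => Q (vsub x y) * (S (vsub y z) * g z)).
  apply: measurable_funM; first exact: measurable_subl.
  by apply: measurable_funM => //; exact: measurable_subr.
have mf' : measurable_fun setT (fun y => Q (vsub x (vsub x y)) * (S (vsub (vsub x y) z) * g z)).
  exact: (measurable_subl x mf).
(* Substituting x + z - y for y exchanges x - y with y - z, and so the two kernels. *)
apply: (etrans (esym (integral_vsubl x mf))); apply: (etrans (esym (integral_vsubr z mf'))).
apply: eq_Rintegral => y _; rewrite vsubK.
have -> : vsub (vsub x (vsub y z)) z = vsub x y.
  by apply: eq_from_tnth => i; rewrite !tnth_vsub; ring.
by ring.
Qed.

End Convolution.

(** * Moments determine integrable functions supported in the ball *)

Section RintegralDominated.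
Context d (T : measurableType d) {R : realType} (m : {measure set T -> \bar R}).

Lemma Rdominated_cvg (f_ : nat -> T -> R) (f g : T -> R) :
  (forall k, measurable_fun setT (f_ k)) -> measurable_fun setT f -> Rintegrable m g ->
  (forall k x, `|f_ k x| <= g x) -> (forall x, f_ k x @[k --> \oo] --> f x) ->
  (\int[m]_x f_ k x)%R @[k --> \oo] --> (\int[m]_x f x)%R.
Proof.
move=> mf_ mf ig_g fg cf.
have iF : Rintegrable m f.
  apply: Rintegrable_le mf ig_g _ => x; apply: (cvgr_to_le (cvg_norm (cf x))).
  exact: nearW.
have [] := @dominated_convergence _ _ _ m setT measurableT (fun k => EFin \o f_ k) (EFin \o f) (EFin \o g).
- by move=> k; exact/measurable_EFinP.
- exact/measurable_EFinP.
- by apply: aeW => x _; apply: cvg_EFin; [exact: nearW|exact: cf].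
- exact: ig_g.
- by apply: aeW => x k _; rewrite /= lee_fin.
move=> _ _ h; apply: fine_cvg; have := RintegrableE iF => ->; exact: h.
Qed.

End RintegralDominated.

Section Moments.
Context {R : realType} (n : nat).
Local Notation V := (n.-tuple R).
Local Notation m := (@mu R n).
Implicit Types (w phi psi : V -> R) (z : V) (E : set V).

(** A monomial is coded by the list of its factors, repetitions giving exponents; multiplying by a
    coordinate prepends an index. *)
Definition mon (s : seq 'I_n) z : R := \prod_(i <- s) tnth z i.

Lemma measurable_mon s : measurable_fun setT (mon s).
Proof.
apply: measurable_prod => i _; exact: measurable_tnth.
Qed.

Lemma coord_le1 z i : sqn z <= 1 -> `|tnth z i| <= 1.
Proof.
move=> z1; rewrite -(@ler_pXn2r _ 2)// ?nnegrE// expr1n real_normK ?num_real//.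
apply: le_trans z1; rewrite /sqn (bigD1 i)//= lerDl; apply: sumr_ge0 => j _; exact: sqr_ge0.
Qed.

Lemma mon_le1 s z : sqn z <= 1 -> `|mon s z| <= 1.
Proof.
move=> z1; rewrite /mon normr_prod; elim: s => [|i s IH]; first by rewrite big_nil.
by rewrite big_cons mulr_ile1 ?coord_le1//; apply: prodr_ge0 => j _.
Qed.

Definition zero_moments w := [/\ Rintegrable m w, (forall z, ~~ (sqn z <= 1) -> w z = 0) &
  forall s, (\int[m]_z (mon s z * w z))%R = 0].

(** Bounds are asked on the ball alone: coordinates are unbounded elsewhere, where the functions
    under study vanish. *)
Definition ball_bounded C phi := measurable_fun setT phi /\ forall z, sqn z <= 1 -> `|phi z| <= C.

(* Functions that preserve vanishing of all moments; the indicators among them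
   form a sigma-algebra containing the coordinate half-spaces. *)
Definition multiplier phi := (exists C, ball_bounded C phi) /\
  forall w, zero_moments w -> zero_moments (fun z => phi z * w z).

Lemma ball_bounded_le C phi w z : ball_bounded C phi -> zero_moments w -> `|phi z * w z| <= C * `|w z|.
Proof.
move=> [_ b] [_ w0 _]; rewrite normrM; have [z1|z1] := boolP (sqn z <= 1).
  by rewrite ler_wpM2r// b.
by rewrite w0// normr0 !mulr0.
Qed.

Lemma ball_bounded_integrable C phi w : ball_bounded C phi -> zero_moments w -> Rintegrable m (fun z => phi z * w z).
Proof.
move=> b mw; have [iw _ _] := mw; apply: Rintegrable_le (RintegrableZ C (Rintegrable_abs iw)) _.
  by apply: measurable_funM; [case: b|exact: Rintegrable_measurable iw].
by move=> z; apply: ball_bounded_le.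
Qed.

Lemma multiplierI C phi : ball_bounded C phi ->
  (forall w s, zero_moments w -> (\int[m]_z (mon s z * (phi z * w z)))%R = 0) -> multiplier phi.
Proof.
move=> b h; split; first by exists C.
move=> w mw; split; [exact: ball_bounded_integrable b mw| |by move=> s; exact: h].
by move=> z z1; have [_ w0 _] := mw; rewrite w0// mulr0.
Qed.

Lemma mon_ball_bounded s : ball_bounded 1 (mon s).
Proof. by split; [exact: measurable_mon|move=> z; exact: mon_le1]. Qed.

Lemma multiplier_coord i : multiplier (fun z => tnth z i).
Proof.
apply: (@multiplierI 1); first by split; [exact: measurable_tnth|move=> z z1; exact: coord_le1].
move=> w s [_ _ /(_ (i :: s)) <-]; apply: eq_Rintegral => z _.
by rewrite /mon big_cons; ring.
Qed.

Lemma multiplier_cst c : multiplier (fun=> c).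
Proof.
apply: (@multiplierI `|c|); first by split.
move=> w s mw; have [_ _ h] := mw.
transitivity (c * \int[m]_z (mon s z * w z))%R; last by rewrite h mulr0.
apply: (etrans _ (RintegrableZl c (ball_bounded_integrable (mon_ball_bounded s) mw))).
by apply: eq_Rintegral => z _; ring.
Qed.

Lemma multiplierM phi psi : multiplier phi -> multiplier psi -> multiplier (fun z => phi z * psi z).
Proof.
move=> [[C [mp bp]] hp] [[D [mq bq]] hq].
apply: (@multiplierI (C * D)).
  split; first exact: measurable_funM.
  by move=> z z1; rewrite normrM ler_pM// ?bp ?bq.
move=> w s mw; have [_ _ /(_ s) <-] := hp _ (hq _ mw).
by apply: eq_Rintegral => z _; ring.
Qed.

Lemma multiplierD phi psi : multiplier phi -> multiplier psi -> multiplier (fun z => phi z + psi z).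
Proof.
move=> [[C [mp bp]] hp] [[D [mq bq]] hq].
apply: (@multiplierI (C + D)).
  split; first exact: measurable_funD.
  by move=> z z1; rewrite (le_trans (ler_normD _ _))// lerD// ?bp ?bq.
move=> w s mw; have mw1 := hp _ mw; have mw2 := hq _ mw.
have i1 := ball_bounded_integrable (mon_ball_bounded s) mw1; have i2 := ball_bounded_integrable (mon_ball_bounded s) mw2.
have [_ _ h1] := mw1; have [_ _ h2] := mw2.
transitivity (\int[m]_z (mon s z * (phi z * w z)) + \int[m]_z (mon s z * (psi z * w z)))%R.
  apply: (etrans _ (RintegralD measurableT i1 i2)).
  by apply: eq_Rintegral => z _; ring.
by rewrite h1 h2 addr0.
Qed.

(** The moments pass to the limit by dominated convergence, with majorant [C * |w|]. *)
Lemma multiplier_lim C (phi_ : nat -> V -> R) phi : measurable_fun setT phi ->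
  (forall k, multiplier (phi_ k)) -> (forall k z, sqn z <= 1 -> `|phi_ k z| <= C) ->
  (forall z, phi_ k z @[k --> \oo] --> phi z) -> multiplier phi.
Proof.
move=> mp h b c; apply: (@multiplierI C).
  split => // z z1; apply: (cvgr_to_le (cvg_norm (c z))); apply: nearW => k; exact: b.
move=> w s mw.
have bk k : ball_bounded C (phi_ k) by split; [have [[? []]] := h k|exact: b].
have [iw w0 _] := mw; have mwm := Rintegrable_measurable iw.
have h0 k : (\int[m]_z (mon s z * (phi_ k z * w z)))%R = 0.
  by have [_ /(_ _ mw) []] := h k.
have key : (\int[m]_z (mon s z * (phi_ k z * w z)))%R @[k --> \oo] -->
    (\int[m]_z (mon s z * (phi z * w z)))%R.
  apply: (@Rdominated_cvg _ _ _ m _ _ (fun z => C * `|w z|)).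
  - move=> k; apply: measurable_funM; first exact: measurable_mon.
    by apply: measurable_funM => //; case: (bk k).
  - apply: measurable_funM; first exact: measurable_mon.
    exact: measurable_funM.
  - exact: RintegrableZ (Rintegrable_abs iw).
  - move=> k z; have [z1|z1] := boolP (sqn z <= 1); last by rewrite w0// !mulr0 normr0 mulr0.
    rewrite normrM; apply: le_trans (ball_bounded_le z (bk k) mw).
    by rewrite ler_piMl// mon_le1.
  move=> z; apply: cvgM; first exact: cvg_cst.
  by apply: cvgM => //; exact: cvg_cst.
apply: (cvg_unique _ key) => //=.
by under eq_fun do rewrite h0; exact: cvg_cst.
Qed.

(** The partial sums of the exponential series are polynomials in [phi], bounded by [expR C] on the
    ball. *)
Lemma multiplier_exp phi : multiplier phi -> multiplier (fun z => expR (phi z)).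
Proof.
move=> hp; have [[C [mp bp]] _] := hp.
apply: (@multiplier_lim (expR C) (fun k z => series (exp_coeff (phi z)) k)).
- exact: (measurableT_comp (@measurable_expR R) mp).
- have pw j : multiplier (fun z => phi z ^+ j).
    elim: j => [|j IH]; first exact: multiplier_cst.
    by have := multiplierM hp IH; congr multiplier; apply/funext => z; rewrite exprS.
  elim => [|k IH].
    by have := multiplier_cst 0; congr multiplier; apply/funext => z; rewrite /series/= big_geq.
  have := multiplierD IH (multiplierM (pw k) (multiplier_cst (k`!%:R^-1))); congr multiplier; apply/funext => z.
  by rewrite /series/= big_nat_recr.
- move=> k z z1; rewrite /series/=; apply: le_trans (ler_norm_sum _ _ _) _.
  apply: (@le_trans _ _ (series (exp_coeff C) k)).
    apply: ler_sum => j _; rewrite /exp_coeff/= normrM normrX normfV normr_nat.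
    by rewrite ler_wpM2r ?invr_ge0// lerXn2r ?nnegrE// ?bp// (le_trans _ (bp _ z1)).
  apply: nondecreasing_cvgn_le; last exact: is_cvg_series_exp_coeff.
  apply: nondecreasing_series => j _ _; rewrite /exp_coeff/= divr_ge0// exprn_ge0//.
  exact: le_trans (bp _ z1).
by move=> z; exact: is_cvg_series_exp_coeff.
Qed.

Lemma cvg_le_harmonic (u : nat -> R) l C :
  (forall k, `|u k - l| <= C / k.+1%:R) -> u k @[k --> \oo] --> l.
Proof.
move=> h; have hc : C / k.+1%:R @[k --> \oo] --> 0.
  by rewrite -[X in _ --> X](mulr0 C); apply: cvgM; [exact: cvg_cst|exact: cvg_harmonic].
apply/subr_cvg0; apply/norm_cvg0P; apply: (squeeze_cvgr _ (cvg_cst 0) hc).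
by apply: nearW => k; rewrite normr_ge0 h.
Qed.

(* [exp (- k exp (k^2 (a - z_i)))] tends to the indicator of [z_i > a]. *)
Lemma multiplier_gt i a : multiplier (\1_[set z | a < tnth z i]).
Proof.
pose t k z : R := k.+1%:R * expR (k.+1%:R ^+ 2 * (a - tnth z i)).
have t0 k z : 0 <= t k z by rewrite mulr_ge0 ?expR_ge0.
have ht k : multiplier (t k).
  apply: multiplierM; first exact: multiplier_cst.
  apply: multiplier_exp; apply: multiplierM; first exact: multiplier_cst.
  apply: multiplierD; first exact: multiplier_cst.
  have := multiplierM (multiplier_cst (-1)) (multiplier_coord i).
  by congr multiplier; apply/funext => z; rewrite mulN1r.
apply: (@multiplier_lim 1 (fun k z => expR (-1 * t k z))).
- apply: measurable_indic; have := @measurable_tnth _ R n i measurableT `]a, +oo[%classic.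
  rewrite setTI => /(_ (measurable_itv _)); congr (measurable _).
  by apply/seteqP; split => z /=; rewrite in_itv/= andbT.
- by move=> k; apply: multiplier_exp; apply: multiplierM; [exact: multiplier_cst|exact: ht].
- by move=> k z _; rewrite ger0_norm ?expR_ge0// expR_le1 mulN1r oppr_le0.
move=> z; have -> : \1_[set z | a < tnth z i] z = (a < tnth z i)%R%:R :> R.
  by rewrite indicE; congr (nat_of_bool _)%:R; apply/idP/idP; rewrite inE.
have k0 k : 0 < k.+1%:R :> R by rewrite ltr0n.
have k1 k : 1 <= k.+1%:R :> R by rewrite ler1n.
have [az|az] := boolP (a < tnth z i) => /=.
  have e0 : 0 < tnth z i - a by rewrite subr_gt0.
  (* Both bounds come from exp(y) >= 1 + y: it gives 1 - exp(-t) <= t, and then t <= 1 / ((k + 1)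
     (z_i - a)). *)
  apply: (@cvg_le_harmonic _ _ (tnth z i - a)^-1) => k.
  have h1 : expR (-1 * t k z) <= 1 by rewrite expR_le1 mulN1r oppr_le0.
  rewrite ler0_norm ?subr_le0// opprB lerBlDr.
  have h2 := expR_ge1Dx (-1 * t k z).
  rewrite mulN1r in h2 *.
  suff h3 : t k z <= (tnth z i - a)^-1 / k.+1%:R.
    by rewrite -[leLHS](subrK (t k z)) addrC lerD.
  rewrite /t; have -> : k.+1%:R ^+ 2 * (a - tnth z i) = - (k.+1%:R ^+ 2 * (tnth z i - a)) by ring.
  rewrite expRN -invfM ler_pdivrMr ?expR_gt0//.
  have h4 := expR_ge1Dx (k.+1%:R ^+ 2 * (tnth z i - a)).
  rewrite mulrC ler_pdivlMr ?mulr_gt0//; apply: le_trans h4.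
  have -> : k.+1%:R * ((tnth z i - a) * k.+1%:R) = k.+1%:R ^+ 2 * (tnth z i - a) by ring.
  by rewrite lerDr.
(* Here t is at least k + 1. On the hyperplane z_i = a the outer factor of [t] alone achieves this
   and makes the half-space open. *)
apply: (@cvg_le_harmonic _ _ 1) => k; rewrite subr0 ger0_norm ?expR_ge0// mulN1r.
rewrite expRN mul1r lef_pV2 ?posrE ?expR_gt0//.
apply: le_trans (expR_ge1Dx _); apply: (@le_trans _ _ (t k z)); last by rewrite lerDr.
apply: ler_peMr; first exact: ltW.
apply: le_trans (expR_ge1Dx _).
by rewrite lerDl mulr_ge0 ?sqr_ge0// subr_ge0 leNgt.
Qed.

Definition multiplier_set E := measurable E /\ multiplier (\1_E).

Lemma multiplier_setC E : multiplier_set E -> multiplier_set (~` E).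
Proof.
move=> [mE hE]; split; first exact: measurableC.
have := multiplierD (multiplier_cst 1) (multiplierM (multiplier_cst (-1)) hE); congr multiplier; apply/funext => z.
by rewrite !indicE in_setC; case: (z \in E) => /=; ring.
Qed.

Lemma multiplier_set0 : multiplier_set set0.
Proof. by split => //; have := multiplier_cst 0; congr multiplier; rewrite indic0. Qed.

Lemma multiplier_setU E F : multiplier_set E -> multiplier_set F -> multiplier_set (E `|` F).
Proof.
move=> [mE hE] [mF hF]; split; first exact: measurableU.
have := multiplierD (multiplierD hE hF) (multiplierM (multiplier_cst (-1)) (multiplierM hE hF)); congr multiplier; apply/funext => z.
by rewrite !indicE in_setU; case: (z \in E); case: (z \in F) => /=; ring.
Qed.

Lemma multiplier_set_bigcup (F : nat -> set V) : (forall k, multiplier_set (F k)) -> multiplier_set (\bigcup_k F k).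
Proof.
move=> hF; have mU : measurable (\bigcup_k F k) by apply: bigcup_measurable => k _; case: (hF k).
have hU k : multiplier_set (\big[setU/set0]_(j < k) F j).
  by elim: k => [|k IH]; [rewrite big_ord0; exact: multiplier_set0|rewrite big_ord_recr; exact: multiplier_setU].
split => //; apply: (@multiplier_lim 1 (fun k => \1_(\big[setU/set0]_(j < k) F j))).
- exact: measurable_indic.
- by move=> k; case: (hU k).
- by move=> k z _; rewrite indicE; case: (_ \in _); rewrite ?normr1 ?normr0.
move=> z; apply: cvg_near_cst; rewrite !indicE.
have [zU|zU] := boolP (z \in \bigcup_k F k).
  have [j _ Fj] := set_mem zU; exists j.+1 => // k /= jk.
  by rewrite indicE mem_set// -bigcup_mkord; exists j.
apply: nearW => k; rewrite indicE memNset// -bigcup_mkord => -[j _ Fj].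
by move/negP: zU; apply; apply: mem_set; exists j.
Qed.

Lemma multiplier_set_sigma_algebra : sigma_algebra setT multiplier_set.
Proof.
split; [exact: multiplier_set0|by move=> E hE; rewrite setTD; exact: multiplier_setC|exact: multiplier_set_bigcup].
Qed.

(** The sets [B] with this property form a sigma-algebra containing the open rays, which generate
    the Borel sets. *)
Lemma multiplier_set_preimage i (B : set R) : measurable B -> multiplier_set ((fun z => tnth z i) @^-1` B).
Proof.
pose D := [set B : set R | multiplier_set ((fun z => tnth z i) @^-1` B)].
have sD : sigma_algebra setT D.
  split; first by rewrite /D/= preimage_set0; exact: multiplier_set0.
  - by move=> A; rewrite /D/= setTD preimage_setC; exact: multiplier_setC.
  - by move=> F hF; rewrite /D/= preimage_bigcup; exact: multiplier_set_bigcup.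
move=> mB; have mB' : (@RGenOInfty.G R).-sigma.-measurable B.
  by rewrite -RGenOInfty.measurableE; exact: mB.
apply: (smallest_sub sD _ mB') => A [a ->]; rewrite /D/=; split.
  have := @measurable_tnth _ R n i measurableT `]a, +oo[%classic.
  by rewrite setTI; apply; exact: measurable_itv.
have := multiplier_gt i a; congr (multiplier (\1_ _)).
by apply/seteqP; split => z /=; rewrite in_itv/= andbT.
Qed.

Lemma measurable_multiplier_set E : measurable E -> multiplier_set E.
Proof.
move=> mE; apply: (smallest_sub multiplier_set_sigma_algebra _ mE) => A.
rewrite -bigcup_seq => -[i _ [B mB <-]]; rewrite setTI.
exact: multiplier_set_preimage.
Qed.

(** The function 2 1_E - 1, with E the set where [w] is nonnegative, is a multiplier and a sign of
    [w]; the moment of order zero then says that the integral of |w| is 0. *)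
Lemma zero_moments_ae w : zero_moments w -> {ae m, forall z, w z = 0}.
Proof.
move=> mw; have [iw _ _] := mw; have mwm := Rintegrable_measurable iw.
pose E := [set z | 0 <= w z].
have mE : measurable E.
  have := mwm measurableT `[0, +oo[%classic (measurable_itv _); rewrite setTI; congr (measurable _).
  by apply/seteqP; split => z /=; rewrite in_itv/= andbT.
have [_ hE] := measurable_multiplier_set mE.
have [_ /(_ _ mw) [_ _ /(_ [::]) h]] := multiplierD (multiplier_cst (-1)) (multiplierM (multiplier_cst 2) hE).
have h0 : (\int[m]_z `|w z|)%R = 0.
  rewrite -[RHS]h; apply: eq_Rintegral => z _; rewrite /mon big_nil mul1r.
  have -> : \1_E z = (0 <= w z)%R%:R :> R.
    by rewrite indicE; congr (nat_of_bool _)%:R; apply/idP/idP; rewrite inE.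
  have [w0|w0] := boolP (0 <= w z); first by rewrite ger0_norm//=; ring.
  by rewrite ltr0_norm ?ltNge//=; ring.
have : (\int[m]_z `|(w z)%:E| = 0)%E by have := RintegrableE (Rintegrable_abs iw); rewrite h0 => /esym.
have mE' : measurable_fun setT (fun z => (w z)%:E) by exact/measurable_EFinP.
move/(ae_eq_integral_abs m measurableT mE'); apply: filterS => z /(_ Logic.I) [].
by [].
Qed.

End Moments.

(** * Injectivity of the convolution operator *)

Section Injectivity.
Context {R : realType} (n : nat).
Local Notation V := (n.-tuple R).
Local Notation m := (@mu R n).
Implicit Types (f g h u v P Q : V -> R) (x y z : V).

Definition clamp (k : nat) (t : R) : R := Num.max (- k%:R) (Num.min t k%:R).

Lemma measurable_clamp k : measurable_fun setT (clamp k).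
Proof.
apply: measurable_maxr; first exact: measurable_cst.
by apply: measurable_minr; [exact: measurable_id|exact: measurable_cst].
Qed.

Lemma clamp_le k t : `|clamp k t| <= k%:R.
Proof.
rewrite ler_norml /clamp le_max lexx /= ge_max ge_min lexx orbT andbT.
by rewrite (@le_trans _ _ 0) ?oppr_le0.
Qed.

(** The Lipschitz constant 1 lets truncated coordinate differences be dominated, uniformly in [k],
    by the true ones. *)
Lemma clamp_lip k a b : `|clamp k a - clamp k b| <= `|a - b|.
Proof.
have maxl (c x y : R) : `|Num.max c x - Num.max c y| <= `|x - y|.
  rewrite /Order.max; case: (ltP c x) => h1; case: (ltP c y) => h2;
  by rewrite ler_norml; case: (ger0P (x - y)) => h5; apply/andP; split; lra.
have minl (c x y : R) : `|Num.min x c - Num.min y c| <= `|x - y|.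
  rewrite /Order.min; case: (ltP x c) => h1; case: (ltP y c) => h2;
  by rewrite ler_norml; case: (ger0P (x - y)) => h5; apply/andP; split; lra.
exact: le_trans (maxl _ _ _) (minl _ _ _).
Qed.

Lemma clamp_cvg t : clamp k t @[k --> \oo] --> t.
Proof.
apply: cvg_near_cst; exists (Num.bound t) => // k /= bk.
have kt : `|t| <= k%:R.
  apply: le_trans (ltW (archi_boundP (normr_ge0 t))) _; rewrite ler_nat.
  by apply: leq_trans bk; rewrite /Num.bound /= normr_id.
move: kt; rewrite ler_norml => /andP[h1 h2].
by rewrite /clamp min_l// max_r.
Qed.

Lemma inner0l g : inner m (fun=> 0) g = 0.
Proof. by rewrite /inner; under eq_Rintegral do rewrite mul0r; rewrite Rintegral_cst// mul0r. Qed.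

(** Coordinates are at most 1 in absolute value on the ball, so the constant [M] is kept. *)
Lemma kern_coord M Q i : kern_le M Q -> kern_le M (fun z => tnth z i * Q z).
Proof.
move=> [mQ M0 QM]; split => //; first by apply: measurable_funM => //; exact: measurable_tnth.
move=> z; rewrite normrM; have [z1|z1] := boolP (sqn z <= 1).
  by apply: le_trans (QM z); rewrite ler_piMl// coord_le1.
have := QM z; rewrite /unit_ball (negbTE z1) mulr0 normr_le0 => /eqP ->.
by rewrite normr0 mulr0.
Qed.

(* Pairing [u := Q_i * g], where [Q_i z := z_i Q z], with the commutator of the
   clamped coordinate multiplier and convolution by [Q] gives [0], because
   [Q * u = Q_i * (Q * g) = 0]; in the limit the pairing becomes [<u, u>]. *)
Lemma Rconv_coord s Q g i : kern Q -> parity s Q -> isL2 m g ->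
  {ae m, forall x, Rconv Q g x = 0} -> {ae m, forall x, Rconv (fun z => tnth z i * Q z) g x = 0}.
Proof.
move=> kQ pQ lg Qg0; have [M kQM] := kQ; have [mQ M0 QM] := kQM.
pose Qi z := tnth z i * Q z; have kQiM : kern_le M Qi by exact: kern_coord.
have kQi : kern Qi by exists M.
pose u := Rconv Qi g; have lu : isL2 m u by exact: L2_Rconv.
have lQg := L2_Rconv kQ lg.
(* This holds at every point: the value is an inner product with [Q * g], which does not see null
   sets. *)
have Qu0 x : Rconv Q u x = 0.
  rewrite /u (RconvC x kQ kQi lg); have lq := L2_subl x (kern_L2 kQi).
  transitivity (inner m (Rconv Q g) (fun y => Qi (vsub x y))); first exact: innerC.
  by rewrite (ae_inner Qg0 lQg (L2_0 m) lq) inner0l.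
apply: inner_eq0 => //.
have mc k : measurable_fun setT (fun z : V => clamp k (tnth z i)).
  by apply: (measurableT_comp (measurable_clamp k)); exact: measurable_tnth.
have lc k f : isL2 m f -> isL2 m (fun z => clamp k (tnth z i) * f z).
  move=> lf; apply: (L2_le (g := fun z => k%:R * `|f z|)).
  - by apply: measurable_funM => //; case: lf.
  - by apply: L2_scale; exact: L2_abs.
  by move=> z; rewrite normrM ler_wpM2r// clamp_le.
pose D (p : V * V) := `|u p.1| * (M * (unit_ball (vsub p.1 p.2) * `|g p.2|)).
pose F (p : V * V) := u p.1 * (Qi (vsub p.1 p.2) * g p.2).
pose F_ k (p : V * V) := u p.1 *
  ((clamp k (tnth p.1 i) - clamp k (tnth p.2 i)) * (Q (vsub p.1 p.2) * g p.2)).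
have mu1 : measurable_fun setT (fun p : V * V => u p.1) := measurableT_comp lu.1 measurable_fst.
have mg2 : measurable_fun setT (fun p : V * V => g p.2) := measurableT_comp lg.1 measurable_snd.
have mD : measurable_fun setT D.
  apply: measurable_funM; first exact: measurableT_comp.
  apply: measurable_funM => //; apply: measurable_funM; last exact: measurableT_comp.
  by apply: measurable_sub2; exact: measurable_unit_ball.
have mF : measurable_fun setT F.
  apply: measurable_funM => //; apply: measurable_funM => //.
  by apply: measurable_sub2; case: kQiM.
have mF_ k : measurable_fun setT (F_ k).
  apply: measurable_funM => //; apply: measurable_funM.
    apply: measurable_funB.
      exact: (measurableT_comp (mc k) measurable_fst).
    exact: (measurableT_comp (mc k) measurable_snd).
  by apply: measurable_funM => //; exact: measurable_sub2.
have FD p : `|F p| <= D p.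
  rewrite /F /D !normrM ler_wpM2l// mulrA ler_wpM2r//.
  by case: kQiM => _ _ /(_ (vsub p.1 p.2)); rewrite /Qi normrM.
have F_D k p : `|F_ k p| <= D p.
  apply: le_trans (FD p); rewrite /F_ /F /Qi !normrM ler_wpM2l// tnth_vsub.
  by rewrite mulrA; do 2 rewrite ler_wpM2r//; exact: clamp_lip.
have iD : Rintegrable (m \x m)%E D.
  apply: (Rintegrable_Rconv_prod M0 lu lg mD) => p.
  by rewrite ger0_norm// /D !mulr_ge0// unit_ball_ge0.
have F_F p : F_ k p @[k --> \oo] --> F p.
  have -> : F p = u p.1 * ((tnth p.1 i - tnth p.2 i) * (Q (vsub p.1 p.2) * g p.2)).
    by rewrite /F /Qi tnth_vsub; ring.
  apply: cvgM; first exact: cvg_cst.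
  apply: cvgM; last exact: cvg_cst.
  by apply: cvgB; exact: clamp_cvg.
have int0 k : (\int[(m \x m)%E]_p F_ k p)%R = 0.
  have iF_ : Rintegrable (m \x m)%E (F_ k) by apply: Rintegrable_le (mF_ k) iD (F_D k).
  have lcg := lc k _ lg; have lcu := lc k _ lu; have lQcg := L2_Rconv kQ lcg.
  apply: (etrans (Rfubini1 iF_)).
  transitivity (\int[m]_x ((clamp k (tnth x i) * u x) * Rconv Q g x -
      u x * Rconv Q (fun z => clamp k (tnth z i) * g z) x))%R.
    apply: eq_Rintegral => x _.
    have i1 := Rconv_integrable x kQ lg; have i2 := Rconv_integrable x kQ lcg.
    transitivity (u x * (clamp k (tnth x i) * Rconv Q g x -
      Rconv Q (fun z => clamp k (tnth z i) * g z) x)); last by ring.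
    rewrite -(RintegrableZl _ i1); have i1' := RintegrableZ (clamp k (tnth x i)) i1.
    rewrite /Rconv -(RintegralB measurableT i1' i2).
    have i3 := integrableB measurableT i1' i2.
    apply: (etrans _ (RintegrableZl (u x) i3)); apply: eq_Rintegral => y _.
    by rewrite /F_/=; ring.
  apply: (etrans (RintegralB measurableT (L2_mul lcu lQg) (L2_mul lu lQcg))).
  have e1 : inner m (fun x => clamp k (tnth x i) * u x) (Rconv Q g) = 0.
    by rewrite innerC (ae_inner Qg0 lQg (L2_0 m) lcu) inner0l.
  have e2 : inner m u (Rconv Q (fun z => clamp k (tnth z i) * g z)) = 0.
    rewrite (inner_Rconv kQ pQ lu lcg); have -> : Rconv Q u = fun=> 0 by apply/funext.
    by rewrite inner0l mulr0.
  by rewrite -/(inner m _ _) e1 -/(inner m _ _) e2 subrr.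
have key := Rdominated_cvg mF_ mF iD F_D F_F.
have iF : Rintegrable (m \x m)%E F by apply: Rintegrable_le mF iD FD.
have <- : (\int[(m \x m)%E]_p F p)%R = inner m u u.
  apply: (etrans (Rfubini1 iF)); apply: eq_Rintegral => x _.
  have e := RintegrableZl (u x) (Rconv_integrable x kQi lg).
  by apply: (etrans _ e); apply: eq_Rintegral.
apply: (cvg_unique _ key) => //=.
by under eq_fun do rewrite int0; exact: cvg_cst.
Qed.

Lemma Rconv_mon P g s : kern P -> parity 1 P -> isL2 m g -> {ae m, forall x, Rconv P g x = 0} ->
  [/\ kern (fun z => mon s z * P z), exists e, parity e (fun z => mon s z * P z) &
   {ae m, forall x, Rconv (fun z => mon s z * P z) g x = 0}].
Proof.
move=> kP pP lg h; elim: s => [|i s [k1 [e p1] h1]].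
  have -> : (fun z => mon [::] z * P z) = P by apply/funext => z; rewrite /mon big_nil mul1r.
  by split => //; exists 1.
have -> : (fun z => mon (i :: s) z * P z) = (fun z => tnth z i * (mon s z * P z)).
  by apply/funext => z; rewrite /mon big_cons mulrA.
split; first by have [M kM] := k1; exists M; exact: kern_coord.
- by exists (- e) => x y; rewrite p1 !tnth_vsub; ring.
exact: Rconv_coord k1 p1 lg h1.
Qed.

Lemma Rconv_inj P g : kern P -> parity 1 P -> (0 < \int[m]_z `|P z|%:E)%E -> isL2 m g ->
  {ae m, forall x, Rconv P g x = 0} -> {ae m, forall x, g x = 0}.
Proof.
move=> kP pP P0 lg h; have [M [mP M0 PM]] := kP.
(* Monomials are enumerated by [pickle], so a single null set of [x] serves all of them. *)
have hs : {ae m, forall x, forall j, Rconv (fun z => mon (odflt [::] (unpickle j)) z * P z) g x = 0}.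
  by apply: ae_foralln => j; have [] := Rconv_mon (odflt [::] (unpickle j)) kP pP lg h.
have h0 : {ae m, forall x, (\int[m]_y (`|P (vsub x y)| * `|g y|)%:E = 0)%E}.
  apply: filterS hs => x hx; pose w z := P z * g (vsub x z).
  have mw0 : measurable_fun setT w by apply: measurable_funM => //; exact: measurable_subl lg.1.
  have mw : zero_moments w.
    split.
    - exact: L2_mul (kern_L2 kP) (L2_subl x lg).
    - move=> z z1; have := PM z; rewrite /unit_ball (negbTE z1) mulr0 normr_le0 => /eqP P0z.
      by rewrite /w P0z mul0r.
    (* Reflecting [y] to [x - y] turns the convolution at [x] into a moment of [w]. *)
    move=> s; have := hx (pickle s); rewrite pickleK /= => <-.
    apply: (etrans (esym (integral_vsubl x (measurable_funM (measurable_mon s) mw0)))).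
    by apply: eq_Rintegral => y _; rewrite /w /= vsubK mulrA.
  have mE : measurable_fun setT (fun z => `|w z|%:E) by apply/measurable_EFinP; exact: measurableT_comp.
  have E0 z : (0 <= `|w z|%:E)%E by rewrite lee_fin.
  transitivity (\int[m]_z `|w z|%:E)%E.
    apply: (etrans _ (ge0_integral_vsubl x mE E0)).
    by apply: eq_integral => y _; rewrite /w vsubK normrM.
  transitivity (\int[m]_z (cst 0%E) z)%E; last exact: integral0.
  apply: ae_eq_integral => //.
  by apply: filterS (zero_moments_ae mw) => z e _; rewrite e normr0.
have mabs f : measurable_fun setT f -> measurable_fun setT (fun z => `|f z|).
  exact: measurableT_comp.
have h1 := ge0_integral_Rconv (mabs _ mP) (mabs _ lg.1) (fun z => normr_ge0 _) (fun z => normr_ge0 _).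
have mF : measurable_fun setT (fun p : V * V => (`|P (vsub p.1 p.2)| * `|g p.2|)%:E).
  apply/measurable_EFinP; apply: measurable_funM.
    exact: measurable_sub2 (mabs _ mP).
  exact: (measurableT_comp (mabs _ lg.1) measurable_snd).
have F0 (p : V * V) : (0 <= (`|P (vsub p.1 p.2)| * `|g p.2|)%:E)%E by rewrite lee_fin mulr_ge0.
have m1 := measurable_fun_fubini_tonelli_F (m2 := m) _ mF F0.
have z1 : (\int[m]_x \int[m]_y (`|P (vsub x y)| * `|g y|)%:E = 0)%E.
  transitivity (\int[m]_z (cst 0%E) z)%E; last exact: integral0.
  apply: ae_eq_integral => //.
  by apply: filterS h0 => x e _.
(* The double integral, which is 0, is the product of the L^1 norms of [P] and [g], and the first is
   positive. *)
have : (\int[m]_y `|g y|%:E = 0)%E.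
  move: h1; rewrite z1 => /esym/eqP; rewrite mule_eq0 (gt_eqF P0)/= => /eqP.
  exact.
have mE : measurable_fun setT (fun z => (g z)%:E) by apply/measurable_EFinP; case: lg.
move/(ae_eq_integral_abs m measurableT mE); apply: filterS => z /(_ Logic.I) [].
by [].
Qed.

End Injectivity.

(** * Uniqueness of the native space *)

Section RKHS.
Context {R : realType} (n : nat).
Local Notation V := (n.-tuple R).
Variable K : V -> V -> R.

Definition comb (s : seq (R * V)) : V -> R := fun x => \sum_(p <- s) p.1 * K x p.2.

Lemma comb_cat s t : comb (s ++ t) = (fun x => comb s x + comb t x).
Proof. by apply/funext => x; rewrite /comb big_cat. Qed.

Definition scale_comb (a : R) (s : seq (R * V)) := [seq (a * p.1, p.2) | p <- s].

Lemma comb_scale a s : comb (scale_comb a s) = (fun x => a * comb s x).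
Proof.
by apply/funext => x; rewrite /comb big_map mulr_sumr; apply: eq_bigr => p _; rewrite mulrA.
Qed.

Section Basics.
Variables (H : set (V -> R)) (ip : (V -> R) -> (V -> R) -> R).
Hypothesis hH : is_RKHS H ip K.
Implicit Types f g h : V -> R.

Let rkD f g : H f -> H g -> H (fun x => f x + g x).
Proof. by have [_ [h _]] := hH; exact: h. Qed.

Let rkZ a f : H f -> H (fun x => a * f x).
Proof. by have [_ [_ [h _]]] := hH; exact: h. Qed.

Let ipDl f g h : H f -> H g -> H h -> ip (fun x => f x + g x) h = ip f h + ip g h.
Proof. by have [_ [_ [_ [k _]]]] := hH; exact: k. Qed.

Let ipZl a f g : H f -> H g -> ip (fun x => a * f x) g = a * ip f g.
Proof. by have [_ [_ [_ [_ [k _]]]]] := hH; exact: k. Qed.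

Let ipC f g : H f -> H g -> ip f g = ip g f.
Proof. by have [_ [_ [_ [_ [_ [k _]]]]]] := hH; exact: k. Qed.

Let ip_ge0 f : H f -> 0 <= ip f f.
Proof. by have [_ [_ [_ [_ [_ [_ [k _]]]]]]] := hH; exact: k. Qed.

Let rkK y : H (fun x => K x y).
Proof. by have [_ [_ [_ [_ [_ [_ [_ [_ [_ [k _]]]]]]]]]] := hH; exact: k. Qed.

Lemma rkhs_rep f y : H f -> f y = ip f (fun x => K x y).
Proof. by have [_ [_ [_ [_ [_ [_ [_ [_ [_ [_ k]]]]]]]]]] := hH; exact: k. Qed.

Lemma rkhs_sub f g : H f -> H g -> H (fun x => f x - g x).
Proof.
move=> hf hg; have := rkD hf (rkZ (-1) hg); congr H.
by apply/funext => x; rewrite mulN1r.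
Qed.

Lemma rkhs_subZ t f g : H f -> H g ->
  ip (fun x => f x - t * g x) (fun x => f x - t * g x) = ip f f - 2 * t * ip f g + t ^+ 2 * ip g g.
Proof.
move=> hf hg; have htg := rkZ (- t) hg.
have -> : (fun x => f x - t * g x) = (fun x => f x + (- t) * g x) by apply/funext => x; rewrite mulNr.
have hs := rkD hf htg.
rewrite (ipDl hf htg hs) (ipZl _ hg hs) (ipC hf hs) (ipC hg hs).
rewrite (ipDl hf htg hf) (ipDl hf htg hg) !(ipZl _ hg)// (ipC hg hf); ring.
Qed.

Lemma rkhs_subE f g : H f -> H g ->
  ip (fun x => f x - g x) (fun x => f x - g x) = ip f f - 2 * ip f g + ip g g.
Proof.
move=> hf hg; have := rkhs_subZ 1 hf hg; rewrite mulr1 expr1n mul1r => <-.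
by congr (ip _ _); apply/funext => x; rewrite mul1r.
Qed.

Lemma rkhs_comb s : H (comb s).
Proof.
elim: s => [|p s IH].
  have -> : comb [::] = fun=> 0 by apply/funext => x; rewrite /comb big_nil.
  by case: hH.
have -> : comb (p :: s) = (fun x => p.1 * K x p.2 + comb s x).
  by apply/funext => x; rewrite /comb big_cons.
by apply: rkD => //; apply: rkZ.
Qed.

(** The right side mentions only values of [f]; for [f] in the span it is computed from [K] alone,
    so all reproducing inner products agree there. *)
Lemma rkhs_ip_comb f s : H f -> ip f (comb s) = \sum_(p <- s) p.1 * f p.2.
Proof.
move=> hf; elim: s => [|p s IH].
  have -> : comb [::] = fun x => 0 * f x by apply/funext => x; rewrite /comb big_nil mul0r.
  by rewrite big_nil ipC ?ipZl ?mul0r//; exact: rkZ.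
have -> : comb (p :: s) = (fun x => p.1 * K x p.2 + comb s x).
  by apply/funext => x; rewrite /comb big_cons.
have hK := rkZ p.1 (rkK p.2); have hs := rkhs_comb s.
rewrite (ipC hf (rkD hK hs)) (ipDl hK hs hf) (ipZl _ (rkK _) hf) (ipC hs hf) IH.
by rewrite (ipC (rkK _) hf) -(rkhs_rep _ hf) big_cons.
Qed.

Lemma rkhs_point f y : H f -> f y ^+ 2 <= ip f f * K y y.
Proof.
move=> hf; have -> : K y y = ip (fun x => K x y) (fun x => K x y) by rewrite -(rkhs_rep y (rkK y)).
rewrite {1}(rkhs_rep y hf); apply: discriminant_le; first exact: ip_ge0.
move=> t; rewrite -(rkhs_subZ t hf (rkK y)); apply: ip_ge0.
by apply: rkhs_sub => //; exact: rkZ.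
Qed.

Lemma rkhs_triangle f g h : H f -> H g -> H h ->
  ip (fun x => f x - g x) (fun x => f x - g x) <=
  2 * ip (fun x => f x - h x) (fun x => f x - h x) + 2 * ip (fun x => g x - h x) (fun x => g x - h x).
Proof.
move=> hf hg hh; have h1 := rkhs_sub hf hh; have h2 := rkhs_sub hg hh.
have e1 : (fun x => f x - g x) = (fun x => (f x - h x) - (g x - h x)) by apply/funext => x; ring.
have := ip_ge0 (rkD h1 h2).
have -> : (fun x => f x - h x + (g x - h x)) = (fun x => (f x - h x) - (-1) * (g x - h x)).
  by apply/funext => x; ring.
by rewrite e1 (rkhs_subZ _ h1 h2) (rkhs_subE h1 h2); lra.
Qed.

Definition rkhs_cvg (u : nat -> V -> R) f := forall e : R, 0 < e -> exists N, forall p, (N <= p)%N ->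
  ip (fun x => u p x - f x) (fun x => u p x - f x) < e.

Lemma rkhs_complete u : (forall j, H (u j)) ->
  (forall e : R, 0 < e -> exists N, forall p q, (N <= p)%N -> (N <= q)%N ->
              ip (fun x => u p x - u q x) (fun x => u p x - u q x) < e) ->
  exists f, H f /\ rkhs_cvg u f.
Proof. by have [_ [_ [_ [_ [_ [_ [_ [_ [k _]]]]]]]]] := hH; exact: k. Qed.

(* A minimising sequence for the distance to the span is Cauchy by the
   parallelogram law, and its limit agrees with [f] at every point. *)
Lemma rkhs_span_dense f : H f -> exists s, rkhs_cvg (fun j => comb (s j)) f.
Proof.
move=> hf; pose N s := ip (fun x => f x - comb s x) (fun x => f x - comb s x).
pose A := range N.
have N0 s : 0 <= N s by apply: ip_ge0; apply: rkhs_sub => //; exact: rkhs_comb.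
have hA : has_inf A by split; [exists (N [::]); exists [::]|exists 0 => _ [s _ <-]].
have infN s : inf A <= N s by apply: ge_inf; [exact: hA.2|exists s].
have hex j : exists s, N s < inf A + j.+1%:R^-1.
  have j0 : 0 < j.+1%:R^-1 :> R by rewrite invr_gt0.
  by have [_ [s _ <-] hs] := inf_adherent j0 hA; exists s.
have [s hs] := choice hex; exists s.
have small e : 0 < e -> exists M, forall p, (M <= p)%N -> p.+1%:R^-1 < e :> R.
  move=> e0; exists (Num.bound e^-1) => p Mp.
  rewrite -[ltRHS]invrK ltf_pV2 ?posrE ?invr_gt0//.
  apply: (@lt_le_trans _ _ (Num.bound e^-1)%:R); first by rewrite archi_boundP// invr_ge0 ltW.
  by rewrite ler_nat leqW.
have hc j : H (comb (s j)) by exact: rkhs_comb.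
have cauchy e : 0 < e -> exists M, forall p q, (M <= p)%N -> (M <= q)%N ->
    ip (fun x => comb (s p) x - comb (s q) x) (fun x => comb (s p) x - comb (s q) x) < e.
  move=> e0; have e4 : 0 < e / 4 by rewrite divr_gt0.
  have [M HM] := small _ e4; exists M => p q Mp Mq.
  have h1 := rkhs_sub hf (hc p); have h2 := rkhs_sub hf (hc q).
  (* This list codes the midpoint of the two combinations, whose distance to [f] is again bounded
     below by the infimum. *)
  have hmid := infN (scale_comb 2^-1 (s p ++ s q)).
  have e1 : N (scale_comb 2^-1 (s p ++ s q)) = 4^-1 *
     (N (s p) + 2 * ip (fun x => f x - comb (s p) x) (fun x => f x - comb (s q) x) + N (s q)).
    rewrite /N comb_scale comb_cat.
    have -> : (fun x => f x - 2^-1 * (comb (s p) x + comb (s q) x)) =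
      (fun x => 2^-1 * ((f x - comb (s p) x) - (-1) * (f x - comb (s q) x))).
      by apply/funext => x; field.
    have h3 : H (fun x => (f x - comb (s p) x) - (-1) * (f x - comb (s q) x)).
      by apply: rkhs_sub => //; exact: rkZ.
    have h4 := rkZ 2^-1 h3.
    rewrite (ipZl _ h3 h4) (ipC h3 h4) (ipZl _ h3 h3) (rkhs_subZ _ h1 h2).
    by field.
  have -> : (fun x => comb (s p) x - comb (s q) x) =
      (fun x => (f x - comb (s q) x) - (f x - comb (s p) x)) by apply/funext => x; ring.
  rewrite (rkhs_subE h2 h1) (ipC h2 h1) -/(N (s p)) -/(N (s q)).
  have := hs p; have := hs q; have := HM _ Mp; have := HM _ Mq; move: hmid; rewrite e1.
  move: (N (s p)) (N (s q)) (inf A) (ip _ _) (p.+1%:R^-1) (q.+1%:R^-1) => ? ? ? ? ? ?.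
  lra.
have [g [hg cg]] := rkhs_complete hc cauchy.
suff -> : f = g by [].
apply/funext => y; apply/eqP; rewrite -subr_eq0 -sqrf_eq0; apply/eqP/le_anti.
rewrite sqr_ge0 andbT; apply/ler_addgt0Pr => e e0; rewrite add0r.
have K0 : 0 <= K y y by rewrite (rkhs_rep y (rkK y)); exact: ip_ge0.
have d0 : 0 < e / (4 * (K y y + 1)) by rewrite divr_gt0// mulr_gt0// ltr_wpDl.
have [M1 HM1] := small _ d0; have [M2 HM2] := cg _ d0.
pose p := maxn M1 M2; have := HM1 p (leq_maxl _ _); have := HM2 p (leq_maxr _ _).
have h1 := rkhs_sub hf (hc p); have h2 := rkhs_sub (hc p) hg.
have b2 := rkhs_point y h2.
(* A near minimiser is nearly orthogonal to the section at [y]: adding a multiple of it cannot go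
   below the infimum, and the discriminant gives the bound. *)
have b1 : (f y - comb (s p) y) ^+ 2 <= (N (s p) - inf A) * K y y.
  have -> : K y y = ip (fun x => K x y) (fun x => K x y) by rewrite -(rkhs_rep y (rkK y)).
  have -> : f y - comb (s p) y = ip (fun x => f x - comb (s p) x) (fun x => K x y).
    exact: (rkhs_rep y h1).
  apply: discriminant_le; first exact: ip_ge0.
  move=> t; have := infN (s p ++ [:: (t, y)]).
  have -> : N (s p ++ [:: (t, y)]) = ip (fun x => (f x - comb (s p) x) - t * K x y)
     (fun x => (f x - comb (s p) x) - t * K x y).
    by congr (ip _ _); apply/funext => x; rewrite comb_cat /comb/= big_seq1 /=; ring.
  by rewrite (rkhs_subZ _ h1 (rkK y)) -/(N (s p)); lra.
have := hs p; move: b1 b2.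
move: (N (s p)) (inf A) (ip _ _) => a b c; move: (f y) (comb (s p) y) (g y) (p.+1%:R^-1) => fy uy gy ip'.
move: K0 d0; move: (K y y) => k k0; set d := e / _ => d0 b1 b2 h3 h4 h5.
have dk : 4 * d * (k + 1) = e by rewrite /d; field; lra.
have := sqr_ge0 ((fy - uy) - (uy - gy)).
nra.
Qed.

End Basics.

(** Combinations approximating [f] in [H] are Cauchy in [H'], since both norms agree on the span.
    Convergence in norm implies pointwise convergence in each space, so the limit in [H'] is [f]
    itself. *)
Lemma rkhs_unique_sub (H H' : set (V -> R)) ip ip' : is_RKHS H ip K -> is_RKHS H' ip' K ->
  forall f, H f -> H' f /\ ip f f = ip' f f.
Proof.
move=> hH hH' f hf; have [s cs] := rkhs_span_dense hH hf.
have hc j : H (comb (s j)) by exact: (rkhs_comb hH).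
have hc' j : H' (comb (s j)) by exact: (rkhs_comb hH').
have [g [hg cg]] : exists g, H' g /\ rkhs_cvg ip' (fun j => comb (s j)) g.
  apply: (rkhs_complete hH') => // e e0; have e4 : 0 < e / 4 by rewrite divr_gt0.
  have [M HM] := cs _ e4; exists M => p q Mp Mq.
  have E : (fun x => comb (s p) x - comb (s q) x) = comb (s p ++ scale_comb (-1) (s q)).
    by rewrite comb_cat comb_scale; apply/funext => x; rewrite mulN1r.
  have -> : ip' (fun x => comb (s p) x - comb (s q) x) (fun x => comb (s p) x - comb (s q) x) =
      ip (fun x => comb (s p) x - comb (s q) x) (fun x => comb (s p) x - comb (s q) x).
    rewrite {2 4}E (rkhs_ip_comb hH' _ (rkhs_sub hH' (hc' p) (hc' q))).
    by rewrite (rkhs_ip_comb hH _ (rkhs_sub hH (hc p) (hc q))).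
  have := rkhs_triangle hH (hc p) (hc q) hf; have := HM p Mp; have := HM q Mq.
  lra.
have fg : f = g.
  apply/funext => y; apply/eqP; rewrite -subr_eq0 -sqrf_eq0; apply/eqP/le_anti.
  rewrite sqr_ge0 andbT; apply/ler_addgt0Pr => e e0; rewrite add0r.
  have K0 : 0 <= K y y.
    have hK : H (fun x => K x y) by have [_ [_ [_ [_ [_ [_ [_ [_ [_ [k _]]]]]]]]]] := hH; exact: k.
    have := rkhs_rep hH y hK => ->.
    by have [_ [_ [_ [_ [_ [_ [k _]]]]]]] := hH; exact: k.
  have d0 : 0 < e / (4 * (K y y + 1)) by rewrite divr_gt0// mulr_gt0// ltr_wpDl.
  have [M1 HM1] := cs _ d0; have [M2 HM2] := cg _ d0.
  pose p := maxn M1 M2; have := HM1 p (leq_maxl _ _); have := HM2 p (leq_maxr _ _).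
  have b1 := rkhs_point hH y (rkhs_sub hH (hc p) hf).
  have b2 := rkhs_point hH' y (rkhs_sub hH' (hc' p) hg).
  move: b1 b2; move: (ip' _ _) (ip _ _) => a b; move: (f y) (comb (s p) y) (g y) => fy uy gy.
  move: K0 d0; move: (K y y) => k k0; set d := e / _ => d0 b1 b2 h3 h4.
  have dk : 4 * d * (k + 1) = e by rewrite /d; field; lra.
  have := sqr_ge0 ((fy - uy) + (gy - uy)).
  nra.
split; first by rewrite fg.
rewrite -fg in hg cg; apply/eqP; rewrite -subr_eq0 -normr_eq0; apply/eqP/le_anti.
rewrite normr_ge0 andbT; apply/ler_addgt0Pr => e e0; rewrite add0r.
have [M1 HM1] := cs _ e0; have [M2 HM2] := cg _ e0.
pose p := maxn M1 M2; have h1 := HM1 p (leq_maxl _ _); have h2 := HM2 p (leq_maxr _ _).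
have g1 : 0 <= ip (fun x => comb (s p) x - f x) (fun x => comb (s p) x - f x).
  have [_ [_ [_ [_ [_ [_ [k _]]]]]]] := hH; apply: k; exact: (rkhs_sub hH).
have g2 : 0 <= ip' (fun x => comb (s p) x - f x) (fun x => comb (s p) x - f x).
  have [_ [_ [_ [_ [_ [_ [k _]]]]]]] := hH'; apply: k; exact: (rkhs_sub hH').
(* In the two expansions the terms involving [comb (s p)] coincide, so the squared norms of [f]
   differ by less than [e]. *)
move: h1 h2 g1 g2; rewrite (rkhs_subE hH (hc p) hf) (rkhs_subE hH' (hc' p) hg).
have -> : ip' (comb (s p)) (comb (s p)) = ip (comb (s p)) (comb (s p)).
  by rewrite (rkhs_ip_comb hH' _ (hc' p)) (rkhs_ip_comb hH _ (hc p)).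
have -> : ip' (comb (s p)) f = ip (comb (s p)) f.
  have [_ [_ [_ [_ [_ [k _]]]]]] := hH; have [_ [_ [_ [_ [_ [k' _]]]]]] := hH'.
  rewrite (k _ _ (hc p) hf) (k' _ _ (hc' p) hg).
  by rewrite (rkhs_ip_comb hH' _ hg) (rkhs_ip_comb hH _ hf).
by move=> h1 h2 g1 g2; rewrite ler_norml; apply/andP; split; lra.
Qed.

Lemma rkhs_unique (H H' : set (V -> R)) ip ip' : is_RKHS H ip K -> is_RKHS H' ip' K ->
  H = H' /\ forall f, H f -> ip f f = ip' f f.
Proof.
move=> hH hH'; split; last by move=> f /(rkhs_unique_sub hH hH')[].
by apply/seteqP; split => f; [case/(rkhs_unique_sub hH hH')|case/(rkhs_unique_sub hH' hH)].
Qed.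

End RKHS.

(** * The native space of an autoconvolution *)

Section ConvolutionRKHS.
Context {R : realType} (n : nat).
Local Notation V := (n.-tuple R).
Local Notation m := (@mu R n).
Implicit Types (f g h u v Q : V -> R) (x y z : V).

Lemma RintnE f : Rintegrable m f -> Rintn f = (\int[m]_x f x)%R.
Proof.
move=> fi; have mf := Rintegrable_measurable fi; have mE : measurable_fun setT (EFin \o f) by exact/measurable_EFinP.
have ip : (\int[m]_x (EFin \o f)^\+ x)%E \is a fin_num by exact: integrable_fin_num (integrable_funepos measurableT fi).
have im : (\int[m]_x (EFin \o f)^\- x)%E \is a fin_num by exact: integrable_fin_num (integrable_funeneg measurableT fi).
rewrite /Rintegral [X in _ = fine X]integralE /Rintn.
have -> : iint (fun x => (Num.max (f x) 0)%:E) = (\int[m]_x (EFin \o f)^\+ x)%E.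
  rewrite iintE; last 2 first.
  - by apply/measurable_EFinP; apply: measurable_maxr.
  - by move=> x; rewrite lee_fin le_max lexx orbT.
  by apply: eq_integral => x _; rewrite funeposE -fine_max.
have -> : iint (fun x => (Num.max (- f x) 0)%:E) = (\int[m]_x (EFin \o f)^\- x)%E.
  rewrite iintE; last 2 first.
  - by apply/measurable_EFinP; apply: measurable_maxr => //; exact: measurableT_comp.
  - by move=> x; rewrite lee_fin le_max lexx orbT.
  by apply: eq_integral => x _; rewrite funenegE -fine_max.
exact: (esym (fineB ip im)).
Qed.

Lemma L2_isL2 g : L2 g <-> isL2 m g.
Proof.
split=> -[mg gi]; split => //; move: gi; rewrite /sqint iintE//.
- by apply/measurable_EFinP; exact: measurable_funX.
- by move=> x; rewrite lee_fin sqr_ge0.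
- by apply/measurable_EFinP; exact: measurable_funX.
- by move=> x; rewrite lee_fin sqr_ge0.
Qed.

Lemma convolE Q g : kern Q -> isL2 m g -> convol Q g = Rconv Q g.
Proof. by move=> kQ lg; apply/funext => x; apply: RintnE; exact: Rconv_integrable. Qed.

Lemma RconvD Q g h : kern Q -> isL2 m g -> isL2 m h ->
  Rconv Q (fun x => g x + h x) = (fun x => Rconv Q g x + Rconv Q h x).
Proof.
move=> kQ lg lh; apply/funext => x; rewrite /Rconv.
apply: (etrans _ (RintegralD measurableT (Rconv_integrable x kQ lg) (Rconv_integrable x kQ lh))).
by apply: eq_Rintegral => y _; rewrite mulrDr.
Qed.

Lemma RconvZ Q a g : kern Q -> isL2 m g -> Rconv Q (fun x => a * g x) = (fun x => a * Rconv Q g x).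
Proof.
move=> kQ lg; apply/funext => x; rewrite /Rconv.
apply: (etrans _ (RintegrableZl a (Rconv_integrable x kQ lg))).
by apply: eq_Rintegral => y _; rewrite mulrCA.
Qed.

Lemma RconvB Q g h : kern Q -> isL2 m g -> isL2 m h ->
  Rconv Q (fun x => g x - h x) = (fun x => Rconv Q g x - Rconv Q h x).
Proof.
move=> kQ lg lh; have := RconvD kQ lg (L2_scale (-1) lh); rewrite RconvZ// => e.
transitivity (fun x => Rconv Q g x + -1 * Rconv Q h x); last by apply/funext => x; rewrite mulN1r.
by rewrite -e; congr Rconv; apply/funext => x; rewrite mulN1r.
Qed.

Lemma ae_Rconv Q g h : kern Q -> isL2 m g -> isL2 m h -> {ae m, forall x, g x = h x} ->
  Rconv Q g = Rconv Q h.
Proof.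
move=> kQ lg lh gh; apply/funext => x.
have lq := L2_subl x (kern_L2 kQ).
transitivity (inner m g (fun y => Q (vsub x y))); first exact: innerC.
by rewrite (ae_inner gh lg lh lq) innerC.
Qed.

Lemma Rconv0 Q : kern Q -> Rconv Q (fun=> 0) = (fun=> 0).
Proof.
move=> kQ; have := RconvZ 0 kQ (L2_0 m); under eq_fun do rewrite mul0r.
by move=> ->; apply/funext => x; rewrite mul0r.
Qed.

Section WithKernel.
Variable P : V -> R.
Hypotheses (kP : kern P) (pP : parity 1 P) (P0 : (0 < \int[m]_z `|P z|%:E)%E).

Lemma Rconv_eq_ae g h : isL2 m g -> isL2 m h -> Rconv P g = Rconv P h -> {ae m, forall x, g x = h x}.
Proof.
move=> lg lh e; have lgh := L2_sub lg lh.
have : {ae m, forall x, Rconv P (fun x => g x - h x) x = 0}.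
  by apply: aeW => x; rewrite (RconvB kP lg lh) e subrr.
move/(Rconv_inj kP pP P0 lgh); apply: filterS => x /eqP.
by rewrite subr_eq0 => /eqP.
Qed.

(** Written so that each section is by definition a convolution with [P]. For even [P] the preimage
    of the section is an L^2 function. *)
Definition Rconv_kernel x y := Rconv P (fun z => P (vsub z y)) x.
Definition Rconv_range := [set f | exists g, isL2 m g /\ f = Rconv P g].

Lemma L2_subr_even y : isL2 m (fun z => P (vsub z y)).
Proof.
have -> : (fun z => P (vsub z y)) = (fun z => P (vsub y z)).
  by apply/funext => z; rewrite pP mul1r.
exact: L2_subl (kern_L2 kP).
Qed.

Lemma rkhs_Rconv : exists ip, is_RKHS Rconv_range ip Rconv_kernel /\
  forall g, isL2 m g -> ip (Rconv P g) (Rconv P g) = inner m g g.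
Proof.
(* The inner product goes through a chosen preimage; injectivity makes the choice irrelevant up to
   null sets. *)
have hch f : exists g, Rconv_range f -> isL2 m g /\ f = Rconv P g.
  by have [[g hg]|nf] := pselect (Rconv_range f); [exists g|exists (fun=> 0)].
have [ch Hch] := choice hch.
pose ip f h := inner m (ch f) (ch h).
have Hc g : isL2 m g -> Rconv_range (Rconv P g) by move=> lg; exists g.
have ipE g h : isL2 m g -> isL2 m h -> ip (Rconv P g) (Rconv P h) = inner m g h.
  move=> lg lh; have [lg' eg] := Hch _ (Hc _ lg); have [lh' eh] := Hch _ (Hc _ lh).
  rewrite /ip (ae_inner (Rconv_eq_ae lg' lg (esym eg)) lg' lg lh') innerC.
  by rewrite (ae_inner (Rconv_eq_ae lh' lh (esym eh)) lh' lh lg) innerC.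
exists ip; split; last by move=> g lg; exact: ipE.
have KE y : (fun x => Rconv_kernel x y) = Rconv P (fun z => P (vsub z y)) by [].
do 10? split.
- by exists (fun=> 0); split; [exact: L2_0|rewrite Rconv0].
- move=> _ _ [g [lg ->]] [h [lh ->]]; exists (fun x => g x + h x).
  by split; [exact: L2_add|rewrite RconvD].
- move=> a _ [g [lg ->]]; exists (fun x => a * g x).
  by split; [exact: L2_scale|rewrite RconvZ].
- move=> _ _ _ [f [lf ->]] [g [lg ->]] [h [lh ->]].
  by rewrite -RconvD// !ipE//; [exact: innerDl|exact: L2_add].
- move=> a _ _ [f [lf ->]] [g [lg ->]].
  by rewrite -RconvZ// !ipE//; [exact: innerZl|exact: L2_scale].
- by move=> _ _ [f [lf ->]] [g [lg ->]]; rewrite !ipE// innerC.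
- by move=> _ [f [lf ->]]; rewrite ipE// inner_ge0.
- move=> _ [f [lf ->]]; rewrite ipE// => f0.
  by rewrite (ae_Rconv kP lf (L2_0 m) (inner_eq0 lf f0)) Rconv0.
- move=> u hu cu; have [g hg] := choice hu.
  have lg j : isL2 m (g j) by have [] := hg j.
  have ug j : u j = Rconv P (g j) by have [] := hg j.
  have [|f [lf cf]] := @L2_complete _ _ _ m g lg.
    move=> e e0; have [N HN] := cu e e0; exists N => p q Np Nq.
    have := HN p q Np Nq; rewrite !ug -(RconvB kP (lg p) (lg q)) ipE//; exact: L2_sub.
  exists (Rconv P f); split; first exact: Hc.
  move=> e e0; have [N HN] := cf e e0; exists N => p Np.
  by rewrite ug -(RconvB kP (lg p) lf) ipE; [exact: HN|exact: L2_sub|exact: L2_sub].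
- by move=> y; rewrite KE; apply: Hc; exact: L2_subr_even.
(* Evenness of [P] turns the inner product of [f] with the translate of [P] into the convolution at
   [y]. *)
- move=> _ y [f [lf ->]]; rewrite KE ipE//; last exact: L2_subr_even.
  by rewrite innerC; apply: eq_Rintegral => z _; rewrite [in RHS]pP mul1r.
Qed.

End WithKernel.

End ConvolutionRKHS.

(** * Small balls have positive mass *)

Section Mass.
Context {R : realType}.
Local Notation leb := (@lebesgue_measure R).
Local Notation Rm := (measurableTypeR R).

Lemma measurable_sqn_lt n e : measurable_fun setT (fun z : n.-tuple R => (sqn z < e)%R%:R : R).
Proof.
rewrite (_ : (fun _ => _) = \1_[set y | sqn y < e]%R); last first.
  by apply/funext => y; rewrite indicE mem_setE.
apply: measurable_indic; rewrite -[X in measurable X]setTI.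
apply: measurable_fun_ltr => //; exact: measurable_sqn.
Qed.

Lemma integral_sqn_lt_gt0 n e : 0 < e -> (0 < \int[@mu R n]_z ((sqn z < e)%R%:R : R)%:E)%E.
Proof.
have mb j r : measurable_fun setT (fun z : j.-tuple R => ((sqn z < r)%R%:R : R)%:E).
  by apply/measurable_EFinP; exact: measurable_sqn_lt.
have b0 j r (z : j.-tuple R) : (0 <= ((sqn z < r)%R%:R : R)%:E)%E by rewrite lee_fin.
elim: n e => [|n IH] e e0.
  rewrite (integral_mu0 (mb _ _)).
  by have -> : sqn [tuple] = 0 :> R; [rewrite /sqn big_ord0|rewrite e0 lte_fin].
have e2 : 0 < e / 2 by rewrite divr_gt0.
have c0 := IH _ e2; pose c := (\int[@mu R n]_z ((sqn z < e / 2)%R%:R : R)%:E)%E.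
rewrite (ge0_integral_muS (mb _ _) (b0 _ _)).
(* With [x] at most 1, [x ^+ 2] is at most [x], hence at most [e / 4], and the tail has room for
   [e / 2]. *)
pose de := Num.min 1 (e / 4).
have de0 : 0 < de by rewrite lt_min ltr01 divr_gt0.
pose I : set R := `[0, de]%classic.
have mI : measurable (I : set Rm) by exact: measurable_itv.
have m1 : measurable_fun setT (EFin \o (\1_I : Rm -> R)).
  by apply/measurable_EFinP; exact: measurable_indic.
have lI : leb I = de%:E by rewrite /I lebesgue_measure_itv/= lte_fin de0 -EFinB subr0.
apply: (@lt_le_trans _ _ (\int[leb]_x ((\1_I x)%:E * c))%E).
  rewrite ge0_integralZr//; last exact: ltW.
  by rewrite integral_indic// setIT [X in (X * _)%E](_ : _ = de%:E)// mule_gt0// lte_fin.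
apply: ge0_le_integral => //.
- by move=> x _; rewrite mule_ge0 ?lee_fin//; exact: ltW.
- by apply: emeasurable_funM.
- exact: (measurable_mu_tail (mb n.+1 e) (b0 n.+1 e)).
move=> x _; rewrite indicE mem_setE in_itv/=.
case: andP => [[x0 xd]|_]; last by rewrite mul0e; exact: integral_ge0.
rewrite mul1e; apply: ge0_le_integral => //; [exact: mb|exact: (measurable_comp_cons x (mb n.+1 e))|].
move=> z _; rewrite lee_fin sqn_cons ler_nat.
case: ltP => // ze; suff -> : (x ^+ 2 + sqn z < e)%R by [].
move: xd; rewrite le_min => /andP[x1 x4]; nra.
Qed.

End Mass.

(** * The kernel P and its normalising constant *)

Section WuKernel.
Context {R : realType} (k : nat) (l c : R).
Hypotheses (hkl : k%:R <= l) (c0 : 0 < c)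
  (c2 : c ^+ 2 = \prod_(i < k) (2 * (l - i%:R) ^+ 2 / pi)).
Local Notation a := (l - k%:R).
Local Notation V := ((2 * k).+1.-tuple R).
Local Notation m := (@mu R (2 * k).+1).

Definition wuP (x : V) : R := c * rho a (sqn x).

Let a0 : 0 <= a. Proof. by rewrite subr_ge0. Qed.

Let mr : measurable_fun setT (fun x : V => rho a (sqn x)).
Proof. by apply: (measurableT_comp (measurable_rho a)); exact: measurable_sqn. Qed.

Lemma kern_wuP : kern wuP.
Proof.
exists c; split; [exact: measurable_funM|exact: ltW|].
move=> z; rewrite normrM (gtr0_norm c0) ler_pM2l// ger0_norm ?rho_ge0// /unit_ball.
case: (leP (sqn z) 1) => z1; first by rewrite rho_le1 ?sqn_ge0.
by rewrite rho0// ltW.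
Qed.

Lemma sqn_vsubC n (x y : n.-tuple R) : sqn (vsub y x) = sqn (vsub x y).
Proof. by apply: eq_bigr => i _; rewrite !tnth_vsub -sqrrN opprB. Qed.

Lemma parity_wuP : parity 1 wuP.
Proof. by move=> x y; rewrite /wuP sqn_vsubC mul1r. Qed.

(** Where the squared norm is below 1/2, the kernel is at least [c] times 1/2 to the power
    [l - k]. *)
Lemma wuP_mass : (0 < \int[m]_z `|wuP z|%:E)%E.
Proof.
have h2 : 0 < (1 / 2 : R) by [].
have p := integral_sqn_lt_gt0 (2 * k).+1 h2.
pose r := c * (1 / 2) `^ a; have r0 : 0 < r by rewrite mulr_gt0// powR_gt0.
have mb : measurable_fun setT (fun z : V => ((sqn z < 1 / 2)%R%:R : R)%:E).
  by apply/measurable_EFinP; exact: measurable_sqn_lt.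
have [mP _] := kern_L2 kern_wuP.
apply: (@lt_le_trans _ _ (r%:E * \int[m]_z ((sqn z < 1 / 2)%R%:R : R)%:E)%E).
  by rewrite mule_gt0.
have b0 (z : V) : (0 <= ((sqn z < 1 / 2)%R%:R : R)%:E)%E by rewrite lee_fin.
have r0' : (0 <= r%:E)%E by rewrite lee_fin ltW.
rewrite -(@ge0_integralZl _ _ _ m setT measurableT _ mb _ (fun z _ => b0 z) r0').
apply: ge0_le_integral => //.
- by move=> z _; rewrite mule_ge0.
- by apply: emeasurable_funM.
- by apply/measurable_EFinP; exact: measurableT_comp.
move=> z _; rewrite -EFinM lee_fin ger0_norm; last by rewrite mulr_ge0 ?rho_ge0// ltW.
case: ltP => z1; last by rewrite mulr0 mulr_ge0 ?rho_ge0// ltW.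
rewrite mulr1 ler_pM2l// /rho /tpow ifT; last by lra.
by apply: ge0_ler_powR => //; rewrite ?nnegrE//; lra.
Qed.

Lemma Rconv_kernel_wuP x y : Rconv_kernel wuP x y = wu l k (Num.sqrt (sqn (vsub x y))).
Proof.
set w := vsub x y; rewrite (wuE hkl (sqrtr_ge0 _)) -c2.
pose f z := rho a (sqn z) * rho a (sqn (vsub w z)).
have mf : measurable_fun setT f.
  apply: measurable_funM => //; exact: (measurable_subl w mr).
have f0 z : 0 <= f z by rewrite mulr_ge0 ?rho_ge0.
have Qf : (autoconvR (2 * k) a (Num.sqrt (sqn w)))%:E = (\int[m]_z (f z)%:E)%E.
  by rewrite (autoconvRE _ _ a0) -autoconv_radial.
have fi : Rintegrable m f by apply: Rintegrable_ge0 => //; rewrite -Qf ltry.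
have -> : autoconvR (2 * k) a (Num.sqrt (sqn w)) = (\int[m]_z f z)%R.
  by apply: EFin_inj; rewrite (RintegrableE fi).
apply: (etrans _ (RintegrableZl (c ^+ 2) fi)).
have mcf : measurable_fun setT (fun z => c ^+ 2 * f z) by exact: measurable_funM.
apply: (etrans _ (integral_vsubr y mcf)).
apply: eq_Rintegral => z _; rewrite /f /w /wuP.
have -> : vsub (vsub x y) (vsub z y) = vsub x z.
  by apply: eq_from_tnth => i; rewrite !tnth_vsub; ring.
by ring.
Qed.

End WuKernel.

(** Squaring the Gamma quotient gives the product of the (l - i)^2, while squaring the power of 2 /
    pi leaves k factors, one for each i. *)
Lemma wu_constant (R : realType) (k : nat) (l : R) : k%:R <= l ->
  let c := Gamma (l + 1) / Gamma (l - k%:R + 1) * (2 / pi) `^ (k%:R / 2) in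
  0 < c /\ c ^+ 2 = \prod_(i < k) (2 * (l - i%:R) ^+ 2 / pi).
Proof.
move=> kl c; have k0 : 0 <= k%:R :> R by [].
have p0 : 0 < 2 / pi :> R by rewrite divr_gt0// pi_gt0.
split.
  by rewrite /c mulr_gt0 ?powR_gt0// divr_gt0// Gamma_gt0//; lra.
rewrite /c exprMn (Gamma_quotient kl) -[X in _ * X](@powR_mulrn _ _ 2) ?powR_ge0//.
rewrite -powRrM divfK// powR_mulrn ?ltW//.
rewrite -prodrXl -[X in _ ^+ X]card_ord -prodr_const -big_split/=.
by apply: eq_bigr => i _; ring.
Qed.

(** The first part keeps the second from being vacuous. Injectivity is stated up to a null set
    because L^2 elements are functions here, not classes. *)
Theorem theorem3p10 (R : realType) (k : nat) (l : R) (hl0 : 0 <= l) (hkl : k%:R <= l) :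
  let d := (2 * k + 1)%N in
  let Phi := fun x : d.-tuple R => wu l k (norm2 x) in
  let K := fun x y : d.-tuple R => Phi (vsub x y) in
  let P := fun x : d.-tuple R =>
    Gamma (l + 1) / Gamma (l - k%:R + 1) * (2 / pi) `^ (k%:R / 2)
    * tpow (1 - norm2 x ^+ 2) (l - k%:R) in
  (exists (H : set (d.-tuple R -> R)) ip, is_RKHS H ip K) /\
  (forall (H : set (d.-tuple R -> R)) ip, is_RKHS H ip K ->
     [/\ H = [set f | exists g, L2 g /\ f = convol P g],
         (forall g, L2 g -> ip (convol P g) (convol P g) = Rintn (fun x => g x ^+ 2)) &
         (forall g h, L2 g -> L2 h -> convol P g = convol P h ->
            iint (fun x => (g x != h x)%:R%:E) = 0%E)]).
Proof.
move=> d; have hd : d = (2 * k).+1 by rewrite /d addn1.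
clearbody d; subst d; move=> Phi K P.
have [c0 c2] := wu_constant hkl.
have PE : P = wuP l (Gamma (l + 1) / Gamma (l - k%:R + 1) * (2 / pi) `^ (k%:R / 2)).
  by apply/funext => x; rewrite /P /norm2 (sqr_sqrtr (sqn_ge0 x)).
have kP : kern P by rewrite PE; exact: kern_wuP.
have pP : parity 1 P by rewrite PE; exact: parity_wuP.
have P0 : (0 < \int[mu _]_z `|P z|%:E)%E by rewrite PE; exact: wuP_mass.
have KE : K = Rconv_kernel P.
  by apply/funext => x; apply/funext => y; rewrite PE (Rconv_kernel_wuP hkl c2).
have [ip0 [h0 ip0E]] := rkhs_Rconv kP pP P0.
rewrite -KE in h0.
split; first by exists (Rconv_range P), ip0.
move=> H ip hH; have [HH ipE] := rkhs_unique hH h0; split.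
- rewrite HH; apply/seteqP; split => f [g [lg ->]]; exists g; split.
  + exact/L2_isL2.
  + by rewrite convolE.
  + exact/L2_isL2.
  + by rewrite convolE//; exact/L2_isL2.
- move=> g /L2_isL2 lg; rewrite (convolE kP lg) ipE; last by rewrite HH; exists g.
  rewrite (ip0E _ lg) (RintnE (L2_sq lg)).
  by apply: eq_Rintegral => x _; rewrite expr2.
move=> g h /L2_isL2 lg /L2_isL2 lh; rewrite (convolE kP lg) (convolE kP lh) => e.
have gh := Rconv_eq_ae kP pP P0 lg lh e.
(* Inequality of [g] and [h] is expressed through the zero set of their difference, which is
   measurable. *)
have mne : measurable_fun setT (fun x => (g x != h x)%:R : R).
  have mE : measurable [set x | g x - h x = 0].
    have := measurable_funB lg.1 lh.1 measurableT (measurable_set1 0); rewrite setTI.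
    by [].
  rewrite (_ : (fun _ => _) = \1_(~` [set x | g x - h x = 0])).
    by apply: measurable_indic; exact: measurableC.
  apply/funext => x; rewrite indicE; congr (nat_of_bool _)%:R.
  rewrite in_setC -subr_eq0; congr negb; apply/eqP/idP; first exact: mem_set.
  exact: set_mem.
rewrite iintE; last 2 first.
- exact/measurable_EFinP.
- by move=> x; rewrite lee_fin.
transitivity (\int[@mu R (2 * k).+1]_x (cst 0%E) x)%E; last exact: integral0.
apply: ae_eq_integral => //; first exact/measurable_EFinP.
by apply: filterS gh => x gx _; rewrite gx eqxx.
Qed.
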